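(* Let $m\in\mathrm{C}^{\infty}(\mathbb{R}^2\setminus\{(0,0)\})$ be such that for all integers $\beta_1,\beta_2\geq 0$ there is a constant $C_{\beta_1,\beta_2}$ with $$\big|\partial_{\tau_1}^{\beta_1}\partial_{\tau_2}^{\beta_2}m(\tau_1,\tau_2)\big|\leq C_{\beta_1,\beta_2}(|\tau_1|+|\tau_2|)^{-\beta_1-\beta_2}\quad\text{for all }(\tau_1,\tau_2)\neq(0,0).$$ Suppose that for some choice of exponents $1<p,q,r<\infty$ with $\frac1p+\frac1q=\frac1r$ and some $s>0$ there is a constant $C$ such that $$\|T_{m}(f,g)\|_{\mathrm{L}^{r}_{y}(\mathrm{W}^{s,r}_{x})}\leq C\,\|f\|_{\mathrm{L}^p(\mathbb{R}^2)}\,\|g\|_{\mathrm{W}^{s,q}}$$ for all Schwartz functions $f,g\in\mathcal{S}(\mathbb{R}^2)$. Then for each $\gamma>0$ there exists a constant $c_\gamma>0$ such that $$\big\{(\tau_1,\tau_2):|m(\tau_1,\tau_2)|\geq\gamma\big\}\subseteq\big\{(\tau_1,\tau_2):|\tau_1|\leq c_\gamma(1+|\tau_2|)\big\}.$$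
   Context: The Fourier transform is $\widehat f(\xi)=\int f(x)e^{-2\pi i x\cdot\xi}\,dx$. For a symbol $m$ on $\mathbb{R}^2\setminus\{(0,0)\}$ and $f,g\in\mathcal{S}(\mathbb{R}^2)$, $$T_{m}(f,g)(x,y):=\int_{\mathbb{R}^4}m(\xi_1,\eta_2)\,e^{2\pi i(x(\xi_1+\eta_1)+y(\xi_2+\eta_2))}\,\widehat f(\xi_1,\xi_2)\,\widehat g(\eta_1,\eta_2)\,d\xi_1d\xi_2d\eta_1d\eta_2.$$ For $s\geq0$ and $1<p<\infty$ the non-homogeneous Sobolev norm on $\mathbb{R}^2$ is $\|f\|_{\mathrm{W}^{s,p}}:=\|(I-\triangle)^{s/2}f\|_{\mathrm{L}^p(\mathbb{R}^2)}$, where $(I-\triangle)^{s/2}$ is the Fourier multiplier with symbol $(1+4\pi^2(\xi_1^2+\xi_2^2))^{s/2}$. The partial Sobolev norm is $\|f\|_{\mathrm{L}^{p}_{y}(\mathrm{W}^{s,p}_{x})}:=\|(I-\triangle_x)^{s/2}f\|_{\mathrm{L}^p(\mathbb{R}^2)}$, where $(I-\triangle_x)^{s/2}$ is the Fourier multiplier with symbol $(1+4\pi^2\xi_1^2)^{s/2}$ acting in the first variable $x$ only. *)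

(* Defs.v *)
From HB Require Import structures.
From mathcomp Require Import all_boot all_order all_algebra.
From mathcomp Require Import complex.
From mathcomp Require Import all_classical all_reals all_analysis.

Set Implicit Arguments.
Unset Strict Implicit.
Unset Printing Implicit Defensive.

Import Order.TTheory GRing.Theory Num.Theory.
Import numFieldNormedType.Exports.

Local Open Scope classical_set_scope.
Local Open Scope ring_scope.

Notation Re := complex.Re.
Notation Im := complex.Im.
Notation cnorm := Normc.normc.

Section smoothness.
Context {R : realType}.

Definition partial1 (f : R * R -> R) : R * R -> R :=
  fun x => 'D_(1, 0) f x.
Definition partial2 (f : R * R -> R) : R * R -> R :=
  fun x => 'D_(0, 1) f x.

(* Meaningful for open U: continuity and differentiability at a point of U
   refer to full neighbourhoods of that point. *)
Fixpoint Ck (k : nat) (U : set (R * R)) (f : R * R -> R) : Prop :=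
  (forall x, U x -> {for x, continuous f}) /\
  if k is k'.+1 then
    [/\ forall x, U x -> derivable f x (1, 0) /\ derivable f x (0, 1),
        Ck k' U (partial1 f) & Ck k' U (partial2 f)]
  else True.

Definition smooth_on (U : set (R * R)) (f : R * R -> R[i]) : Prop :=
  forall k, Ck k U (fun x => Re (f x)) /\ Ck k U (fun x => Im (f x)).

Definition mixed_partial (b1 b2 : nat) (f : R * R -> R[i]) : R * R -> R[i] :=
  fun x => (iter b1 partial1 (iter b2 partial2 (fun y => Re (f y))) x
        +i* iter b1 partial1 (iter b2 partial2 (fun y => Im (f y))) x)%C.

Definition schwartz (f : R * R -> R[i]) : Prop :=
  smooth_on setT f /\
  forall a1 a2 b1 b2 : nat, exists M : R, forall x : R * R,
    `|x.1| ^+ a1 * `|x.2| ^+ a2 * cnorm (mixed_partial b1 b2 f x) <= M.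

End smoothness.

(* The canonical sigma-finite structure on m1 \x m2 is shadowed by the one
   declared for subprobabilities, so sigma-finiteness is proved directly. *)
Lemma product_sigma_finite d1 d2 (T1 : measurableType d1)
    (T2 : measurableType d2) (R : realType)
    (m1 : {sigma_finite_measure set T1 -> \bar R})
    (m2 : {sigma_finite_measure set T2 -> \bar R}) :
  sigma_finite setT (m1 \x m2)%E.
Proof.
have /sigma_finiteP[F [TF ndF Foo]] := sigma_finiteT m1.
have /sigma_finiteP[G [TG ndG Goo]] := sigma_finiteT m2.
exists (fun n => F n `*` G n).
  rewrite -setXTT TF TG predeqE => -[x y]; split.
    move=> [/= [n _ Fnx] [k _ Gky]]; exists (maxn n k) => //; split.
    - by move: x Fnx; exact/subsetPset/ndF/leq_maxl.
    - by move: y Gky; exact/subsetPset/ndG/leq_maxr.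
  by move=> [n _ []/= ? ?]; split; exists n.
move=> k; have [? ?] := Foo k; have [? ?] := Goo k.
split; first exact: measurableX.
by rewrite product_measure1E// lte_mul_pinfty// ge0_fin_numE.
Qed.

Section integration.
Context {R : realType}.

Definition leb2 : set (measurableTypeR R * measurableTypeR R)%type -> \bar R :=
  (@lebesgue_measure R \x @lebesgue_measure R)%E.
HB.instance Definition _ := Measure.on leb2.
HB.instance Definition _ :=
  Measure_isSigmaFinite.Build _ _ _ leb2
    (product_sigma_finite (@lebesgue_measure R) (@lebesgue_measure R)).

Definition leb4 : set ((measurableTypeR R * measurableTypeR R) *
                       (measurableTypeR R * measurableTypeR R))%type -> \bar R :=
  (leb2 \x leb2)%E.
HB.instance Definition _ := Measure.on leb4.
HB.instance Definition _ :=
  Measure_isSigmaFinite.Build _ _ _ leb4 (product_sigma_finite leb2 leb2).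

Definition cintegral d (T : measurableType d)
    (mu : {measure set T -> \bar R}) (F : T -> R[i]) : R[i] :=
  Complex (\int[mu]_z (Re (F z))) (\int[mu]_z (Im (F z))).

Definition cmeasurable d (T : measurableType d) (F : T -> R[i]) : Prop :=
  measurable_fun setT (fun z => Re (F z)) /\
  measurable_fun setT (fun z => Im (F z)).

Definition cintegrable d (T : measurableType d)
    (mu : {measure set T -> \bar R}) (F : T -> R[i]) : Prop :=
  mu.-integrable setT (fun z => (Re (F z))%:E) /\
  mu.-integrable setT (fun z => (Im (F z))%:E).

Definition Lp_norm (p : R) (f : R * R -> R[i]) : \bar R :=
  Lnorm leb2 p%:E (fun z => (cnorm (f z))%:E).

End integration.

Section fourier.
Context {R : realType}.
Implicit Types (f g F G phi : R * R -> R[i]) (sigma : R * R -> R).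

Definition expi (t : R) : R[i] := (cos (2 * pi * t) +i* sin (2 * pi * t))%C.

Definition fourier f (xi : R * R) : R[i] :=
  cintegral leb2 (fun x => f x * expi (- (x.1 * xi.1 + x.2 * xi.2))).

Definition bilinear_multiplier (m : R * R -> R[i]) f g (x : R * R) : R[i] :=
  cintegral leb4 (fun w : (R * R) * (R * R) =>
    let xi := w.1 in let eta := w.2 in
    m (xi.1, eta.2)
    * expi (x.1 * (xi.1 + eta.1) + x.2 * (xi.2 + eta.2))
    * fourier f xi * fourier g eta).

Definition multiplier_schwartz sigma phi (x : R * R) : R[i] :=
  cintegral leb2 (fun xi =>
    (sigma xi)%:C%C * fourier phi xi * expi (x.1 * xi.1 + x.2 * xi.2)).

(* G is the image of F under the Fourier multiplier with symbol sigma, in the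
   sense of tempered distributions: the transpose of the multiplier with symbol
   sigma is the multiplier with symbol xi |-> sigma (- xi).  This makes sense
   for functions F that are not Schwartz, such as bilinear_multiplier m f g when
   m is singular at the origin. *)
Definition is_multiplier sigma F G : Prop :=
  forall phi, schwartz phi ->
    let phi' := multiplier_schwartz (fun xi => sigma (- xi)) phi in
    [/\ cintegrable leb2 (fun x => G x * phi x),
        cintegrable leb2 (fun x => F x * phi' x) &
        cintegral leb2 (fun x => G x * phi x) =
        cintegral leb2 (fun x => F x * phi' x)].

(* The L^p norm of the image of F under the multiplier with symbol sigma.  That
   image is unique up to a null set, so the set below has at most one element;
   the value is +oo if the image is not given by a function. *)
Definition multiplier_norm sigma (p : R) F : \bar R :=
  ereal_inf [set Lp_norm p G | G in
    [set G : measurableTypeR R * measurableTypeR R -> R[i] |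
      cmeasurable G /\ is_multiplier sigma F G]].

Definition bessel (s : R) (xi : R * R) : R :=
  (1 + 4 * pi ^+ 2 * (xi.1 ^+ 2 + xi.2 ^+ 2)) `^ (s / 2).

Definition bessel_x (s : R) (xi : R * R) : R :=
  (1 + 4 * pi ^+ 2 * xi.1 ^+ 2) `^ (s / 2).

Definition sobolev_norm (s p : R) F : \bar R := multiplier_norm (bessel s) p F.

Definition partial_sobolev_norm (s p : R) F : \bar R :=
  multiplier_norm (bessel_x s) p F.

End fourier.

(* Main.v *)
Require Import Defs.
From HB Require Import structures.
From mathcomp Require Import all_boot all_order all_algebra.
From mathcomp Require Import complex.
From mathcomp Require Import all_classical all_reals all_analysis.
From mathcomp Require Import measurable_realfun ring lra.

Set Implicit Arguments.
Unset Strict Implicit.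
Unset Printing Implicit Defensive.

Import Order.TTheory GRing.Theory Num.Theory.
Import numFieldNormedType.Exports.
Local Open Scope classical_set_scope.
Local Open Scope ring_scope.

(* The symbol is tested on Gaussian wave packets.  For tau = (tau1, tau2) let f
   and g be the standard Gaussian modulated at the frequencies (tau1, 0) and
   (0, tau2).  When |tau1| is large, m varies slowly at unit scale around tau,
   so T_m(f, g) = m(tau) f g + O(1/|tau1|) uniformly.  Pairing (I - Delta_x)^(s/2)
   T_m(f, g) with the Gaussian modulated at -tau, and moving the multiplier to
   that Gaussian, gives (1 + 4 pi^2 tau1^2)^(s/2) (m(tau)/3 + O(1/|tau1|)), which
   Hoelder's inequality bounds by the norm on the left-hand side of the estimate.
   On the right-hand side f has a norm independent of tau, and g has Sobolev norm
   O((1 + 4 pi^2 tau2^2)^(s/2)).  Hence |m(tau)| >= gamma forces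
   |tau1| <= c (1 + |tau2|). *)

(* Num.Theory rebinds Re and Im to its own real and imaginary parts. *)
Local Notation Re := complex.Re.
Local Notation Im := complex.Im.

(** * Complex numbers and complex-valued integrals *)

(** [bilinear_multiplier m f g] need not be a Schwartz function, since m may be singular at the
    origin, so the norm on the left is an infimum over functions [G] known only through their
    pairings with Schwartz functions. The lower bound is therefore proved for an arbitrary such [G],
    and the test packet has to be shown to be Schwartz. The Sobolev norm on the right is an infimum
    too, but there one explicit [G] is enough.

    Two demands shape the estimates. Constants must be uniform in the frequency, apart from the
    expected power of the Bessel symbol: Peetre's inequality moves that power to the centre of the
    Gaussian, and half of the Gaussian exponent, pi / 2 out of pi, pays for the remaining polynomial
    factors. Errors must be integrable over the plane although the approximations hold only
    uniformly in x: each error is multiplied by a factor that decays. The 1/3 is the integral of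
    exp(-3 pi |x|^2), the product of the Gaussians of f, g and the test function. *)

Section complex_numbers.
Context {R : realType}.
Implicit Types (x y z : R[i]) (a b : R).

Lemma cReD x y : Re (x + y) = Re x + Re y. Proof. by move: x y => [? ?] [? ?]. Qed.
Lemma cImD x y : Im (x + y) = Im x + Im y. Proof. by move: x y => [? ?] [? ?]. Qed.
Lemma cReN x : Re (- x) = - Re x. Proof. by case: x. Qed.
Lemma cImN x : Im (- x) = - Im x. Proof. by case: x. Qed.
Lemma cReM x y : Re (x * y) = Re x * Re y - Im x * Im y.
Proof. by move: x y => [? ?] [? ?]. Qed.
Lemma cImM x y : Im (x * y) = Re x * Im y + Im x * Re y.
Proof. by move: x y => [? ?] [? ?]. Qed.

Lemma complex_ext x y : Re x = Re y -> Im x = Im y -> x = y.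
Proof. by move: x y => [? ?] [? ?] /= -> ->. Qed.

Lemma cnorm_ge0 z : 0 <= cnorm z.
Proof. by case: z => a b; exact: sqrtr_ge0. Qed.

Lemma normr_Re_le z : `|Re z| <= cnorm z.
Proof.
case: z => a b /=; rewrite -sqrtr_sqr ler_wsqrtr//.
by rewrite lerDl sqr_ge0.
Qed.

Lemma normr_Im_le z : `|Im z| <= cnorm z.
Proof.
case: z => a b /=; rewrite -sqrtr_sqr ler_wsqrtr//.
by rewrite lerDr sqr_ge0.
Qed.

Lemma cnorm_le_ReIm z : cnorm z <= `|Re z| + `|Im z|.
Proof.
case: z => a b /=; rewrite -[leRHS]ger0_norm ?addr_ge0// -sqrtr_sqr.
rewrite ler_wsqrtr// sqrrD !real_normK ?num_real//.
by rewrite -addrA lerD2l lerDr mulrn_wge0// mulr_ge0.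
Qed.

Lemma cnorm_real a : cnorm a%:C%C = `|a|.
Proof. by rewrite /= expr0n addr0 sqrtr_sqr. Qed.

Lemma cReZ a z : Re (a%:C%C * z) = a * Re z.
Proof. by rewrite cReM /= mul0r subr0. Qed.

Lemma cImZ a z : Im (a%:C%C * z) = a * Im z.
Proof. by rewrite cImM /= mul0r addr0. Qed.

Lemma cnormD x y : cnorm (x + y) <= cnorm x + cnorm y.
Proof. exact: le_normcD. Qed.

Lemma cnormN x : cnorm (- x) = cnorm x.
Proof. exact: normcN. Qed.

Lemma cnormB x y : cnorm (x - y) <= cnorm x + cnorm y.
Proof. by rewrite (le_trans (cnormD _ _))// cnormN. Qed.

Lemma expiD a b : expi (a + b) = expi a * expi b :> R[i].
Proof.
by apply: complex_ext; rewrite ?(cReM, cImM) /= mulrDr ?cosD ?sinD// addrC.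
Qed.

Lemma expi0 : expi 0 = 1 :> R[i].
Proof. by apply: complex_ext; rewrite /= mulr0 ?cos0 ?sin0. Qed.

Lemma cnorm_expi a : cnorm (expi a : R[i]) = 1.
Proof. by rewrite /= cos2Dsin2 sqrtr1. Qed.

End complex_numbers.

(** * Borel sets and measurable functions on the plane *)

Section plane_measurability.
Context {R : realType}.
Local Notation R1 := (measurableTypeR R).

(** Second countability: [O] is the union of the rational boxes it contains, which are countably
    many, and each box is a measurable rectangle for the product sigma-algebra. *)
Lemma open_measurable_plane (O : set (R * R)) : open O ->
  measurable (O : set (R1 * R1)).
Proof.
move=> oO.
pose B (i : rat * rat * nat) : set (R * R) :=
  ball (ratr i.1.1 : R) (i.2.+1%:R^-1) `*` ball (ratr i.1.2 : R) (i.2.+1%:R^-1).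
pose B' i := if pselect (B i `<=` O) then B i else set0.
have -> : O = \bigcup_i B' i.
  apply/seteqP; split => [[x y] Oxy|z [i _]]; last first.
    by rewrite /B'; case: (pselect (B i `<=` O)) => [iO|//]; exact: iO.
  have /nbhs_ballP[e /= e0 eO] := open_nbhs_nbhs (conj oO Oxy).
  have [n] : exists n : nat, n.+1%:R^-1 < e / 2.
    have [n _ /(_ n (leqnn n)) nP] := near_infty_natSinv_lt (PosNum (divr_gt0 e0 (ltr0Sn R 1))).
    by exists n.
  set d : R := n.+1%:R^-1 => de.
  have d0 : 0 < d by rewrite invr_gt0.
  have [q qx] := rat_in_itvoo (ltac:(lra) : x - d < x + d).
  have [r ry] := rat_in_itvoo (ltac:(lra) : y - d < y + d).
  have {}qx : ball (ratr q : R) d x.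
    move: qx; rewrite in_itv/= => /andP[? ?].
    by rewrite /ball/= ltr_norml; apply/andP; split; lra.
  have {}ry : ball (ratr r : R) d y.
    move: ry; rewrite in_itv/= => /andP[? ?].
    by rewrite /ball/= ltr_norml; apply/andP; split; lra.
  exists (q, r, n) => //; rewrite /B'; case: (pselect (B (q, r, n) `<=` O)) => [?|]; first by split.
  case => -[u v] [/= uq vr]; apply: eO.
  have tri (a b c : R) : ball a d b -> ball a d c -> ball b e c.
    move=> ab ac; have -> : e = e / 2 + e / 2 by lra.
    apply: (@ball_triangle _ _ a); first exact/ball_sym/(le_ball (ltW de)).
    exact/(le_ball (ltW de)).
  by split; [exact: tri qx uq|exact: tri ry vr].
apply: (countable_bigcupT_measurable (countableP _)) => -[[q r] n].
rewrite /B'; case: (pselect (B (q, r, n) `<=` O)) => ? /=; last exact: measurable0.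
by apply: measurableX; apply: open_measurable; exact: ball_open.
Qed.

(** One exceptional point is allowed because a symbol such as m is continuous only off the origin; a
    single point is measurable whatever the value there. *)
Lemma continuous_off_measurable_plane (f : R * R -> R) (a : R * R) :
  (forall x, x != a -> {for x, continuous f}) ->
  measurable_fun setT (f : R1 * R1 -> R).
Proof.
move=> cf; apply: (measurability _ (RGenOpens.measurableE R)).
move=> _ [_ [u [v ->] <-]]; rewrite setTI.
set V := `]u, v[%classic.
have -> : f @^-1` V = (f @^-1` V `\` [set a]) `|` (f @^-1` V `&` [set a]).
  by rewrite setDE -setIUr setUC setUv setIT.
have m1 : measurable ([set a] : set (R1 * R1)).
  have -> : [set a] = [set a.1] `*` [set a.2] :> set (R1 * R1).
    apply/seteqP; split => [_ -> //|[x y] [/= -> ->]].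
    by rewrite -surjective_pairing.
  by apply: measurableX; exact: measurable_set1.
apply: measurableU.
- apply: open_measurable_plane; rewrite openE => x [/= Vfx xa].
  have /cf : x != a by apply/eqP.
  have oV : nbhs (f x) V by apply: open_nbhs_nbhs; split => //; exact: interval_open.
  move=> /(_ _ oV) H.
  apply: filterI; first exact: H.
  apply: open_nbhs_nbhs; split => //; rewrite openC.
  exact/accessible_closed_set1/hausdorff_accessible/norm_hausdorff.
- have [Va|nVa] := pselect (V (f a)).
    rewrite (_ : _ `&` _ = [set a])//; apply/seteqP; split => x; first by case.
    by move=> ->.
  rewrite (_ : _ `&` _ = set0)//; apply/seteqP; split => x //.
  by case => /= Vx xa; apply: nVa; rewrite -xa.
Qed.

Lemma continuous_measurable_plane (f : R * R -> R) : continuous f ->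
  measurable_fun setT (f : R1 * R1 -> R).
Proof. by move=> cf; apply: (@continuous_off_measurable_plane f 0) => x _; exact: cf. Qed.

End plane_measurability.

Section complex_integral.
Context {R : realType} d {T : measurableType d} (mu : {measure set T -> \bar R}).
Implicit Types (F G : T -> R[i]) (g : T -> R) (c : R[i]).
Local Notation integ g := (mu.-integrable setT (EFin \o g)).

Lemma cmeasurableM F G : cmeasurable F -> cmeasurable G ->
  cmeasurable (fun x => F x * G x).
Proof.
move=> [F1 F2] [G1 G2]; split.
  by under eq_fun do rewrite cReM; apply: measurable_funB; exact: measurable_funM.
by under eq_fun do rewrite cImM; apply: measurable_funD; exact: measurable_funM.
Qed.

Lemma cmeasurable_cst c : cmeasurable (fun _ : T => c).
Proof. by split; exact: measurable_cst. Qed.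

Lemma cmeasurable_real g : measurable_fun setT g ->
  cmeasurable (fun x => (g x)%:C%C).
Proof. by move=> mg; split => //; exact: measurable_cst. Qed.

Lemma cmeasurable_expi g : measurable_fun setT g ->
  cmeasurable (fun x => expi (g x)).
Proof.
move=> mg; split => /=.
  apply: (measurableT_comp (f := @cos R)).
    by apply: continuous_measurable_fun; exact: continuous_cos.
  exact: measurable_funM.
apply: (measurableT_comp (f := @sin R)).
  by apply: continuous_measurable_fun; exact: continuous_sin.
exact: measurable_funM.
Qed.

Lemma measurable_cnorm F : cmeasurable F ->
  measurable_fun setT (fun x => cnorm (F x)).
Proof.
move=> [mR mI].
have -> : (fun x => cnorm (F x)) = Num.sqrt \o (fun x => Re (F x) ^+ 2 + Im (F x) ^+ 2).
  by apply/funext => x /=; case: (F x).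
apply: measurableT_comp.
  by apply: continuous_measurable_fun; exact: sqrt_continuous.
by apply: measurable_funD; apply: measurable_funX.
Qed.

Lemma cintegrable_measurable F : cintegrable mu F -> cmeasurable F.
Proof.
by move=> [/measurable_int/measurable_EFinP ? /measurable_int/measurable_EFinP ?].
Qed.

Lemma le_integrable_real (f g : T -> R) : measurable_fun setT f -> integ g ->
  (forall x, `|f x| <= g x) -> integ f.
Proof.
move=> mf ig fg; apply: le_integrable ig => //; first exact/measurable_EFinP.
by move=> x _ /=; rewrite lee_fin (le_trans (fg x))// ler_norm.
Qed.

Lemma le_cintegrable F g : cmeasurable F -> integ g ->
  (forall x, cnorm (F x) <= g x) -> cintegrable mu F.
Proof.
move=> [mR mI] ig Fg; split; apply: le_integrable_real ig _ => // x.
  exact: le_trans (normr_Re_le _) (Fg x).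
exact: le_trans (normr_Im_le _) (Fg x).
Qed.

Lemma integrableD_real (f g : T -> R) : integ f -> integ g -> integ (fun x => f x + g x).
Proof. by move=> fi gi; have := integrableD measurableT fi gi. Qed.

Lemma integrableZ_real (k : R) g : integ g -> integ (fun x => k * g x).
Proof. by move=> gi; have := integrableZl measurableT k gi. Qed.

Lemma integrable_cnorm F : cintegrable mu F -> integ (fun x => cnorm (F x)).
Proof.
move=> iF; have [iR iI] := iF.
have iRI := integrableD_real (integrable_norm iR) (integrable_norm iI).
apply: le_integrable_real iRI _.
  exact/measurable_cnorm/cintegrable_measurable.
by move=> x; rewrite ger0_norm ?cnorm_ge0// cnorm_le_ReIm.
Qed.

Lemma cintegrable_real g : integ g -> cintegrable mu (fun x => (g x)%:C%C).
Proof. by move=> ig; split => //=; exact: integrable0. Qed.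

Lemma cintegrableD F G : cintegrable mu F -> cintegrable mu G ->
  cintegrable mu (fun x => F x + G x).
Proof.
move=> [F1 F2] [G1 G2]; split.
  by under eq_fun do rewrite cReD; exact: integrableD_real.
by under eq_fun do rewrite cImD; exact: integrableD_real.
Qed.

Lemma cintegrableM_bounded F G (M : R) : cintegrable mu F -> cmeasurable G ->
  (forall x, cnorm (G x) <= M) -> cintegrable mu (fun x => F x * G x).
Proof.
move=> iF mG GM; apply: le_cintegrable.
- exact: cmeasurableM (cintegrable_measurable iF) mG.
- exact: (integrableZ_real M (integrable_cnorm iF)).
- by move=> x; rewrite Normc.normcM mulrC ler_wpM2r ?cnorm_ge0.
Qed.

Lemma cintegrableZ c F : cintegrable mu F -> cintegrable mu (fun x => c * F x).
Proof.
move=> iF; under eq_fun do rewrite mulrC.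
by apply: (@cintegrableM_bounded _ _ (cnorm c)) => //; exact: cmeasurable_cst.
Qed.

Lemma cintegrableN F : cintegrable mu F -> cintegrable mu (fun x => - F x).
Proof. by move=> iF; under eq_fun do rewrite -mulN1r; exact: cintegrableZ. Qed.

Lemma cintegrableB F G : cintegrable mu F -> cintegrable mu G ->
  cintegrable mu (fun x => F x - G x).
Proof. by move=> iF iG; apply: cintegrableD => //; exact: cintegrableN. Qed.

Lemma eq_cintegral F G : F =1 G -> cintegral mu F = cintegral mu G.
Proof. by move=> /funext ->. Qed.

Lemma cintegralD F G : cintegrable mu F -> cintegrable mu G ->
  cintegral mu (fun x => F x + G x) = cintegral mu F + cintegral mu G.
Proof.
move=> [F1 F2] [G1 G2]; apply: complex_ext => /=; rewrite -RintegralD//.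
  by apply: eq_Rintegral => x _; rewrite cReD.
by apply: eq_Rintegral => x _; rewrite cImD.
Qed.

Lemma cintegralZ c F : cintegrable mu F ->
  cintegral mu (fun x => c * F x) = c * cintegral mu F.
Proof.
move=> [F1 F2]; apply: complex_ext; rewrite ?(cReM, cImM) /=.
  rewrite -!RintegralZl// -RintegralB//; [|exact: integrableZ_real..].
  by apply: eq_Rintegral => x _; rewrite cReM.
rewrite -!RintegralZl// -RintegralD//; [|exact: integrableZ_real..].
by apply: eq_Rintegral => x _; rewrite cImM.
Qed.

Lemma cintegralB F G : cintegrable mu F -> cintegrable mu G ->
  cintegral mu (fun x => F x - G x) = cintegral mu F - cintegral mu G.
Proof.
move=> iF iG; rewrite cintegralD//; last exact: cintegrableN.
by rewrite -[in RHS]mulN1r -cintegralZ//; congr (_ + _); apply: eq_cintegral => x; rewrite mulN1r.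
Qed.

Lemma cintegral_real g : cintegral mu (fun x => (g x)%:C%C) = (\int[mu]_x g x)%:C%C.
Proof. by apply: complex_ext => //=; rewrite /Rintegral integral0. Qed.

(* The constant 2 comes from bounding the real and imaginary parts separately. *)
Lemma le_cnorm_cintegral F g : cintegrable mu F -> integ g ->
  (forall x, cnorm (F x) <= g x) -> cnorm (cintegral mu F) <= 2 * \int[mu]_x g x.
Proof.
move=> [iR iI] ig Fg; rewrite (le_trans (cnorm_le_ReIm _))//=.
rewrite mulr_natl mulr2n lerD// (le_trans (le_normr_Rintegral _ _))//.
  apply: le_Rintegral => //; first exact: integrable_norm.
  by move=> x _; exact: le_trans (normr_Re_le _) (Fg x).
apply: le_Rintegral => //; first exact: integrable_norm.
by move=> x _; exact: le_trans (normr_Im_le _) (Fg x).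
Qed.

End complex_integral.

(** * Fubini's theorem for finite-valued integrals and transposition of kernels *)

Section fubini_finite.
Context d1 d2 (T1 : measurableType d1) (T2 : measurableType d2) {R : realType}.
Variables (m1 : {sigma_finite_measure set T1 -> \bar R})
  (m2 : {sigma_finite_measure set T2 -> \bar R}).
Local Notation integ mu g := (mu.-integrable setT (EFin \o g)).

(** The inner integral in Fubini's theorem is an extended real, finite only almost everywhere;
    [fine] changes it on a null set only. *)
Lemma integrable_fine d (T : measurableType d) (mu : {measure set T -> \bar R})
    (F : T -> \bar R) : mu.-integrable setT F ->
  integ mu (fun x => fine (F x)) /\
  (\int[mu]_x F x = \int[mu]_x (fine (F x))%:E)%E.
Proof.
move=> iF; have mF := measurable_int _ iF.
have mfF : measurable_fun setT (fun x => (fine (F x))%:E).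
  by apply/measurable_EFinP; exact: measurableT_comp.
split.
  apply: le_integrable iF => // x _ /=.
  by case: (F x) => [r| |] //=; rewrite normr0 leey.
apply: ae_eq_integral => //.
apply: filterS (integrable_ae measurableT iF) => x /= /(_ I) Fx _.
by rewrite fineK.
Qed.

Lemma Rfubini1 (f : T1 * T2 -> R) : integ (m1 \x m2)%E f ->
  integ m1 (fun x => \int[m2]_y f (x, y)) /\
  \int[(m1 \x m2)%E]_z f z = \int[m1]_x \int[m2]_y f (x, y).
Proof.
move=> fi; have [iF eF] := integrable_fine (integrable_fubini_F fi).
split; first exact: iF.
by rewrite /Rintegral -(integral12_prod_meas1 fi) eF.
Qed.

Lemma Rfubini2 (f : T1 * T2 -> R) : integ (m1 \x m2)%E f ->
  integ m2 (fun y => \int[m1]_x f (x, y)) /\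
  \int[(m1 \x m2)%E]_z f z = \int[m2]_y \int[m1]_x f (x, y).
Proof.
move=> fi.
have iG : m2.-integrable setT (fubini_G m1 (EFin \o f)).
  have mG := measurable_fubini_G fi.
  have /integrableP[mf _] := fi.
  have fi2 := (integrable21ltyP m1 m2 mf).1 fi.
  apply/integrableP; split => //; apply: le_lt_trans fi2.
  apply: ge0_le_integral => //.
  - exact: measurableT_comp.
  - apply: (measurable_fun_fubini_tonelli_G (abse \o (EFin \o f))) => [|z].
      exact: measurableT_comp.
    exact: abse_ge0.
  - move=> y _; apply: le_abse_integral => //.
    exact: measurableT_comp.
have [iG' eG] := integrable_fine iG.
split; first exact: iG'.
by rewrite /Rintegral -(integral21_prod_meas1 fi) eG.
Qed.

Lemma cintegral_fubini1 (F : T1 * T2 -> R[i]) : cintegrable (m1 \x m2)%E F ->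
  cintegrable m1 (fun x => cintegral m2 (fun y => F (x, y))) /\
  cintegral (m1 \x m2)%E F = cintegral m1 (fun x => cintegral m2 (fun y => F (x, y))).
Proof.
move=> [/Rfubini1[? eR] /Rfubini1[? eI]]; split; first by split.
by apply: complex_ext; rewrite /= ?eR ?eI.
Qed.

Lemma cintegral_fubini2 (F : T1 * T2 -> R[i]) : cintegrable (m1 \x m2)%E F ->
  cintegrable m2 (fun y => cintegral m1 (fun x => F (x, y))) /\
  cintegral (m1 \x m2)%E F = cintegral m2 (fun y => cintegral m1 (fun x => F (x, y))).
Proof.
move=> [/Rfubini2[? eR] /Rfubini2[? eI]]; split; first by split.
by apply: complex_ext; rewrite /= ?eR ?eI.
Qed.

Lemma integrable_tensor (f : T1 -> R) (g : T2 -> R) :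
  integ m1 f -> integ m2 g -> integ (m1 \x m2)%E (fun z => f z.1 * g z.2).
Proof.
move=> fi gi.
have /integrableP[/measurable_EFinP mf fy] := fi.
have /integrableP[/measurable_EFinP mg gy] := gi.
have mfg : measurable_fun setT (EFin \o (fun z : T1 * T2 => f z.1 * g z.2)).
  by apply/measurable_EFinP; apply: measurable_funM; exact: measurableT_comp.
apply/(integrable12ltyP m1 m2 mfg) => /=.
under eq_integral => x _.
  under eq_integral do rewrite normrM EFinM.
  rewrite ge0_integralZl//; last by apply/measurable_EFinP; exact: measurableT_comp.
  over.
rewrite ge0_integralZr//=.
- by rewrite lte_mul_pinfty// ?integral_ge0// ge0_fin_numE ?integral_ge0.
- by apply/measurable_EFinP; exact: measurableT_comp.
- exact: integral_ge0.
Qed.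

Lemma cintegrable_tensor (f : T1 -> R[i]) (g : T2 -> R[i]) :
  cintegrable m1 f -> cintegrable m2 g ->
  cintegrable (m1 \x m2)%E (fun z => f z.1 * g z.2).
Proof.
move=> fi gi.
have [mfr mfi] := cintegrable_measurable fi.
have [mgr mgi] := cintegrable_measurable gi.
apply: le_cintegrable.
- apply: cmeasurableM; split.
  + exact: (measurableT_comp mfr measurable_fst).
  + exact: (measurableT_comp mfi measurable_fst).
  + exact: (measurableT_comp mgr measurable_snd).
  + exact: (measurableT_comp mgi measurable_snd).
- exact: integrable_tensor (integrable_cnorm fi) (integrable_cnorm gi).
- by move=> x; rewrite Normc.normcM.
Qed.

Lemma cintegral_tensor (f : T1 -> R[i]) (g : T2 -> R[i]) :
  cintegrable m1 f -> cintegrable m2 g ->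
  cintegral (m1 \x m2)%E (fun z => f z.1 * g z.2) =
  cintegral m1 f * cintegral m2 g.
Proof.
move=> fi gi; have [_ ->] := cintegral_fubini1 (cintegrable_tensor fi gi).
rewrite mulrC -cintegralZ//; apply: eq_cintegral => x /=.
by rewrite cintegralZ// mulrC.
Qed.

(** Boundedness of [k] makes [f x * g y * k (x, y)] integrable on the product, so Fubini applies
    both ways. With an exponential kernel this is the multiplication formula for Fourier transforms,
    by which multipliers are transposed below. *)
Lemma cintegral_exchange (f : T1 -> R[i]) (g : T2 -> R[i])
    (k : T1 * T2 -> R[i]) (M : R) :
  cintegrable m1 f -> cintegrable m2 g -> cmeasurable k ->
  (forall z, cnorm (k z) <= M) ->
  cintegrable m1 (fun x => f x * cintegral m2 (fun y => g y * k (x, y))) /\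
  cintegral m1 (fun x => f x * cintegral m2 (fun y => g y * k (x, y))) =
  cintegral m2 (fun y => g y * cintegral m1 (fun x => f x * k (x, y))).
Proof.
move=> fi gi [mkr mki] kM.
have Fi := cintegrableM_bounded (cintegrable_tensor fi gi) (conj mkr mki) kM.
have gx x : cintegrable m2 (fun y => g y * k (x, y)).
  apply: (cintegrableM_bounded gi (M := M)) => //; split.
    exact: (measurableT_comp mkr (pair1_measurable x)).
  exact: (measurableT_comp mki (pair1_measurable x)).
have fy y : cintegrable m1 (fun x => f x * k (x, y)).
  apply: (cintegrableM_bounded fi (M := M)) => //; split.
    exact: (measurableT_comp mkr (pair2_measurable y)).
  exact: (measurableT_comp mki (pair2_measurable y)).
have E1 : (fun x => f x * cintegral m2 (fun y => g y * k (x, y))) =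
    (fun x => cintegral m2 (fun y => f x * g y * k (x, y))).
  apply/funext => x; rewrite -cintegralZ//.
  by apply: eq_cintegral => y; rewrite mulrA.
have E2 : (fun y => g y * cintegral m1 (fun x => f x * k (x, y))) =
    (fun y => cintegral m1 (fun x => f x * g y * k (x, y))).
  apply/funext => y; rewrite -cintegralZ//.
  by apply: eq_cintegral => x; rewrite mulrCA mulrA.
rewrite E1 E2; have [H1 <-] := cintegral_fubini1 Fi.
by split => //; have [_ <-] := cintegral_fubini2 Fi.
Qed.

End fubini_finite.

(** * Gaussians on the real line *)

Section derivatives.
Context {R : realType}.
Implicit Types (f g : R -> R) (x : R).

Lemma is_derive_add f g x a b : is_derive x 1 f a -> is_derive x 1 g b ->
  is_derive x 1 (fun t => f t + g t) (a + b).
Proof. by move=> *; exact: is_deriveD. Qed.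

Lemma is_derive_opp f x a : is_derive x 1 f a ->
  is_derive x 1 (fun t => - f t) (- a).
Proof. by move=> *; exact: is_deriveN. Qed.

Lemma is_derive_mul f g x a b : is_derive x 1 f a -> is_derive x 1 g b ->
  is_derive x 1 (fun t => f t * g t) (a * g x + f x * b).
Proof.
move=> fa gb; apply: (is_derive_eq (is_deriveM fa gb)).
by rewrite /GRing.scale/= addrC mulrC.
Qed.

Lemma is_derive_const (c : R) x : is_derive x 1 (fun _ => c) 0.
Proof. exact: is_derive_cst. Qed.

Lemma is_derive_scale (c : R) f x a : is_derive x 1 f a ->
  is_derive x 1 (fun t => c * f t) (c * a).
Proof.
move=> fa; apply: (is_derive_eq (is_derive_mul (is_derive_const c x) fa)).
by rewrite mul0r add0r.
Qed.

Lemma is_derive_sqr f x a : is_derive x 1 f a ->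
  is_derive x 1 (fun t => f t ^+ 2) (2 * f x * a).
Proof.
move=> fa; apply: (is_derive_eq (is_derive_mul fa fa)).
by rewrite mulrC -mulr2n -mulrA mulr_natl.
Qed.

Lemma is_derive_compose f g x a b : is_derive (g x) 1 f a -> is_derive x 1 g b ->
  is_derive x 1 (fun t => f (g t)) (a * b).
Proof. exact: is_derive1_comp. Qed.

Lemma is_derive_translate (c x : R) : is_derive x 1 (fun t => t - c) 1.
Proof.
apply: (is_derive_eq (is_derive_add (is_derive_id x 1) (is_derive_const _ _))).
by rewrite addr0.
Qed.

Lemma is_derive_continuous f x a : is_derive x 1 f a -> {for x, continuous f}.
Proof. by move=> [df _]; exact/differentiable_continuous/derivable1_diffP. Qed.

Lemma is_derive_derive1 f x a : is_derive x 1 f a -> derive1 f x = a.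
Proof. by move=> [df <-]; rewrite derive1E. Qed.

End derivatives.

Section real_line.
Context {R : realType}.
Local Notation leb := (@lebesgue_measure R).
Local Notation integ g := (leb.-integrable setT (EFin \o g)).

(** The fundamental theorem of calculus on [-n, n] leaves boundary terms that vanish in the limit;
    [|dk|] dominates the truncations. *)
Lemma Rintegral_derive0 (k dk : R -> R) :
  (forall t : R, is_derive t 1 k (dk t)) -> continuous dk -> integ dk ->
  k n%:R @[n --> \oo] --> 0 -> k (- n%:R) @[n --> \oo] --> 0 ->
  \int[leb]_t dk t = 0.
Proof.
move=> kdk cdk idk k1 k2.
have mdk : measurable_fun setT dk by exact: continuous_measurable_fun.
pose f_ n := (EFin \o dk) \_ `[- n%:R, n%:R].
have [] := @dominated_convergence _ _ _ leb setT measurableT f_ (EFin \o dk)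
    (fun t => `|(dk t)%:E|%E).
- move=> n; apply/(measurable_restrictT _ _).1 => //.
  exact/measurable_funTS/measurable_EFinP.
- exact/measurable_EFinP.
- apply: aeW => t _.
  apply: cvg_near_cst; near=> n.
  rewrite /f_ patchE mem_set//= in_itv/= -ler_norml.
  by near: n; exact: nbhs_infty_ger.
- exact: integrable_abse.
- by apply: aeW => t n _; rewrite /f_ patchE; case: ifPn => // _; rewrite abse0 abse_ge0.
move=> _ _ lim1.
have lim2 : (\int[leb]_t f_ n t)%E @[n --> \oo] --> 0%E.
  (* The shift of index makes -n < n strict, as the fundamental theorem requires; it fails at n =
     0. *)
  rewrite -(cvg_shiftn 1%N).
  have -> : (fun n => \int[leb]_t f_ (n + 1)%N t)%E =
      (fun n => (k (n + 1)%N%:R - k (- (n + 1)%N%:R))%:E).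
    apply/funext => n; rewrite /f_ -integral_mkcond/=.
    rewrite (@continuous_FTC2 _ dk k) ?EFinB//.
    - by rewrite addn1 gtrN.
    - exact: continuous_subspaceT.
    - have ck t : {for t, continuous k} by exact: is_derive_continuous (kdk t).
      split=> [x _| |]; first by case: (kdk x).
        exact/cvg_at_right_filter/ck.
      exact/cvg_at_left_filter/ck.
    - by move=> x _; apply: is_derive_derive1.
  apply: cvg_EFin; first exact: nearW.
  rewrite -[X in _ --> X](subr0 0); apply: cvgB.
    by have := k1; rewrite -(cvg_shiftn 1%N).
  by have := k2; rewrite -(cvg_shiftn 1%N).
rewrite /Rintegral.
by rewrite (cvg_unique _ lim1 lim2).
Unshelve. all: end_near. Qed.

(** With [b = pi] and [c = 0] this is its own Fourier transform; [b = pi / 2] is the wider envelope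
    that dominates polynomial multiples of the case [b = pi]. *)
Definition gauss (b c t : R) : R := expR (- (b * (t - c) ^+ 2)).

Lemma gauss_gt0 b c t : 0 < gauss b c t. Proof. exact: expR_gt0. Qed.

Lemma continuous_gauss b c : continuous (gauss b c).
Proof.
move=> t; apply: (@is_derive_continuous _ _ _ (expR (- (b * (t - c) ^+ 2)) * - (b * (2 *
  (t - c) * 1)))).
apply: is_derive_compose; apply: is_derive_opp; apply: is_derive_scale.
by apply: is_derive_sqr; exact: is_derive_translate.
Qed.

Lemma integral_gauss b c : 0 < b -> integ (gauss b c) /\
  \int[leb]_t gauss b c t = Num.sqrt (pi / b).
Proof.
(* Standard deviation of the normal law of whose density [gauss b c] is a multiple. *)
move=> b0; pose s := (Num.sqrt (2 * b))^-1.
have s0 : s != 0 by rewrite invr_eq0 sqrtr_eq0 -ltNge mulr_gt0.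
have ss : s ^+ 2 = (2 * b)^-1 by rewrite exprVn sqr_sqrtr// mulr_ge0// ltW.
have E : gauss b c = (fun t => Num.sqrt (pi / b) * normal_pdf c s t).
  apply/funext => t; rewrite normal_pdfE// /normal_peak /normal_fun.
  have -> : s ^+ 2 * pi *+ 2 = pi / b.
    rewrite ss -mulr_natr invfM; field; lra.
  rewrite mulVKf; last by rewrite sqrtr_eq0 -ltNge divr_gt0// pi_gt0.
  congr expR; rewrite ss -mulr_natr; field; lra.
have ip := integrable_normal_pdf c s.
rewrite E; split; first exact: integrableZ_real.
by rewrite RintegralZl// /Rintegral integral_normal_pdf mulr1.
Qed.

(** Put z = y / (N a): then z <= 1 + z <= e^z, raised to the power a. A large [N] spends little of
    an exponential factor. *)
Lemma powR_le_expR (y a N : R) : 0 <= y -> 0 < a -> 0 < N ->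
  y `^ a <= (N * a) `^ a * expR (y / N).
Proof.
move=> y0 a0 N0.
have -> : y = (N * a) * (y / (N * a)) by rewrite mulrC divfK// mulf_neq0// gt_eqF.
have z0 : 0 <= y / (N * a) by rewrite divr_ge0// mulr_ge0// ltW.
rewrite powRM//; last by rewrite mulr_ge0// ltW.
rewrite ler_wpM2l ?powR_ge0//.
have -> : N * a * (y / (N * a)) / N = (y / (N * a)) * a.
  by field; rewrite !gt_eqF.
rewrite expRM; apply: ge0_ler_powR; rewrite ?nnegrE ?expR_ge0//; first exact: ltW.
by rewrite (le_trans _ (expR_ge1Dx _))// lerDr.
Qed.

Lemma integrable_powR_decay (p : R) : 1 < p ->
  integ (fun t => (1 + `|t|) `^ (- p)).
Proof.
move=> p1.
have cf : continuous (fun t : R => (1 + `|t|) `^ (- p)).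
  move=> t.
  have c1 : {for t, continuous (fun t : R => 1 + `|t|)}.
    by apply: cvgD; [exact: cvg_cst|exact: norm_continuous].
  have t0 : 0 < 1 + `|t| by rewrite ltr_wpDr.
  exact: (continuous_comp c1 (is_derive_continuous (is_derive1_powR (- p) t0))).
apply/integrableP; split.
  by apply/measurable_EFinP; exact: continuous_measurable_fun.
under eq_integral do rewrite /= ger0_norm ?powR_ge0//.
have f0 (x : R) : 0 <= (1 + `|x|) `^ (- p) by exact: powR_ge0.
rewrite (ge0_symfun_integralT f0 cf); last by move=> x /=; rewrite normrN.
rewrite -set_itvcy.
pose F (t : R) : R := (1 - p)^-1 * (1 + t) `^ (1 - p).
have dF (x : R) : 0 <= x -> is_derive x 1 F ((1 + x) `^ (- p)).
  move=> x0; have x1 : 0 < 1 + x by rewrite ltr_wpDr.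
  apply: (is_derive_eq (is_derive_scale _ (is_derive_compose
    (is_derive1_powR (1 - p) x1) (is_derive_add (is_derive_const 1 x) (is_derive_id x 1))))).
  rewrite add0r mulr1 mulrA mulVf ?mul1r; first by congr powR; lra.
  by rewrite subr_eq0 lt_eqF.
rewrite (@ge0_continuous_FTC2y _ _ F 0 0).
- by rewrite -EFinB -EFinM ltry.
- by move=> x _; exact: powR_ge0.
- exact: continuous_subspaceT.
- rewrite -(mulr0 (1 - p)^-1); apply: cvgMr.
  apply/cvgrPdist_lt => e e0; near=> t.
  rewrite sub0r normrN ger0_norm ?powR_ge0//.
  (* The threshold solves t^(1 - p) = e; as 1 - p is negative, the power stays below [e] beyond
     it. *)
  have t0 : Num.max 0 (expR (ln e / (1 - p))) < t.
    by near: t; apply: nbhs_pinfty_gt; rewrite num_real.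
  move: t0; rewrite gt_max => /andP[t0 et].
  have t1 : 0 < 1 + t by rewrite addr_gt0.
  rewrite /powR gt_eqF// -[X in _ < X](lnK e0) ltr_expR.
  have : ln e / (1 - p) < ln (1 + t).
    rewrite -[ltLHS]expRK ltr_ln ?posrE ?expR_gt0//.
    by rewrite (lt_trans et)// ltrDr.
  by rewrite ltr_ndivrMr ?subr_lt0// mulrC.
- move=> x x0; by case: (dF x (ltW x0)).
- by apply: cvg_at_right_filter; apply: is_derive_continuous (dF 0 (lexx 0)).
- move=> x; rewrite in_itv/= andbT => x0.
  by rewrite (is_derive_derive1 (dF x (ltW x0))) ger0_norm// ltW.
Unshelve. all: end_near. Qed.

End real_line.

Section envelopes.
Context {R : realType}.
Local Notation leb := (@lebesgue_measure R).
Local Notation integ g := (leb.-integrable setT (EFin \o g)).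

(** The common majorant: it is integrable, it makes boundary terms vanish at infinity, and multiples
    of its tensor square dominate Schwartz functions on the plane. *)
Definition decay (t : R) : R := (1 + t ^+ 2)^-1.

Lemma decay_gt0 t : 0 < decay t.
Proof. by rewrite invr_gt0 ltr_wpDr// sqr_ge0. Qed.

Lemma decay_le (t : R) : decay t <= 2 * (1 + `|t|)^-1.
Proof.
have t0 : 0 <= `|t| by [].
have tt : t ^+ 2 = `|t| ^+ 2 by rewrite real_normK// num_real.
rewrite /decay tt -[leLHS]mul1r ler_pdivrMr; last nra.
by rewrite mulrAC ler_pdivlMr; nra.
Qed.

Lemma continuous_decay : continuous decay.
Proof.
move=> t; apply: cvgV; first by rewrite gt_eqF// ltr_wpDr// sqr_ge0.
apply: cvgD; first exact: cvg_cst.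
exact: exprn_continuous.
Qed.

Lemma integrable_decay : integ decay.
Proof.
have i2 := integrable_powR_decay (ltr1n R 2).
apply: le_integrable_real (integrableZ_real 2 i2) _.
  by apply: continuous_measurable_fun; exact: continuous_decay.
move=> t; rewrite ger0_norm; last exact/ltW/decay_gt0.
rewrite powRN powR_mulrn ?addr_ge0//.
have t0 : 0 <= `|t| by [].
have tt : t ^+ 2 = `|t| ^+ 2 by rewrite real_normK// num_real.
rewrite /decay tt -[leLHS]mul1r ler_pdivrMr; last nra.
have p0 : 0 < 1 + `|t| by lra.
rewrite mulrAC (ler_pdivlMr _ _ (exprn_gt0 2 p0)).
by have := sqr_ge0 (`|t| - 1); nra.
Qed.

(** Combine exp(-u) <= 1 / (1 + u), for u = b (t - c)^2, with 1 + t^2 <= 2 (1 + (t - c)^2) (1 +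
    c^2). The constant depends on [c], so with varying [c] this serves only to justify integrations
    by parts; quantitative uses have [c = 0]. *)
Lemma gauss_le_decay b c : 0 < b -> exists2 K : R, 0 < K &
  forall t, gauss b c t <= K * decay t.
Proof.
move=> b0.
have c0 : 0 < 1 + c ^+ 2 by rewrite ltr_wpDr ?sqr_ge0.
have b1 : 0 < 1 + b^-1 by rewrite addr_gt0 ?invr_gt0.
exists (2 * (1 + b^-1) * (1 + c ^+ 2)); first by rewrite !mulr_gt0.
move=> t; rewrite /gauss /decay.
have ub : (1 + b * (t - c) ^+ 2) <= expR (b * (t - c) ^+ 2) by exact: expR_ge1Dx.
have u0 : 0 <= b * (t - c) ^+ 2 by rewrite mulr_ge0 ?sqr_ge0// ltW.
rewrite expRN ler_pdivlMr; last by rewrite ltr_wpDr// sqr_ge0.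
rewrite ler_pdivrMl ?expR_gt0//.
apply: (@le_trans _ _ ((1 + b * (t - c) ^+ 2) * (2 * (1 + b^-1) * (1 + c ^+ 2)))); last first.
  by rewrite ler_wpM2r// !mulr_ge0 ?addr_ge0 ?sqr_ge0// invr_ge0 ltW.
have bi : b * b^-1 = 1 by rewrite divff// gt_eqF.
have bi0 : 0 < b^-1 by rewrite invr_gt0.
have -> : (1 + b * (t - c) ^+ 2) * (2 * (1 + b^-1) * (1 + c ^+ 2)) =
  2 * (1 + b^-1 + b * (t - c) ^+ 2 + (b * b^-1) * (t - c) ^+ 2) * (1 + c ^+ 2) by ring.
rewrite bi mul1r.
apply: (@le_trans _ _ (2 * (1 + (t - c) ^+ 2) * (1 + c ^+ 2))).
  by have := sqr_ge0 (t - 2 * c); have := sqr_ge0 ((t - c) * c); nra.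
by rewrite ler_wpM2r ?addr_ge0 ?sqr_ge0// ler_wpM2l//; lra.
Qed.

Lemma cvg_decay_bound (k : R -> R) (M : R) : (forall t, `|k t| <= M * decay t) ->
  k n%:R @[n --> \oo] --> 0 /\ k (- n%:R) @[n --> \oo] --> 0.
Proof.
move=> kM.
have M0 : 0 <= M.
  have := le_trans (normr_ge0 _) (kM 0).
  by rewrite pmulr_lge0 ?decay_gt0.
have H : (2 * M) * @harmonic R n @[n --> \oo] --> 0.
  rewrite -(mulr0 (2 * M)); apply: cvgM; [exact: cvg_cst|exact: cvg_harmonic].
have bd (u : R) n : `|u| = n%:R -> `|k u| <= (2 * M) * @harmonic R n.
  move=> un; rewrite (le_trans (kM _))//.
  have := decay_le u; rewrite un nat1r => h.
  by rewrite [2 * M]mulrC -mulrA ler_wpM2l.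
split; apply/norm_cvg0P; apply: (squeeze_cvgr _ (cvg_cst 0) H); apply: nearW => n;
  by rewrite normr_ge0/= bd// ?normrN normr_nat.
Qed.

(** Half of the Gaussian exponent pays for the weight: N = 8 pi in [powR_le_expR] costs exp((pi / 2)
    (t - c)^2) and the constant exp(1 / (8 pi)). Nothing depends on the centre, which later is the
    frequency of a packet. *)
Lemma gauss_absorb (a : R) : 0 < a -> exists2 K : R, 0 < K &
  forall c t, (1 + 4 * pi ^+ 2 * (t - c) ^+ 2) `^ a * gauss pi c t <= K * gauss (pi / 2) c t.
Proof.
move=> a0; have p0 := @pi_gt0 R.
exists ((8 * pi * a) `^ a * expR ((8 * pi)^-1)).
  by rewrite mulr_gt0 ?expR_gt0// powR_gt0// !mulr_gt0.
move=> c t; set y := 1 + _.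
have y0 : 0 <= y by rewrite addr_ge0// mulr_ge0 ?sqr_ge0// mulr_ge0// sqr_ge0.
have N0 : 0 < 8 * pi :> R by rewrite mulr_gt0.
have := powR_le_expR y0 a0 N0.
rewrite -(ler_pM2r (gauss_gt0 pi c t)) => /le_trans; apply.
rewrite -!mulrA ler_wpM2l ?powR_ge0// /gauss -!expRD ler_expR /y.
rewrite le_eqVlt; apply/orP; left; apply/eqP.
by move: p0 {y y0 N0}; move: (@pi R) => P P0; field; rewrite gt_eqF.
Qed.

End envelopes.

Section gaussian_transform.
Context {R : realType}.
Local Notation leb := (@lebesgue_measure R).
Local Notation integ g := (leb.-integrable setT (EFin \o g)).

Lemma Rintegral_derive_decay (k dk : R -> R) (M M' : R) :
  (forall t : R, is_derive t 1 k (dk t)) -> continuous dk ->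
  (forall t, `|k t| <= M * decay t) -> (forall t, `|dk t| <= M' * decay t) ->
  \int[leb]_t dk t = 0.
Proof.
move=> kdk cdk kM dkM; have [k1 k2] := cvg_decay_bound kM.
apply: (Rintegral_derive0 kdk cdk _ k1 k2).
apply: (le_integrable_real _ (integrableZ_real M' integrable_decay) dkM).
exact: continuous_measurable_fun.
Qed.

Lemma gauss_ge0 (b c t : R) : 0 <= gauss b c t.
Proof. exact: expR_ge0. Qed.

Lemma is_derive_gauss (b c t : R) :
  is_derive t 1 (gauss b c) (- (2 * b * (t - c)) * gauss b c t).
Proof.
apply: (is_derive_eq (is_derive_compose (is_derive_expR _) (is_derive_opp
  (is_derive_scale b (is_derive_sqr (is_derive_translate c t)))))).
by rewrite /gauss mulrC; congr (_ * _); ring.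
Qed.

Lemma is_derive_cos_affine (w u t : R) :
  is_derive t 1 (fun t => cos (w * t + u)) (- w * sin (w * t + u)).
Proof.
apply: (is_derive_eq (is_derive_compose (is_derive_cos _)
  (is_derive_add (is_derive_scale w (is_derive_id t 1)) (is_derive_const u t)))).
by rewrite addr0 mulr1 mulrC mulrN mulNr.
Qed.

Lemma is_derive_sin_affine (w u t : R) :
  is_derive t 1 (fun t => sin (w * t + u)) (w * cos (w * t + u)).
Proof.
apply: (is_derive_eq (is_derive_compose (is_derive_sin _)
  (is_derive_add (is_derive_scale w (is_derive_id t 1)) (is_derive_const u t)))).
by rewrite addr0 mulr1 mulrC.
Qed.

Lemma normr_cos_le1 (t : R) : `|cos t| <= 1.
Proof. by rewrite ler_norml cos_geN1 cos_le1. Qed.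

Lemma normr_sin_le1 (t : R) : `|sin t| <= 1.
Proof. by rewrite ler_norml sin_geN1 sin_le1. Qed.

(** The case a = 1 of [gauss_absorb], as u <= 1 + u^2. It dominates the derivative of the transform
    in the frequency, and later pays for the linear factors in a Lipschitz bound. *)
Lemma gauss_moment : exists2 K : R, 0 < K &
  forall c t, 2 * pi * `|t - c| * gauss pi c t <= K * gauss (pi / 2) c t.
Proof.
have [K K0 KP] := @gauss_absorb R 1 ltr01.
exists K => // c t; apply: le_trans (KP c t).
rewrite ler_wpM2r ?gauss_ge0// powRr1; last first.
  by rewrite addr_ge0// mulr_ge0 ?sqr_ge0// mulr_ge0 ?sqr_ge0.
have -> : 4 * pi ^+ 2 * (t - c) ^+ 2 = (2 * pi * `|t - c|) ^+ 2.
  by rewrite !exprMn real_normK ?num_real//; ring.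
by move: (2 * pi * `|t - c|) => x; have := sqr_ge0 (x - 1); have := sqr_ge0 x; nra.
Qed.

(* As a function of xi, the integral solves y' = - 2 pi xi y. *)
Lemma integral_gauss_cos c theta xi :
  \int[leb]_t (gauss pi c t * cos (2 * pi * xi * t + (theta - 2 * pi * xi * c))) =
  cos theta * gauss pi 0 xi.
Proof.
(* The phase at the centre [t = c] is [theta] for every [x], so differentiating in [x] brings down t
   - c, the factor that differentiating the Gaussian in [t] also produces. *)
pose f (x t : R) : R := gauss pi c t * cos (2 * pi * x * t + (theta - 2 * pi * x * c)).
pose C x := \int[leb]_t f x t.
have p0 := @pi_gt0 R.
have [ig eg] := integral_gauss c p0.
have ifx x : integ (f x).
  apply: le_integrable_real ig _.
    apply: continuous_measurable_fun => t; apply: cvgM; first exact: continuous_gauss.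
    exact: is_derive_continuous (is_derive_cos_affine _ _ _).
  move=> t; rewrite normrM ger0_norm ?gauss_ge0//.
  by rewrite ler_piMr ?normr_cos_le1// gauss_ge0.
pose df (x t : R) := - (2 * pi * (t - c)) * gauss pi c t * sin (2 * pi * x * t +
  (theta - 2 * pi * x * c)).
have fdf (x t : R) : is_derive x 1 (f ^~ t) (df x t).
  have E : f ^~ t = (fun x => gauss pi c t * cos (2 * pi * (t - c) * x + theta)).
    by apply/funext => y; rewrite /f; congr (_ * cos _); ring.
  rewrite E; apply: (is_derive_eq (is_derive_scale _ (is_derive_cos_affine _ _ _))).
  by rewrite /df mulrA [gauss _ _ _ * _]mulrC; congr (_ * sin _); ring.
have [K K0 KP] := gauss_moment.
have [ie _] := integral_gauss c (divr_gt0 p0 (ltr0Sn R 1)).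
have dfK x t : `|df x t| <= K * gauss (pi / 2) c t.
  rewrite /df normrM (le_trans _ (KP c t))// normrM normrN normrM.
  rewrite [`|2 * pi|]ger0_norm ?mulr_ge0 ?pi_ge0// [`|gauss _ _ _|]ger0_norm ?gauss_ge0//.
  by rewrite ler_piMr ?normr_sin_le1// !mulr_ge0 ?pi_ge0 ?gauss_ge0.
have dC (x : R) : is_derive x 1 C (\int[leb]_t df x t).
  have xI : `]x - 1, x + 1[%classic x by rewrite /= in_itv/=; lra.
  have A1 y : `]x - 1, x + 1[%classic y -> integ (f y) by move=> _; exact: ifx.
  have A2 y z : `]x - 1, x + 1[%classic y -> [set: R] z -> derivable (f ^~ z) y 1.
    by move=> _ _; case: (fdf y z).
  have A3 y : 0 <= K * gauss (pi / 2) c y by rewrite mulr_ge0 ?gauss_ge0// ltW.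
  have A4 y z : `]x - 1, x + 1[%classic y -> [set: R] z ->
      `|partial1of2 f y z| <= K * gauss (pi / 2) c z.
    by move=> _ _; rewrite partial1of2E; have [_ ->] := fdf y z.
  have A5 := integrableZ_real K ie.
  split; first exact: (@derivable_under_integral _ _ _ leb f setT measurableT x (x-1)
    (x+1) xI A1 A2 _ A3 A5 A4).
  rewrite -derive1E (@differentiation_under_integral _ _ _ leb f setT measurableT x (x-1)
    (x+1) xI A1 A2 _ A3 A5 A4).
  by apply: eq_Rintegral => t _; rewrite partial1of2E; have [_ ->] := fdf x t.
have [K' K'0 K'P] := @gauss_le_decay R pi c p0.
have [K2 K20 K2P] := @gauss_le_decay R (pi / 2) c (divr_gt0 p0 (ltr0Sn R 1)).
have dCE x : \int[leb]_t df x t = - (2 * pi * x) * C x.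
  (* The derivative of [k] in [t] is [df x t + 2 * pi * x * f x t], and its integral vanishes: this
     is the differential equation. *)
  pose k t := gauss pi c t * sin (2 * pi * x * t + (theta - 2 * pi * x * c)).
  pose dk t := df x t + 2 * pi * x * f x t.
  have kdk (t : R) : is_derive t 1 k (dk t).
    apply: (is_derive_eq (is_derive_mul (is_derive_gauss _ _ _) (is_derive_sin_affine _ _ _))).
    by rewrite /dk /df /f; ring.
  have cdk : continuous dk.
    move=> t; apply: cvgD; last first.
      apply: cvgM; first exact: cvg_cst.
      apply: cvgM; first exact: continuous_gauss.
      exact: is_derive_continuous (is_derive_cos_affine _ _ _).
    apply: cvgM; last exact: is_derive_continuous (is_derive_sin_affine _ _ _).
    apply: cvgM; last exact: continuous_gauss.
    apply: cvgN; apply: cvgM; first exact: cvg_cst.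
    exact: is_derive_continuous (is_derive_translate _ _).
  have kM t : `|k t| <= K' * decay t.
    apply: le_trans (K'P t); rewrite normrM ger0_norm ?gauss_ge0//.
    by rewrite ler_piMr ?normr_sin_le1// gauss_ge0.
  have dkM t : `|dk t| <= (K * K2 + `|2 * pi * x| * K') * decay t.
    rewrite mulrDl (le_trans (ler_normD _ _))// lerD//.
      by rewrite (le_trans (dfK x t))// -mulrA ler_wpM2l// ltW.
    rewrite normrM -[leRHS]mulrA ler_wpM2l// /f normrM ger0_norm ?gauss_ge0//.
    apply: le_trans (K'P t).
    by rewrite ler_piMr ?normr_cos_le1// gauss_ge0.
  have := Rintegral_derive_decay kdk cdk kM dkM.
  rewrite /dk RintegralD//; last first.
    - exact: integrableZ_real.
    - apply: le_integrable_real (integrableZ_real K ie) (dfK x).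
      apply: continuous_measurable_fun.
      have -> : df x = (fun t => dk t - 2 * pi * x * f x t).
        by apply/funext => t; rewrite /dk addrK.
      move=> t; apply: cvgB; first exact: cdk.
      apply: cvgM; first exact: cvg_cst.
      apply: cvgM; first exact: continuous_gauss.
      exact: is_derive_continuous (is_derive_cos_affine _ _ _).
  by rewrite RintegralZl// -/(C x) => /eqP; rewrite addr_eq0 => /eqP ->; ring.
(* Integrating factor: [D] is constant, and its value at 0 is cos theta. *)
pose D x := C x * expR (pi * x ^+ 2).
have dD (x : R) : is_derive x 1 D 0.
  apply: (is_derive_eq (is_derive_mul (dC x) (is_derive_compose (is_derive_expR _)
    (is_derive_scale pi (is_derive_sqr (is_derive_id x 1)))))).
  by rewrite dCE; ring.
have := is_derive_0_is_cst xi 0 dD.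
rewrite /D expr0n mulr0 expR0 mulr1.
have -> : C 0 = cos theta.
  rewrite /C /f.
  under eq_Rintegral do rewrite mulr0 !mul0r subr0 add0r.
  by rewrite RintegralZr// eg divff ?sqrtr1 ?mul1r// gt_eqF.
rewrite -/(C xi) => <-; rewrite /gauss subr0 -mulrA -expRD subrr expR0 mulr1//.
Qed.

End gaussian_transform.

(** * Wave packets and their Fourier transforms *)

Section wave_packets.
Context {R : realType}.
Local Notation leb := (@lebesgue_measure R).
Local Notation integ mu g := (mu.-integrable setT (EFin \o g)).

Lemma cintegral_gauss_expi (c xi : R) :
  cintegral leb (fun t => (gauss pi c t)%:C%C * expi (t * xi)) =
  (gauss pi 0 xi)%:C%C * expi (c * xi).
Proof.
apply: complex_ext; rewrite ?(cReZ, cImZ) /=.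
  rewrite [RHS]mulrC -(integral_gauss_cos c _ xi); apply: eq_Rintegral => t _.
  by rewrite mul0r subr0; congr (_ * cos _); ring.
(* The imaginary part is the cosine formula with [theta] moved by a quarter turn. *)
have -> : sin (2 * pi * (c * xi)) = cos (2 * pi * (c * xi) - pi / 2).
  by rewrite cosB cos_pihalf sin_pihalf mulr0 add0r mulr1.
rewrite [RHS]mulrC -(integral_gauss_cos c _ xi); apply: eq_Rintegral => t _.
rewrite mul0r addr0; congr (_ * _).
have -> : 2 * pi * xi * t + (2 * pi * (c * xi) - pi / 2 - 2 * pi * xi * c) =
  2 * pi * (t * xi) - pi / 2 by ring.
by rewrite cosB cos_pihalf sin_pihalf mulr0 add0r mulr1.
Qed.

Lemma cintegrable_gauss (b c : R) : 0 < b ->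
  cintegrable leb (fun t => (gauss b c t)%:C%C).
Proof. by move=> b0; apply: cintegrable_real; have [] := integral_gauss c b0. Qed.

Lemma cmeasurable_expiZ (xi : R) : cmeasurable (fun t : measurableTypeR R => expi (t * xi) : R[i]).
Proof. by apply: cmeasurable_expi; exact: measurable_funM. Qed.

Lemma cintegrable_gauss_expi (c xi : R) :
  cintegrable leb (fun t => (gauss pi c t)%:C%C * expi (t * xi)).
Proof.
apply: (cintegrableM_bounded (cintegrable_gauss c (pi_gt0 R)) (M := 1)).
  exact: cmeasurable_expiZ.
by move=> x; rewrite cnorm_expi.
Qed.

Definition gauss2 (b : R) (c x : R * R) : R := gauss b c.1 x.1 * gauss b c.2 x.2.

Lemma gauss2_ge0 b c x : 0 <= gauss2 b c x.
Proof. by rewrite mulr_ge0 ?gauss_ge0. Qed.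

Lemma continuous_fst (f : R -> R) : continuous f -> continuous (fun x : R * R => f x.1).
Proof. by move=> cf x; apply: (continuous_comp cvg_fst (cf x.1)). Qed.

Lemma continuous_snd (f : R -> R) : continuous f -> continuous (fun x : R * R => f x.2).
Proof. by move=> cf x; apply: (continuous_comp cvg_snd (cf x.2)). Qed.

Lemma continuous_gauss2 b c : continuous (gauss2 b c).
Proof.
by move=> x; apply: cvgM;
  [exact: (continuous_fst (@continuous_gauss R b c.1))|exact: (continuous_snd
    (@continuous_gauss R b c.2))].
Qed.

Lemma integrable_tensor2 (f g : R -> R) : integ leb f -> integ leb g ->
  integ leb2 (fun x => f x.1 * g x.2).
Proof. by move=> fi gi; exact: (integrable_tensor fi gi). Qed.

Lemma Rintegral_tensor2 (f g : R -> R) : integ leb f -> integ leb g ->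
  \int[leb2]_x (f x.1 * g x.2) = \int[leb]_t f t * \int[leb]_t g t.
Proof.
move=> fi gi; have [_ e] := Rfubini1 (integrable_tensor fi gi).
apply: (etrans e) => /=; under eq_Rintegral do rewrite RintegralZl//.
by rewrite RintegralZr.
Qed.

Lemma cintegral_tensor2 (f g : R -> R[i]) : cintegrable leb f -> cintegrable leb g ->
  cintegral leb2 (fun x => f x.1 * g x.2) = cintegral leb f * cintegral leb g.
Proof. by move=> fi gi; exact: (cintegral_tensor fi gi). Qed.

Lemma integral_gauss2 b c : 0 < b -> integ leb2 (gauss2 b c) /\
  \int[leb2]_x gauss2 b c x = pi / b.
Proof.
move=> b0; have [i1 e1] := integral_gauss c.1 b0; have [i2 e2] := integral_gauss c.2 b0.
split; first exact: integrable_tensor2.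
by rewrite Rintegral_tensor2// e1 e2 -expr2 sqr_sqrtr// divr_ge0 ?pi_ge0// ltW.
Qed.

Lemma measurable_dot (xi : R * R) :
  measurable_fun setT (fun x : measurableTypeR R * measurableTypeR R => x.1 * xi.1 + x.2 * xi.2).
Proof. by apply: measurable_funD; apply: measurable_funM. Qed.

Lemma cintegral_gauss2_expi (c xi : R * R) :
  cintegral leb2 (fun x => (gauss2 pi c x)%:C%C * expi (x.1 * xi.1 + x.2 * xi.2)) =
  (gauss2 pi 0 xi)%:C%C * expi (c.1 * xi.1 + c.2 * xi.2).
Proof.
have E : (fun x : R * R => (gauss2 pi c x)%:C%C * expi (x.1 * xi.1 + x.2 * xi.2)) =
    fun x => ((gauss pi c.1 x.1)%:C%C * expi (x.1 * xi.1)) *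
             ((gauss pi c.2 x.2)%:C%C * expi (x.2 * xi.2)).
  by apply/funext => x; rewrite expiD /gauss2 rmorphM/= mulrACA.
rewrite E (cintegral_tensor2 (cintegrable_gauss_expi _ _) (cintegrable_gauss_expi _ _)).
by rewrite !cintegral_gauss_expi expiD /gauss2 rmorphM/= mulrACA.
Qed.

Definition packet (tau x : R * R) : R[i] :=
  (gauss2 pi 0 x)%:C%C * expi (x.1 * tau.1 + x.2 * tau.2).

Lemma cnorm_packet tau x : cnorm (packet tau x) = gauss2 pi 0 x.
Proof. by rewrite Normc.normcM cnorm_expi mulr1 cnorm_real ger0_norm// gauss2_ge0. Qed.

(** Modulation becomes translation, and [gauss2 pi 0] is its own transform. *)
Lemma fourier_packet tau xi : fourier (packet tau) xi = (gauss2 pi tau xi)%:C%C.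
Proof.
pose d := (tau.1 - xi.1, tau.2 - xi.2).
transitivity (cintegral leb2 (fun x => (gauss2 pi 0 x)%:C%C * expi (x.1 * d.1 + x.2 * d.2))).
  apply: eq_cintegral => x; rewrite /packet -mulrA -expiD; congr (_ * expi _).
  by rewrite /d /=; ring.
rewrite cintegral_gauss2_expi /= !mul0r addr0 expi0 mulr1.
by congr (_%:C)%C; rewrite /gauss2 /gauss /=; congr (expR _ * expR _); ring.
Qed.

Lemma cintegrable_packet tau : cintegrable leb2 (packet tau).
Proof.
apply: (cintegrableM_bounded _ _ (M := 1)).
- by apply: cintegrable_real; have [] := integral_gauss2 0 (pi_gt0 R).
- by apply: cmeasurable_expi; exact: measurable_dot.
- by move=> x; rewrite cnorm_expi.
Qed.

End wave_packets.

(** * Integration by parts *)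

Section complex_derivative.
Context {R : realType}.
Local Notation leb := (@lebesgue_measure R).

Definition cderive (h : R -> R[i]) (t : R) (d : R[i]) : Prop :=
  is_derive t 1 (fun u => Re (h u)) (Re d) /\
  is_derive t 1 (fun u => Im (h u)) (Im d).

Definition ccontinuous (T : topologicalType) (h : T -> R[i]) : Prop :=
  continuous (fun x => Re (h x)) /\ continuous (fun x => Im (h x)).

Lemma cderive_real (f : R -> R) (t a : R) : is_derive t 1 f a ->
  cderive (fun u => (f u)%:C%C) t a%:C%C.
Proof. by move=> fa; split => //=; exact: is_derive_const. Qed.

Lemma cderiveM f g t a b : cderive f t a -> cderive g t b ->
  cderive (fun u => f u * g u) t (a * g t + f t * b).
Proof.
move=> [fr fi] [gr gi]; split.
  have -> : (fun u => Re (f u * g u)) = fun u => Re (f u) * Re (g u) + - (Im (f u) * Im (g u)).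
    by apply/funext => u; rewrite cReM.
  apply: (is_derive_eq (is_derive_add (is_derive_mul fr gr) (is_derive_opp (is_derive_mul fi gi)))).
  by rewrite cReD !cReM; ring.
have -> : (fun u => Im (f u * g u)) = fun u => Re (f u) * Im (g u) + Im (f u) * Re (g u).
  by apply/funext => u; rewrite cImM.
apply: (is_derive_eq (is_derive_add (is_derive_mul fr gi) (is_derive_mul fi gr))).
by rewrite cImD !cImM; ring.
Qed.

Lemma cderive_expi (xi t : R) :
  cderive (fun u => expi (u * xi)) t ((0 +i* (2 * pi * xi))%C * expi (t * xi)).
Proof.
have E u : 2 * pi * (u * xi) = (2 * pi * xi) * u + 0 by ring.
split; rewrite ?(cReM, cImM) /=.
  have -> : (fun u => cos (2 * pi * (u * xi))) = fun u => cos ((2 * pi * xi) * u + 0).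
    by apply/funext => u; rewrite E.
  by apply: (is_derive_eq (is_derive_cos_affine _ _ _)); rewrite E; ring.
have -> : (fun u => sin (2 * pi * (u * xi))) = fun u => sin ((2 * pi * xi) * u + 0).
  by apply/funext => u; rewrite E.
by apply: (is_derive_eq (is_derive_sin_affine _ _ _)); rewrite E; ring.
Qed.

Lemma ccontinuousD (T : topologicalType) (f g : T -> R[i]) :
  ccontinuous f -> ccontinuous g -> ccontinuous (fun x => f x + g x).
Proof.
move=> [f1 f2] [g1 g2]; split.
  by under eq_fun do rewrite cReD; move=> x; apply: cvgD; [exact: f1|exact: g1].
by under eq_fun do rewrite cImD; move=> x; apply: cvgD; [exact: f2|exact: g2].
Qed.

Lemma ccontinuousM (T : topologicalType) (f g : T -> R[i]) :
  ccontinuous f -> ccontinuous g -> ccontinuous (fun x => f x * g x).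
Proof.
move=> [f1 f2] [g1 g2]; split.
  under eq_fun do rewrite cReM; move=> x; apply: cvgB; apply: cvgM;
    by [exact: f1|exact: g1|exact: f2|exact: g2].
under eq_fun do rewrite cImM; move=> x; apply: cvgD; apply: cvgM;
  by [exact: f1|exact: g1|exact: f2|exact: g2].
Qed.

Lemma ccontinuous_cst (T : topologicalType) (c : R[i]) : ccontinuous (fun _ : T => c).
Proof. by split => x; exact: cvg_cst. Qed.

Lemma ccontinuous_real (T : topologicalType) (f : T -> R) : continuous f ->
  ccontinuous (fun x => (f x)%:C%C).
Proof. by move=> cf; split => //= x; exact: cvg_cst. Qed.

Lemma cderive_continuous h dh : (forall t, cderive h t (dh t)) -> ccontinuous h.
Proof. by move=> hdh; split=> t; have [h1 h2] := hdh t;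
  [exact: is_derive_continuous h1|exact: is_derive_continuous h2]. Qed.

Lemma ccontinuous_expi (xi : R) : ccontinuous (fun t : R => expi (t * xi) : R[i]).
Proof. exact: cderive_continuous (cderive_expi xi). Qed.

Lemma ccontinuous_measurable (h : R -> R[i]) : ccontinuous h ->
  cmeasurable (h : measurableTypeR R -> _).
Proof. by move=> [? ?]; split; exact: continuous_measurable_fun. Qed.

Lemma ccontinuous_measurable2 (h : R * R -> R[i]) : ccontinuous h ->
  cmeasurable (h : measurableTypeR R * measurableTypeR R -> _).
Proof. by move=> [? ?]; split; exact: continuous_measurable_plane. Qed.

Lemma decay_cintegrable (h : R -> R[i]) M : ccontinuous h ->
  (forall t, cnorm (h t) <= M * decay t) -> cintegrable leb h.
Proof.
move=> ch hM; apply: (le_cintegrable _ (integrableZ_real M integrable_decay) hM).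
exact: ccontinuous_measurable.
Qed.

(** The product [h t * expi (t * xi)] vanishes at infinity, so its derivative has integral 0. *)
Lemma cintegral_by_parts (h dh : R -> R[i]) (M xi : R) :
  (forall t, cderive h t (dh t)) -> ccontinuous dh ->
  (forall t, cnorm (h t) <= M * decay t) ->
  (forall t, cnorm (dh t) <= M * decay t) ->
  cintegral leb (fun t => dh t * expi (t * xi)) =
  (0 +i* (- (2 * pi * xi)))%C * cintegral leb (fun t => h t * expi (t * xi)).
Proof.
move=> hdh cdh hM dhM; have ch := cderive_continuous hdh.
set al : R[i] := (0 +i* (2 * pi * xi))%C.
have ce := ccontinuous_expi xi.
have che := ccontinuousM ch ce.
have cdhe := ccontinuousM cdh ce.
have heM t : cnorm (h t * expi (t * xi)) <= M * decay t.
  by rewrite Normc.normcM cnorm_expi mulr1.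
have dheM t : cnorm (dh t * expi (t * xi)) <= M * decay t.
  by rewrite Normc.normcM cnorm_expi mulr1.
have ihe := decay_cintegrable che heM.
have idhe := decay_cintegrable cdhe dheM.
pose dk t := dh t * expi (t * xi) + h t * (al * expi (t * xi)).
have kdk t : cderive (fun u => h u * expi (u * xi)) t (dk t).
  exact: cderiveM (hdh t) (cderive_expi xi t).
have cdk : ccontinuous dk.
  apply: ccontinuousD => //; apply: ccontinuousM => //; apply: ccontinuousM => //.
  exact: ccontinuous_cst.
have dkM t : cnorm (dk t) <= (M + cnorm al * M) * decay t.
  rewrite (le_trans (cnormD _ _))// mulrDl lerD// mulrCA Normc.normcM -mulrA.
  by rewrite ler_wpM2l ?cnorm_ge0.
have : cintegral leb dk = 0.
  have [cr ci] := cdk; apply: complex_ext => /=.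
    apply: (Rintegral_derive_decay (fun t => (kdk t).1) cr).
      by move=> t; exact: le_trans (normr_Re_le _) (heM t).
    by move=> t; exact: le_trans (normr_Re_le _) (dkM t).
  apply: (Rintegral_derive_decay (fun t => (kdk t).2) ci).
    by move=> t; exact: le_trans (normr_Im_le _) (heM t).
  by move=> t; exact: le_trans (normr_Im_le _) (dkM t).
rewrite (_ : dk = fun t => dh t * expi (t * xi) + al * (h t * expi (t * xi))); last first.
  by apply/funext => t; rewrite /dk mulrCA.
rewrite cintegralD//; last exact: cintegrableZ.
rewrite cintegralZ// => /eqP; rewrite addr_eq0 => /eqP ->.
by rewrite -mulNr; congr (_ * _); apply: complex_ext; rewrite /= ?oppr0.
Qed.

Lemma continuous_section1 (f : R * R -> R) y : continuous f -> continuous (fun t => f (t, y)).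
Proof.
move=> cf t; apply: (@cvg_comp _ _ _ (fun t => (t, y)) f); last exact: cf.
by apply: (@cvg_pair _ _ _ _ (nbhs t) (nbhs y)); [exact: cvg_id|exact: cvg_cst].
Qed.

Lemma continuous_section2 (f : R * R -> R) y : continuous f -> continuous (fun t => f (y, t)).
Proof.
move=> cf t; apply: (@cvg_comp _ _ _ (fun t => (y, t)) f); last exact: cf.
by apply: (@cvg_pair _ _ _ _ (nbhs y) (nbhs t)); [exact: cvg_cst|exact: cvg_id].
Qed.

Definition decay2 (x : R * R) : R := decay x.1 * decay x.2.

Lemma integrable_decay2 : leb2.-integrable setT (EFin \o decay2).
Proof. by apply: integrable_tensor2; exact: integrable_decay. Qed.

Lemma decay2_cintegrable (h : R * R -> R[i]) M : ccontinuous h ->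
  (forall x, cnorm (h x) <= M * decay2 x) -> cintegrable leb2 h.
Proof.
move=> ch hM; apply: (le_cintegrable _ (integrableZ_real M integrable_decay2) hM).
exact: ccontinuous_measurable2.
Qed.

Lemma ccontinuous_dot (xi : R * R) :
  ccontinuous (fun x : R * R => expi (x.1 * xi.1 + x.2 * xi.2) : R[i]).
Proof.
under eq_fun do rewrite expiD.
have [r1 i1] := ccontinuous_expi xi.1; have [r2 i2] := ccontinuous_expi xi.2.
apply: ccontinuousM; split.
- exact: (continuous_fst r1).
- exact: (continuous_fst i1).
- exact: (continuous_snd r2).
- exact: (continuous_snd i2).
Qed.

Section by_parts_plane.
Variables (h dh : R * R -> R[i]) (M : R) (xi : R * R).
Hypotheses (ch : ccontinuous h) (cdh : ccontinuous dh).
Hypothesis hM : forall x, cnorm (h x) <= M * decay2 x.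
Hypothesis dhM : forall x, cnorm (dh x) <= M * decay2 x.

Let ce x := expi (x.1 * xi.1 + x.2 * xi.2) : R[i].

Let ihe : cintegrable leb2 (fun x => h x * ce x).
Proof.
apply: (decay2_cintegrable (M := M)); first exact: ccontinuousM ch (ccontinuous_dot xi).
by move=> x; rewrite Normc.normcM cnorm_expi mulr1.
Qed.

Let idhe : cintegrable leb2 (fun x => dh x * ce x).
Proof.
apply: (decay2_cintegrable (M := M)); first exact: ccontinuousM cdh (ccontinuous_dot xi).
by move=> x; rewrite Normc.normcM cnorm_expi mulr1.
Qed.

(** Fubini puts the differentiated variable innermost; for each frozen value of the other one, its
    exponential factor is constant and the formula on the line applies. *)
Lemma cintegral_by_parts1 :
  (forall x, cderive (fun t => h (t, x.2)) x.1 (dh x)) ->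
  cintegral leb2 (fun x => dh x * expi (x.1 * xi.1 + x.2 * xi.2)) =
  (0 +i* (- (2 * pi * xi.1)))%C *
  cintegral leb2 (fun x => h x * expi (x.1 * xi.1 + x.2 * xi.2)).
Proof.
move=> hdh; have [i1 e1] := cintegral_fubini2 idhe; have [i2 e2] := cintegral_fubini2 ihe.
apply: (etrans e1).
apply: (etrans _ (congr1 (fun z => _ * z) (esym e2))).
rewrite -cintegralZ.
2: exact: i2.
apply: eq_cintegral => /= y0; move: (y0 : R) => {y0} y.
have Hh u : cnorm (h (u, y)) <= M * decay y * decay u.
  by rewrite mulrAC -mulrA; exact: hM.
have Hdh u : cnorm (dh (u, y)) <= M * decay y * decay u.
  by rewrite mulrAC -mulrA; exact: dhM.
have cd : ccontinuous (fun u : R => dh (u, y)).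
  by split; [exact: (continuous_section1 cdh.1)|exact: (continuous_section1 cdh.2)].
have chh : ccontinuous (fun u : R => h (u, y)).
  by split; [exact: (continuous_section1 ch.1)|exact: (continuous_section1 ch.2)].
have E (k : R * R -> R[i]) : (forall u, cnorm (k (u, y)) <= M * decay y * decay u) ->
    ccontinuous (fun u : R => k (u, y)) ->
    cintegral leb (fun u => k (u, y) * ce (u, y)) =
    expi (y * xi.2) * cintegral leb (fun u => k (u, y) * expi (u * xi.1)).
  move=> kM ck; rewrite -cintegralZ.
    by apply: eq_cintegral => u; rewrite /ce /= expiD mulrA mulrC.
  apply: (decay_cintegrable (M := M * decay y)); first exact: ccontinuousM ck (ccontinuous_expi _).
  by move=> u; rewrite Normc.normcM cnorm_expi mulr1.
rewrite (E dh)// (E h)// mulrCA; congr (_ * _).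
exact: (@cintegral_by_parts (fun u => h (u, y)) (fun u => dh (u, y)) _ xi.1 (fun t => hdh (t,
  y)) cd Hh Hdh).
Qed.

Lemma cintegral_by_parts2 :
  (forall x, cderive (fun t => h (x.1, t)) x.2 (dh x)) ->
  cintegral leb2 (fun x => dh x * expi (x.1 * xi.1 + x.2 * xi.2)) =
  (0 +i* (- (2 * pi * xi.2)))%C *
  cintegral leb2 (fun x => h x * expi (x.1 * xi.1 + x.2 * xi.2)).
Proof.
move=> hdh; have [i1 e1] := cintegral_fubini1 idhe; have [i2 e2] := cintegral_fubini1 ihe.
apply: (etrans e1).
apply: (etrans _ (congr1 (fun z => _ * z) (esym e2))).
rewrite -cintegralZ.
2: exact: i2.
apply: eq_cintegral => /= y0; move: (y0 : R) => {y0} y.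
have Hh u : cnorm (h (y, u)) <= M * decay y * decay u.
  by rewrite -mulrA; exact: hM.
have Hdh u : cnorm (dh (y, u)) <= M * decay y * decay u.
  by rewrite -mulrA; exact: dhM.
have cd : ccontinuous (fun u : R => dh (y, u)).
  by split; [exact: (continuous_section2 cdh.1)|exact: (continuous_section2 cdh.2)].
have chh : ccontinuous (fun u : R => h (y, u)).
  by split; [exact: (continuous_section2 ch.1)|exact: (continuous_section2 ch.2)].
have E (k : R * R -> R[i]) : (forall u, cnorm (k (y, u)) <= M * decay y * decay u) ->
    ccontinuous (fun u : R => k (y, u)) ->
    cintegral leb (fun u => k (y, u) * ce (y, u)) =
    expi (y * xi.1) * cintegral leb (fun u => k (y, u) * expi (u * xi.2)).
  move=> kM ck; rewrite -cintegralZ.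
    by apply: eq_cintegral => u; rewrite /ce /= expiD mulrCA.
  apply: (decay_cintegrable (M := M * decay y)); first exact: ccontinuousM ck (ccontinuous_expi _).
  by move=> u; rewrite Normc.normcM cnorm_expi mulr1.
rewrite (E dh)// (E h)// mulrCA; congr (_ * _).
exact: (@cintegral_by_parts (fun u => h (y, u)) (fun u => dh (y, u)) _ xi.2 (fun t => hdh (y,
  t)) cd Hh Hdh).
Qed.

End by_parts_plane.
End complex_derivative.

(** * Schwartz functions *)

Section partial_derivatives.
Context {R : realType}.
Implicit Types (f : R * R -> R) (x : R * R).

(** The difference quotient along a basis vector of the plane is literally that of a section, which
    carries the directional derivatives in [Ck] over to calculus in one variable. *)
Lemma quotient_section1 f (t y : R) :
  (fun h : R => h^-1 *: ((f \o shift (t, y)) (h *: ((1, 0) : R * R)) - f (t, y))) =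
  (fun h : R => h^-1 *: (((fun u => f (u, y)) \o shift t) (h *: (1 : R)) - f (t, y))).
Proof.
apply/funext => h; congr (_ *: (f _ - _)).
by congr pair; rewrite /= ?scaler0 ?add0r.
Qed.

Lemma quotient_section2 f (t y : R) :
  (fun h : R => h^-1 *: ((f \o shift (y, t)) (h *: ((0, 1) : R * R)) - f (y, t))) =
  (fun h : R => h^-1 *: (((fun u => f (y, u)) \o shift t) (h *: (1 : R)) - f (y, t))).
Proof.
apply/funext => h; congr (_ *: (f _ - _)).
by congr pair; rewrite /= ?scaler0 ?add0r.
Qed.

Lemma derivable_partial1 f (t y : R) : derivable f (t, y) (1, 0) ->
  is_derive t 1 (fun u => f (u, y)) (partial1 f (t, y)).
Proof.
by rewrite /derivable quotient_section1 => df; split=> //;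
  rewrite /partial1 /derive quotient_section1.
Qed.

Lemma derivable_partial2 f (t y : R) : derivable f (y, t) (0, 1) ->
  is_derive t 1 (fun u => f (y, u)) (partial2 f (y, t)).
Proof.
by rewrite /derivable quotient_section2 => df; split=> //;
  rewrite /partial2 /derive quotient_section2.
Qed.

Lemma is_derive_partial1 f (t y d : R) : is_derive t 1 (fun u => f (u, y)) d ->
  derivable f (t, y) (1, 0) /\ partial1 f (t, y) = d.
Proof.
by move=> [+ <-]; rewrite /derivable /partial1 /derive quotient_section1; split.
Qed.

Lemma is_derive_partial2 f (t y d : R) : is_derive t 1 (fun u => f (y, u)) d ->
  derivable f (y, t) (0, 1) /\ partial2 f (y, t) = d.
Proof.
by move=> [+ <-]; rewrite /derivable /partial2 /derive quotient_section2; split.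
Qed.

End partial_derivatives.

Section schwartz_functions.
Context {R : realType}.

Lemma decay2_ge0 (x : R * R) : 0 <= decay2 x.
Proof. by rewrite mulr_ge0// ltW// decay_gt0. Qed.

Definition smooth1 (f : R * R -> R) := forall k, Ck k setT f.

Lemma smooth1_continuous f : smooth1 f -> continuous f.
Proof. by move=> sf x; have [cf _] := sf 0%N; exact: cf. Qed.

Lemma smooth1_derivable f x : smooth1 f ->
  derivable f x (1, 0) /\ derivable f x (0, 1).
Proof. by move=> /(_ 1%N)[_ [df _ _]]; exact: df. Qed.

Lemma smooth1_partial1 f : smooth1 f -> smooth1 (partial1 f).
Proof. by move=> sf k; have [_ []] := sf k.+1. Qed.

Lemma smooth1_partial2 f : smooth1 f -> smooth1 (partial2 f).
Proof. by move=> sf k; have [_ []] := sf k.+1. Qed.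

Lemma smooth1_iter f j k : smooth1 f -> smooth1 (iter j partial1 (iter k partial2 f)).
Proof.
move=> sf; elim: j => [|j IH]; last exact: smooth1_partial1.
by elim: k => [//|k IH]; exact: smooth1_partial2.
Qed.

Variable phi : R * R -> R[i].
Hypothesis sphi : schwartz phi.

Local Notation D j k := (mixed_partial j k phi).

Let sRe : smooth1 (fun x => Re (phi x)).
Proof. by move=> k; have [/(_ k)[]] := sphi. Qed.

Let sIm : smooth1 (fun x => Im (phi x)).
Proof. by move=> k; have [/(_ k)[]] := sphi. Qed.

Lemma schwartz_mixed_partial_continuous j k : ccontinuous (D j k).
Proof. by split; apply: smooth1_continuous; exact: smooth1_iter. Qed.

Lemma schwartz_cderive1 j k x : cderive (fun t => D j k (t, x.2)) x.1 (D j.+1 k x).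
Proof.
case: x => t y; split => /=.
  by apply: derivable_partial1; have [] := smooth1_derivable (t, y) (smooth1_iter j k sRe).
by apply: derivable_partial1; have [] := smooth1_derivable (t, y) (smooth1_iter j k sIm).
Qed.

Lemma schwartz_cderive2 k x : cderive (fun t => D 0 k (x.1, t)) x.2 (D 0 k.+1 x).
Proof.
case: x => y t; split => /=.
  by apply: derivable_partial2; have [] := smooth1_derivable (y, t) (smooth1_iter 0 k sRe).
by apply: derivable_partial2; have [] := smooth1_derivable (y, t) (smooth1_iter 0 k sIm).
Qed.

(** The weights 1, x1^2, x2^2 and x1^2 x2^2 of four seminorms add up to (1 + x1^2) (1 + x2^2), the
    inverse of [decay2]. *)
Lemma schwartz_decay j k : exists M, forall x, cnorm (D j k x) <= M * decay2 x.
Proof.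
have [_ B] := sphi.
have [M0 H0] := B 0%N 0%N j k; have [M1 H1] := B 2%N 0%N j k.
have [M2 H2] := B 0%N 2%N j k; have [M3 H3] := B 2%N 2%N j k.
exists (M0 + M1 + M2 + M3) => x.
rewrite /decay2 /decay -invfM ler_pdivlMr; last first.
  by rewrite mulr_gt0 // ltr_wpDr// sqr_ge0.
move: (H0 x) (H1 x) (H2 x) (H3 x); rewrite !expr0 !real_normK ?num_real//.
by move: (cnorm _) => u; lra.
Qed.

Lemma schwartz_cintegrable : cintegrable leb2 phi.
Proof.
have [M HM] := schwartz_decay 0 0.
have E : D 0 0 = phi by apply/funext => x; apply: complex_ext.
rewrite -E; apply: (decay2_cintegrable (schwartz_mixed_partial_continuous 0 0) HM).
Qed.

Lemma fourier_expi (f : R * R -> R[i]) xi : fourier f xi =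
  cintegral leb2 (fun x => f x * expi (x.1 * (- xi.1, - xi.2).1 + x.2 * (- xi.1, - xi.2).2)).
Proof.
by apply: eq_cintegral => x; congr (_ * expi _); rewrite /= !mulrN opprD.
Qed.

Lemma cnorm_imaginary (b : R) : cnorm (0 +i* b)%C = `|b|.
Proof. by rewrite /= expr0n add0r sqrtr_sqr. Qed.

(** Each derivative yields a factor 2 pi i xi; taking moduli discards the powers of i. The second
    variable is treated first since [mixed_partial] applies [partial2] innermost. *)
Lemma fourier_mixed_partial j k xi :
  cnorm (fourier (D j k) xi) =
  `|2 * pi * xi.1| ^+ j * `|2 * pi * xi.2| ^+ k * cnorm (fourier phi xi).
Proof.
elim: j => [|j IH].
  elim: k => [|k IH].
    rewrite !expr0 !mul1r; congr (cnorm (fourier _ xi)).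
    by apply/funext => x; exact: complex_ext.
  have [M HM] := schwartz_decay 0 k; have [M' HM'] := schwartz_decay 0 k.+1.
  have M2 x : cnorm (D 0 k x) <= Num.max M M' * decay2 x.
    rewrite (le_trans (HM x))// ler_wpM2r ?decay2_ge0//.
    by rewrite le_max lexx.
  have M2' x : cnorm (D 0 k.+1 x) <= Num.max M M' * decay2 x.
    rewrite (le_trans (HM' x))// ler_wpM2r ?decay2_ge0//.
    by rewrite le_max lexx orbT.
  rewrite fourier_expi (cintegral_by_parts2 _ _ _ M2 M2' (schwartz_cderive2 k)); last 2 first.
  - exact: schwartz_mixed_partial_continuous.
  - exact: schwartz_mixed_partial_continuous.
  rewrite -fourier_expi Normc.normcM IH cnorm_imaginary /= mulrN opprK.
  by rewrite [in RHS]exprS; ring.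
have [M HM] := schwartz_decay j k; have [M' HM'] := schwartz_decay j.+1 k.
have M2 x : cnorm (D j k x) <= Num.max M M' * decay2 x.
  rewrite (le_trans (HM x))// ler_wpM2r ?decay2_ge0//.
  by rewrite le_max lexx.
have M2' x : cnorm (D j.+1 k x) <= Num.max M M' * decay2 x.
  rewrite (le_trans (HM' x))// ler_wpM2r ?decay2_ge0//.
  by rewrite le_max lexx orbT.
rewrite fourier_expi (cintegral_by_parts1 _ _ _ M2 M2' (schwartz_cderive1 j k)); last 2 first.
- exact: schwartz_mixed_partial_continuous.
- exact: schwartz_mixed_partial_continuous.
rewrite -fourier_expi Normc.normcM IH cnorm_imaginary /= mulrN opprK.
by rewrite [in RHS]exprS; ring.
Qed.

Lemma cnorm_fourier_le (f : R * R -> R[i]) : cintegrable leb2 f ->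
  exists C, forall xi, cnorm (fourier f xi) <= C.
Proof.
move=> fi; exists (2 * \int[leb2]_x cnorm (f x)) => xi.
rewrite fourier_expi; apply: le_cnorm_cintegral; last 2 first.
- exact: integrable_cnorm.
- by move=> x; rewrite Normc.normcM cnorm_expi mulr1.
apply: (cintegrableM_bounded fi (M := 1)).
  by apply: cmeasurable_expi; exact: measurable_dot.
by move=> x; rewrite cnorm_expi.
Qed.

(** The weight expands into four monomials. Each of them times the transform of [phi] is at most, in
    modulus, the transform of a mixed partial, the factors 2 pi being at least 1; and that transform
    is bounded because the partial is integrable. *)
Lemma schwartz_fourier_decay N : exists2 C, 0 <= C & forall xi,
  (1 + `|xi.1| ^+ N) * (1 + `|xi.2| ^+ N) * cnorm (fourier phi xi) <= C.
Proof.
have H j k : exists C, forall xi, `|xi.1| ^+ j * `|xi.2| ^+ k * cnorm (fourier phi xi) <= C.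
  have [M HM] := schwartz_decay j k.
  have [C HC] := cnorm_fourier_le (decay2_cintegrable (schwartz_mixed_partial_continuous j k) HM).
  exists C => xi; apply: le_trans (HC xi); rewrite fourier_mixed_partial.
  rewrite ler_wpM2r ?cnorm_ge0// ler_pM ?exprn_ge0//; apply: lerXn2r; rewrite ?nnegrE//;
    rewrite normrM ler_peMl// ger0_norm ?mulr_ge0 ?pi_ge0//.
    by have := @pi_ge2 R; lra.
  by have := @pi_ge2 R; lra.
have [C0 H0] := H 0%N 0%N; have [C1 H1] := H N 0%N.
have [C2 H2] := H 0%N N; have [C3 H3] := H N N.
have main xi : (1 + `|xi.1| ^+ N) * (1 + `|xi.2| ^+ N) * cnorm (fourier phi xi) <=
    C0 + C1 + C2 + C3.
  move: (H0 xi) (H1 xi) (H2 xi) (H3 xi); rewrite !expr0.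
  by move: (cnorm _) => u; lra.
exists (C0 + C1 + C2 + C3) => //; apply: le_trans (main 0).
by rewrite !mulr_ge0 ?cnorm_ge0// addr_ge0// exprn_ge0.
Qed.

End schwartz_functions.

(** * Membership of wave packets in the Schwartz class *)

Section packets_are_schwartz.
Context {R : realType}.

(* osc1 and osc2 are closed under differentiation and contain the real and
   imaginary parts of wave packets. *)
Inductive osc1 : (R -> R) -> Prop :=
| osc1_mono n w u : osc1 (fun t => t ^+ n * (cos (w * t + u) * gauss pi 0 t))
| osc1_add f g : osc1 f -> osc1 g -> osc1 (fun t => f t + g t)
| osc1_scale c f : osc1 f -> osc1 (fun t => c * f t).

Inductive osc2 : (R * R -> R) -> Prop :=
| osc2_tensor f g : osc1 f -> osc1 g -> osc2 (fun x => f x.1 * g x.2)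
| osc2_add f g : osc2 f -> osc2 g -> osc2 (fun x => f x + g x).

Lemma sin_cos_shift (a : R) : sin a = cos (a - pi / 2).
Proof. by rewrite cosB cos_pihalf sin_pihalf mulr0 add0r mulr1. Qed.

Lemma is_derive_expn n (t : R) : is_derive t 1 (fun t => t ^+ n) (n%:R * t ^+ n.-1).
Proof.
elim: n => [|n IH].
  by apply: (is_derive_eq (is_derive_const 1 t)); rewrite mul0r.
have -> : (fun t : R => t ^+ n.+1) = fun t => t * t ^+ n.
  by apply/funext => u; rewrite exprS.
apply: (is_derive_eq (is_derive_mul (is_derive_id t 1) IH)).
by case: n {IH} => [|n]; rewrite /= ?exprS -?natr1; ring.
Qed.

Lemma osc1_derive f : osc1 f -> exists2 g, osc1 g & forall t : R, is_derive t 1 f (g t).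
Proof.
elim=> [n w u|{}f g _ [f' of' ff'] _ [g' og' gg']|c {}f _ [f' of' ff']]; last 2 first.
- exists (fun t => f' t + g' t); first exact: osc1_add.
  by move=> t; exact: is_derive_add.
- exists (fun t => c * f' t); first exact: osc1_scale.
  by move=> t; exact: is_derive_scale.
(* The derivative of the cosine stays in the class because a sine is a cosine with shifted phase;
   hence the free phase [u] in [osc1_mono]. *)
pose g t := (n%:R * (t ^+ n.-1 * (cos (w * t + u) * gauss pi 0 t)) +
  (- w) * (t ^+ n * (cos (w * t + (u - pi / 2)) * gauss pi 0 t))) +
  (- (2 * pi)) * (t ^+ n.+1 * (cos (w * t + u) * gauss pi 0 t)).
exists g.
  by apply: osc1_add; [apply: osc1_add|]; apply: osc1_scale; exact: osc1_mono.
move=> t.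
apply: (is_derive_eq (is_derive_mul (is_derive_expn n t)
  (is_derive_mul (is_derive_cos_affine w u t) (is_derive_gauss pi 0 t)))).
by rewrite /g addrA -sin_cos_shift exprS subr0; ring.
Qed.

Lemma expn_gauss_bounded n : exists M : R, forall t, `|t| ^+ n * gauss pi 0 t <= M.
Proof.
(* The exponent is n + 1 because [gauss_absorb] wants it positive, also when n = 0. *)
have [K K0 KP] := @gauss_absorb R n.+1%:R (ltr0Sn R n).
exists K => t; apply: (@le_trans _ _ (K * gauss (pi / 2) 0 t)); last first.
  rewrite ler_piMr ?(ltW K0)// /gauss -[X in _ <= X]expR0 ler_expR oppr_le0.
  by rewrite mulr_ge0 ?sqr_ge0// divr_ge0 ?pi_ge0.
apply: le_trans (KP 0 t); rewrite ler_wpM2r ?gauss_ge0// subr0.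
set y := 1 + 4 * pi ^+ 2 * t ^+ 2.
have ty : `|t| <= y.
  rewrite /y; have p2 := @pi_ge2 R.
  rewrite -(real_normK (num_real t)); set v := `|t|.
  have v0 : 0 <= v by rewrite /v.
  have : 1 <= 4 * pi ^+ 2 :> R by nra.
  by move: (4 * pi ^+ 2) => z z1; have := sqr_ge0 (v - 1); nra.
have y1 : 1 <= y by rewrite /y lerDl mulr_ge0 ?sqr_ge0// mulr_ge0 ?sqr_ge0.
rewrite powR_mulrn; last exact: le_trans y1.
rewrite exprS (@le_trans _ _ (y ^+ n))//; first by apply: lerXn2r;
  rewrite ?nnegrE// (le_trans _ y1).
by rewrite ler_peMl// exprn_ge0// (le_trans _ y1).
Qed.

Lemma osc1_bounded f a : osc1 f -> exists M : R, forall t, `|t| ^+ a * `|f t| <= M.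
Proof.
elim=> [n w u|{}f g _ [M HM] _ [M' HM']|c {}f _ [M HM]].
- have [M HM] := expn_gauss_bounded (a + n).
  exists M => t; apply: le_trans (HM t).
  rewrite !normrM exprD normrX -mulrA ler_wpM2l ?exprn_ge0// ler_wpM2l ?exprn_ge0//.
  by rewrite [`|gauss _ _ _|]ger0_norm ?gauss_ge0// ler_piMl ?gauss_ge0// normr_cos_le1.
- exists (M + M') => t; rewrite (le_trans _ (lerD (HM t) (HM' t)))//.
  by rewrite -mulrDr ler_wpM2l ?exprn_ge0// ler_normD.
- exists (`|c| * M) => t; rewrite normrM mulrCA ler_wpM2l//.
Qed.

Lemma osc2_bounded F a b : osc2 F ->
  exists M : R, forall x, `|x.1| ^+ a * `|x.2| ^+ b * `|F x| <= M.
Proof.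
elim=> [f g of_ og|{}f g _ [M HM] _ [M' HM']].
  have [M HM] := osc1_bounded a of_; have [M' HM'] := osc1_bounded b og.
  exists (M * M') => x; rewrite normrM mulrACA ler_pM// ?mulr_ge0 ?exprn_ge0//.
exists (M + M') => x; rewrite (le_trans _ (lerD (HM x) (HM' x)))//.
by rewrite -mulrDr ler_wpM2l ?mulr_ge0 ?exprn_ge0// ler_normD.
Qed.

Lemma osc1_continuous f : osc1 f -> continuous f.
Proof. by move=> /osc1_derive[g _ fg] t; exact: is_derive_continuous (fg t). Qed.

Lemma osc2_continuous F : osc2 F -> continuous F.
Proof.
elim=> [f g of_ og|{}f g _ cf _ cg] x.
  by apply: cvgM; [exact: (continuous_fst (osc1_continuous of_))|
                   exact: (continuous_snd (osc1_continuous og))].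
by apply: cvgD; [exact: cf|exact: cg].
Qed.

Lemma osc2_partial1 F : osc2 F ->
  (forall x, derivable F x (1, 0)) /\ osc2 (partial1 F).
Proof.
move=> oF; suff [G oG FG] : exists2 G, osc2 G &
    forall t y : R, is_derive t 1 (fun u => F (u, y)) (G (t, y)).
  have PG t y := is_derive_partial1 (FG t y).
  have -> : partial1 F = G by apply/funext => -[t y]; have [] := PG t y.
  by split => // -[t y]; have [] := PG t y.
elim: oF => [f g /osc1_derive[f' of' ff'] og|{}F G _ [F' oF' FF'] _ [G' oG' GG']].
  exists (fun x => f' x.1 * g x.2); first exact: osc2_tensor.
  move=> t y; apply: (is_derive_eq (is_derive_mul (ff' t) (is_derive_const (g y) t))).
  by rewrite mulr0 addr0.
exists (fun x => F' x + G' x); first exact: osc2_add.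
by move=> t y; exact: is_derive_add.
Qed.

Lemma osc2_partial2 F : osc2 F ->
  (forall x, derivable F x (0, 1)) /\ osc2 (partial2 F).
Proof.
move=> oF; suff [G oG FG] : exists2 G, osc2 G &
    forall t y : R, is_derive t 1 (fun u => F (y, u)) (G (y, t)).
  have PG t y := is_derive_partial2 (FG t y).
  have -> : partial2 F = G by apply/funext => -[y t]; have [] := PG t y.
  by split => // -[y t]; have [] := PG t y.
elim: oF => [f g of_ /osc1_derive[g' og' gg']|{}F G _ [F' oF' FF'] _ [G' oG' GG']].
  exists (fun x => f x.1 * g' x.2); first exact: osc2_tensor.
  by move=> t y; apply: (is_derive_eq (is_derive_scale (f y) (gg' t))).
exists (fun x => F' x + G' x); first exact: osc2_add.
by move=> t y; exact: is_derive_add.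
Qed.

Lemma osc2_Ck k F : osc2 F -> Ck k setT F.
Proof.
elim: k F => [|k IH] F oF.
  by split => // x _; exact: osc2_continuous.
have [d1 o1] := osc2_partial1 oF; have [d2 o2] := osc2_partial2 oF.
split; first by move=> x _; exact: osc2_continuous.
by split; [move=> x _; split|exact: IH|exact: IH].
Qed.

Lemma osc2_iter F j k : osc2 F -> osc2 (iter j partial1 (iter k partial2 F)).
Proof.
move=> oF; elim: j => [|j IH]; last by have [] := osc2_partial1 IH.
by elim: k => [//|k IH]; have [] := osc2_partial2 IH.
Qed.

Lemma osc2_schwartz (f : R * R -> R[i]) :
  osc2 (fun x => Re (f x)) -> osc2 (fun x => Im (f x)) -> schwartz f.
Proof.
move=> oR oI; split; first by move=> k; split; exact: osc2_Ck.
move=> a b j k.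
have [M HM] := osc2_bounded a b (osc2_iter j k oR).
have [M' HM'] := osc2_bounded a b (osc2_iter j k oI).
exists (M + M') => x; rewrite (le_trans _ (lerD (HM x) (HM' x)))//.
by rewrite -mulrDr ler_wpM2l ?mulr_ge0 ?exprn_ge0// cnorm_le_ReIm.
Qed.

Lemma schwartz_packet (tau : R * R) : schwartz (packet tau).
Proof.
have o1 w u : osc1 (fun t => cos (w * t + u) * gauss pi 0 t).
  have := osc1_mono 0 w u.
  rewrite (_ : (fun t => t ^+ 0 * _) = (fun t => cos (w * t + u) * gauss pi 0 t))//.
  by apply/funext => t; rewrite mul1r.
(* The addition formula splits the oscillation into two tensor products; [u = 0] gives the real part
   of the packet and [u = - (pi / 2)] the imaginary part. *)
have aux u : osc2 (fun x => gauss2 pi 0 x * cos (2 * pi * tau.1 * x.1 +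
  (2 * pi * tau.2 * x.2 + u))).
  have := osc2_add (osc2_tensor (o1 (2 * pi * tau.1) 0) (o1 (2 * pi * tau.2) u))
    (osc2_tensor (osc1_scale (-1) (o1 (2 * pi * tau.1) (- (pi / 2)))) (o1 (2 * pi * tau.2)
      (u - pi / 2))).
  congr osc2; apply/funext => x.
  by rewrite /= [in RHS]cosD !addrA -!sin_cos_shift addr0 /gauss2; ring.
apply: osc2_schwartz.
  have := aux 0; congr osc2; apply/funext => x.
  by rewrite /packet cReZ /= addr0; congr (_ * cos _); ring.
have := aux (- (pi / 2)); congr osc2; apply/funext => x.
by rewrite /packet cImZ /= sin_cos_shift; congr (_ * cos _); ring.
Qed.

End packets_are_schwartz.

(** * Sobolev norms of wave packets *)

Section symbol_bounds.
Context {R : realType}.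

(** Its power s / 2 is [bessel s], and the same power on the axis (t, 0) is [bessel_x s]. It is kept
    apart from the power because differentiation changes the exponent. *)
Definition bessel_base (xi : R * R) : R := 1 + 4 * pi ^+ 2 * (xi.1 ^+ 2 + xi.2 ^+ 2).

Lemma bessel_base_ge1 xi : 1 <= bessel_base xi.
Proof. by rewrite lerDl mulr_ge0 ?addr_ge0 ?sqr_ge0// mulr_ge0 ?sqr_ge0. Qed.

Lemma bessel_base_gt0 xi : 0 < bessel_base xi.
Proof. exact: lt_le_trans (bessel_base_ge1 xi). Qed.

Lemma continuous_bessel_base b : continuous (fun xi => bessel_base xi `^ b).
Proof.
move=> x.
have c1 : {for x, continuous bessel_base}.
  apply: cvgD; first exact: cvg_cst.
  apply: cvgM; first exact: cvg_cst.
  have sq : continuous (fun t : R => t ^+ 2) by exact: exprn_continuous.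
  by apply: cvgD; [exact: (continuous_fst sq)|exact: (continuous_snd sq)].
exact: (continuous_comp c1 (is_derive_continuous (is_derive1_powR b (bessel_base_gt0 x)))).
Qed.

(** Peetre's inequality, from |xi|^2 <= 2 (|xi - c|^2 + |c|^2). The weight in xi - c is a product
    over coordinates, so that Gaussians in one variable can absorb it. *)
Lemma bessel_base_peetre (c xi : R * R) :
  bessel_base xi <= 2 * ((1 + 4 * pi ^+ 2 * (xi.1 - c.1) ^+ 2) *
    (1 + 4 * pi ^+ 2 * (xi.2 - c.2) ^+ 2)) * bessel_base c.
Proof.
rewrite /bessel_base; have k0 : 0 <= 4 * pi ^+ 2 :> R by rewrite mulr_ge0 ?sqr_ge0.
move: (4 * pi ^+ 2) k0 => k k0.
set u := (xi.1 - c.1) ^+ 2; set v := (xi.2 - c.2) ^+ 2.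
set d := c.1 ^+ 2 + c.2 ^+ 2.
have u0 : 0 <= u by exact: sqr_ge0.
have v0 : 0 <= v by exact: sqr_ge0.
have d0 : 0 <= d by rewrite addr_ge0 ?sqr_ge0.
have h : xi.1 ^+ 2 + xi.2 ^+ 2 <= 2 * (u + v + d).
  rewrite /u /v /d; have := sqr_ge0 (xi.1 - 2 * c.1); have := sqr_ge0 (xi.2 - 2 * c.2); nra.
apply: (@le_trans _ _ (1 + k * (2 * (u + v + d)))); first by rewrite lerD2l ler_wpM2l.
have := mulr_ge0 k0 u0; have := mulr_ge0 k0 v0; have := mulr_ge0 k0 d0.
have -> : 1 + k * (2 * (u + v + d)) = 1 + 2 * (k * u + k * v + k * d) by ring.
move: (k * u) (k * v) (k * d) => ku kv kd kd0 kv0 ku0.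
have h1 : 1 + ku + kv <= (1 + ku) * (1 + kv) by have := mulr_ge0 ku0 kv0; lra.
apply: (@le_trans _ _ (2 * (1 + ku + kv) * (1 + kd))); last first.
  by rewrite ler_wpM2r ?ler_wpM2l// addr_ge0.
by have := mulr_ge0 (addr_ge0 ku0 kv0) kd0; lra.
Qed.

(** For u = 2 pi |t - c| one has (1 + u)^2 <= 2 (1 + u^2), so the extra weight costs one more power
    in [gauss_absorb]. The square leaves room for two derivatives of the Gaussian in the same
    variable. *)
Lemma gauss_weight_absorb (a : R) : 0 < a -> exists2 K : R, 0 < K &
  forall c t, (1 + 4 * pi ^+ 2 * (t - c) ^+ 2) `^ a * (1 + 2 * pi * `|t - c|) ^+ 2 * gauss pi c t
    <= K * gauss (pi / 2) c t.
Proof.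
move=> a0; have [K K0 KP] := @gauss_absorb R (a + 1) (addr_gt0 a0 ltr01).
exists (2 * K); first by rewrite mulr_gt0.
move=> c t.
apply: (@le_trans _ _ (2 * ((1 + 4 * pi ^+ 2 * (t - c) ^+ 2) `^ (a + 1) * gauss pi c t)));
  last first.
  by rewrite -[leRHS]mulrA ler_wpM2l.
set y := 1 + _.
have y0 : 0 < y by rewrite ltr_wpDr// mulr_ge0 ?sqr_ge0// mulr_ge0 ?sqr_ge0.
rewrite powRD ?(gt_eqF y0)// ?implybT//.
rewrite powRr1 ?(ltW y0)//.
have -> : 2 * (y `^ a * y * gauss pi c t) = y `^ a * (2 * y) * gauss pi c t by ring.
rewrite ler_wpM2r ?gauss_ge0// ler_wpM2l ?powR_ge0//.
have -> : y = 1 + (2 * pi * `|t - c|) ^+ 2.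
  by rewrite /y !exprMn real_normK ?num_real//; ring.
by move: (2 * pi * _) => u; have := sqr_ge0 (u - 1); nra.
Qed.

(** Peetre's inequality replaces [xi] by [c] at the price of functions of xi - c, which the Gaussian
    absorbs uniformly in [c]: the only growth in the frequency is the expected power of
    [bessel_base c]. *)
Lemma bessel_gauss2_absorb (a : R) : 0 < a -> exists2 K : R, 0 < K &
  forall c xi, bessel_base xi `^ a * (1 + 2 * pi * `|xi.1 - c.1|) ^+ 2 *
    (1 + 2 * pi * `|xi.2 - c.2|) ^+ 2 * gauss2 pi c xi <=
    K * bessel_base c `^ a * gauss2 (pi / 2) c xi.
Proof.
move=> a0; have [K K0 KP] := gauss_weight_absorb a0.
exists (2 `^ a * (K * K)); first by rewrite mulr_gt0 ?powR_gt0// mulr_gt0.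
move=> c xi.
have yp u : 0 <= 1 + 4 * pi ^+ 2 * u ^+ 2 :> R by rewrite addr_ge0// mulr_ge0 ?sqr_ge0//
  mulr_ge0 ?sqr_ge0.
have H : bessel_base xi `^ a <= 2 `^ a * ((1 + 4 * pi ^+ 2 * (xi.1 - c.1) ^+ 2) `^ a *
    (1 + 4 * pi ^+ 2 * (xi.2 - c.2) ^+ 2) `^ a) * bessel_base c `^ a.
  rewrite -powRM// -powRM ?mulr_ge0// -powRM ?mulr_ge0 ?(ltW (bessel_base_gt0 _))//.
  apply: (ge0_ler_powR (ltW a0) _ _ (bessel_base_peetre c xi)); rewrite nnegrE.
    exact/ltW/bessel_base_gt0.
  by rewrite !mulr_ge0// ltW// bessel_base_gt0.
have W0 : 0 <= (1 + 2 * pi * `|xi.1 - c.1|) ^+ 2 * (1 + 2 * pi * `|xi.2 - c.2|) ^+ 2 * gauss2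
  pi c xi.
  by apply: mulr_ge0; [apply: mulr_ge0; exact: sqr_ge0|exact: gauss2_ge0].
rewrite -2!mulrA [X in _ * X]mulrA; apply: (le_trans (ler_wpM2r W0 H)).
have G1 := KP c.1 xi.1; have G2 := KP c.2 xi.2.
have pos u v : 0 <= (1 + 4 * pi ^+ 2 * (v - u) ^+ 2) `^ a *
    (1 + 2 * pi * `|v - u|) ^+ 2 * gauss pi u v :> R.
  by apply: mulr_ge0; [apply: mulr_ge0; [exact: powR_ge0|exact: sqr_ge0]|exact: gauss_ge0].
have := ler_pM (pos _ _) (pos _ _) G1 G2.
have e0 : 0 <= 2 `^ a * bessel_base c `^ a by rewrite mulr_ge0 ?powR_ge0.
move=> /(ler_wpM2l e0).
by rewrite /gauss2; congr (_ <= _); ring.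
Qed.

End symbol_bounds.

(** * From weighted pointwise bounds to Lebesgue norms *)

Section Lp_bounds.
Context {R : realType}.
Local Notation integ mu g := (mu.-integrable setT (EFin \o g)).

(** The p-th power of the inverse weight is integrable because p > 1; [V] is the p-th root of its
    integral. *)
Lemma Lp_norm_le (p : R) : 1 < p -> exists2 V : R, 0 <= V &
  forall (h : measurableTypeR R * measurableTypeR R -> R[i]) (M : R), cmeasurable h ->
    (forall x, (1 + `|x.1|) * (1 + `|x.2|) * cnorm (h x) <= M) ->
    (Lp_norm p h <= (M * V)%:E)%E.
Proof.
move=> p1; have p0 : 0 < p by exact: lt_trans p1.
have iv := integrable_powR_decay p1.
pose v (x : R * R) : R := (1 + `|x.1|) `^ (- p) * (1 + `|x.2|) `^ (- p).
have ivv : integ leb2 v by exact: (integrable_tensor2 iv iv).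
have v0 x : 0 <= v x by rewrite mulr_ge0 ?powR_ge0.
pose I := \int[leb2]_x v x.
have I0 : 0 <= I by apply: Rintegral_ge0 => x _.
have EI : (\int[leb2]_x (v x)%:E = I%:E)%E.
  by rewrite /I /Rintegral fineK//; apply: integrable_fin_num.
exists (I `^ p^-1); first exact: powR_ge0.
move=> h M mh hM.
have M0 : 0 <= M by apply: le_trans (hM 0); rewrite !mulr_ge0 ?cnorm_ge0 ?addr_ge0.
rewrite /Lp_norm unlock /=.
have -> : M * I `^ p^-1 = (M `^ p * I) `^ p^-1.
  by rewrite powRM ?powR_ge0// -powRrM divff ?gt_eqF// powRr1.
rewrite -poweR_EFin; apply: gt0_ler_poweR.
- by rewrite invr_ge0 ltW.
- by rewrite in_itv/= leey andbT; apply: integral_ge0 => x _; rewrite lee_fin; exact: powR_ge0.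
- by rewrite in_itv/= leey andbT lee_fin mulr_ge0 ?powR_ge0.
rewrite EFinM -EI -ge0_integralZl//; last 3 first.
- exact: measurable_int ivv.
- by move=> x _; rewrite lee_fin.
- by rewrite lee_fin powR_ge0.
apply: ge0_le_integral => //.
- apply/measurable_EFinP; apply: (measurableT_comp (measurable_powR p)).
  by apply: measurableT_comp => //; exact: measurable_cnorm.
- by apply/measurable_EFinP/measurable_funM => //; apply/measurable_EFinP;
  exact: measurable_int ivv.
move=> x _; rewrite lee_fin ger0_norm ?cnorm_ge0// /v.
have a1 : 0 < 1 + `|x.1| by rewrite ltr_wpDr.
have a2 : 0 < 1 + `|x.2| by rewrite ltr_wpDr.
rewrite !powRN -invfM ler_pdivlMr ?mulr_gt0 ?powR_gt0//.
have na : (1 + `|x.1|) * (1 + `|x.2|) * cnorm (h x) \in Num.nneg.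
  by rewrite nnegrE !mulr_ge0 ?cnorm_ge0 ?(ltW a1) ?(ltW a2).
have nM : M \in Num.nneg by rewrite nnegrE.
have := ge0_ler_powR (ltW p0) na nM (hM x).
rewrite powRM ?cnorm_ge0 ?mulr_ge0 ?(ltW a1) ?(ltW a2)//.
by rewrite powRM ?(ltW a1) ?(ltW a2)// mulrC.
Qed.

End Lp_bounds.

(** * Transposition of Fourier kernels and measurability of transforms *)

Section fourier_exchange.
Context {R : realType}.

(** The multiplication formula for Fourier transforms; c = 1 and c = -1 give both signs of the
    exponent. *)
Lemma cintegral_exchange_expi (c : R) (f g : R * R -> R[i]) :
  cintegrable leb2 f -> cintegrable leb2 g ->
  cintegrable leb2 (fun x => f x * cintegral leb2 (fun xi =>
    g xi * expi (c * (x.1 * xi.1 + x.2 * xi.2)))) /\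
  cintegral leb2 (fun x => f x * cintegral leb2 (fun xi =>
    g xi * expi (c * (x.1 * xi.1 + x.2 * xi.2)))) =
  cintegral leb2 (fun xi => g xi * cintegral leb2 (fun x =>
    f x * expi (c * (x.1 * xi.1 + x.2 * xi.2)))).
Proof.
move=> fi gi.
pose k (z : (measurableTypeR R * measurableTypeR R) *
  (measurableTypeR R * measurableTypeR R)) : R[i] :=
  expi (c * (z.1.1 * z.2.1 + z.1.2 * z.2.2)).
have mk : cmeasurable k.
  apply: cmeasurable_expi; apply: measurable_funM => //.
  by apply: measurable_funD; apply: measurable_funM; apply: measurableT_comp.
have k1 z : cnorm (k z) <= 1 by rewrite cnorm_expi.
exact: (cintegral_exchange fi gi mk k1).
Qed.

(* Multiplied by a Gaussian, the transform is a marginal of an integrable function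
   on the product, hence measurable; then divide by the Gaussian. *)
Lemma cmeasurable_transform (c : R) (g : R * R -> R[i]) : cintegrable leb2 g ->
  cmeasurable (fun x : measurableTypeR R * measurableTypeR R =>
    cintegral leb2 (fun xi => g xi * expi (c * (x.1 * xi.1 + x.2 * xi.2)))).
Proof.
move=> gi.
have ig2 : cintegrable leb2 (fun x => (gauss2 pi 0 x)%:C%C : R[i]).
  by apply: cintegrable_real; have [] := integral_gauss2 0 (pi_gt0 R).
have [+ _] := cintegral_exchange_expi c ig2 gi.
move=> /cintegrable_measurable mH.
have g0 x : gauss2 pi 0 x != 0 :> R by rewrite gt_eqF// mulr_gt0 ?gauss_gt0.
have mi : cmeasurable (fun x : measurableTypeR R * measurableTypeR R =>
  ((gauss2 pi 0 x)^-1)%:C%C : R[i]).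
  apply: cmeasurable_real; apply: continuous_measurable_plane => x.
  by apply: cvgV; [exact: g0|exact: continuous_gauss2].
have := cmeasurableM mi mH; congr cmeasurable; apply/funext => x /=.
by rewrite mulrA -rmorphM mulVf// mul1r.
Qed.

End fourier_exchange.

(** * Derivatives of the Bessel symbol times a Gaussian *)

Section symbol_derivatives.
Context {R : realType}.
Variables (a : R) (c : R * R).
Implicit Types (x : R * R).

(** The derivative of [bessel_base] in one coordinate, grouped so that 2 pi t can be compared with
    [bessel_base] itself. *)
Definition slope (t : R) : R := 4 * pi * (2 * pi * t).

(** The symbol of (I - Delta)^a times the Fourier transform of the packet of frequency [c]. *)
Definition symbol x : R := bessel_base x `^ a * gauss2 pi c x.

Definition symbol1 x : R :=
  (a * (bessel_base x `^ (a - 1) * slope x.1) -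
   bessel_base x `^ a * (2 * pi * (x.1 - c.1))) * gauss2 pi c x.

Definition symbol2 x : R :=
  (a * (bessel_base x `^ (a - 1) * slope x.2) -
   bessel_base x `^ a * (2 * pi * (x.2 - c.2))) * gauss2 pi c x.

Definition symbol12 x : R :=
  (a * (a - 1) * (bessel_base x `^ (a - 1 - 1) * slope x.2 * slope x.1) -
   a * (bessel_base x `^ (a - 1) * slope x.2) * (2 * pi * (x.1 - c.1)) -
   a * (bessel_base x `^ (a - 1) * slope x.1) * (2 * pi * (x.2 - c.2)) +
   bessel_base x `^ a * (2 * pi * (x.1 - c.1)) * (2 * pi * (x.2 - c.2))) *
  gauss2 pi c x.

Lemma is_derive_bessel_base1 (b t y : R) :
  is_derive t 1 (fun u => bessel_base (u, y) `^ b)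
    (b * (bessel_base (t, y) `^ (b - 1) * slope t)).
Proof.
have D : is_derive t 1 (fun u => bessel_base (u, y)) (4 * pi ^+ 2 * (2 * t)).
  apply: (is_derive_eq (is_derive_add (is_derive_const 1 t) (is_derive_scale (4 * pi ^+ 2)
    (is_derive_add (is_derive_sqr (is_derive_id t 1)) (is_derive_const (y ^+ 2) t))))).
  by rewrite /=; ring.
apply: (is_derive_eq (@is_derive_compose _ (fun z => z `^ b) (fun u => bessel_base (u,
  y)) t _ _ (is_derive1_powR b (bessel_base_gt0 (t, y))) D)).
by rewrite /slope /=; ring.
Qed.

Lemma is_derive_bessel_base2 (b t y : R) :
  is_derive t 1 (fun u => bessel_base (y, u) `^ b)
    (b * (bessel_base (y, t) `^ (b - 1) * slope t)).
Proof.
have D : is_derive t 1 (fun u => bessel_base (y, u)) (4 * pi ^+ 2 * (2 * t)).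
  apply: (is_derive_eq (is_derive_add (is_derive_const 1 t) (is_derive_scale (4 * pi ^+ 2)
    (is_derive_add (is_derive_const (y ^+ 2) t) (is_derive_sqr (is_derive_id t 1)))))).
  by rewrite /=; ring.
apply: (is_derive_eq (@is_derive_compose _ (fun z => z `^ b) (fun u => bessel_base (y,
  u)) t _ _ (is_derive1_powR b (bessel_base_gt0 (y, t))) D)).
by rewrite /slope /=; ring.
Qed.

Lemma is_derive_gauss2_1 (t y : R) :
  is_derive t 1 (fun u => gauss2 pi c (u, y)) (- (2 * pi * (t - c.1)) * gauss2 pi c (t, y)).
Proof.
apply: (is_derive_eq (is_derive_mul (is_derive_gauss pi c.1 t)
  (is_derive_const (gauss pi c.2 y) t))).
by rewrite /gauss2 /=; ring.
Qed.

Lemma is_derive_gauss2_2 (t y : R) :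
  is_derive t 1 (fun u => gauss2 pi c (y, u)) (- (2 * pi * (t - c.2)) * gauss2 pi c (y, t)).
Proof.
apply: (is_derive_eq (is_derive_mul (is_derive_const (gauss pi c.1 y) t)
  (is_derive_gauss pi c.2 t))).
by rewrite /gauss2 /=; ring.
Qed.

Lemma is_derive_symbol1 (t y : R) : is_derive t 1 (fun u => symbol (u, y)) (symbol1 (t, y)).
Proof.
apply: (is_derive_eq (is_derive_mul (is_derive_bessel_base1 a t y) (is_derive_gauss2_1 t y))).
by rewrite /symbol1 /=; ring.
Qed.

Lemma is_derive_symbol2 (t y : R) : is_derive t 1 (fun u => symbol (y, u)) (symbol2 (y, t)).
Proof.
apply: (is_derive_eq (is_derive_mul (is_derive_bessel_base2 a t y) (is_derive_gauss2_2 t y))).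
by rewrite /symbol2 /=; ring.
Qed.

Lemma is_derive_symbol12 (t y : R) : is_derive t 1 (fun u => symbol1 (y, u)) (symbol12 (y, t)).
Proof.
have D1 := is_derive_scale a (is_derive_mul (is_derive_bessel_base2 (a - 1) t y)
  (is_derive_const (slope y) t)).
have D2 := is_derive_mul (is_derive_bessel_base2 a t y) (is_derive_const (2 * pi * (y - c.1)) t).
apply: (is_derive_eq (is_derive_mul (is_derive_add D1 (is_derive_opp D2))
  (is_derive_gauss2_2 t y))).
by rewrite /symbol12 /=; ring.
Qed.

Lemma continuous_slope1 : continuous (fun x => slope x.1).
Proof.
apply: continuous_fst => t; apply: cvgM; first exact: cvg_cst.
by apply: cvgM; [exact: cvg_cst|exact: cvg_id].
Qed.

Lemma continuous_slope2 : continuous (fun x => slope x.2).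
Proof.
apply: continuous_snd => t; apply: cvgM; first exact: cvg_cst.
by apply: cvgM; [exact: cvg_cst|exact: cvg_id].
Qed.

Lemma continuous_shift1 : continuous (fun x => 2 * pi * (x.1 - c.1) : R).
Proof.
apply: (@continuous_fst _ (fun t => 2 * pi * (t - c.1))) => t.
by apply: cvgM; [exact: cvg_cst|apply: cvgB; [exact: cvg_id|exact: cvg_cst]].
Qed.

Lemma continuous_shift2 : continuous (fun x => 2 * pi * (x.2 - c.2) : R).
Proof.
apply: (@continuous_snd _ (fun t => 2 * pi * (t - c.2))) => t.
by apply: cvgM; [exact: cvg_cst|apply: cvgB; [exact: cvg_id|exact: cvg_cst]].
Qed.

Lemma continuous_symbol : continuous symbol.
Proof.
by move=> x; apply: cvgM; [exact: continuous_bessel_base|exact: continuous_gauss2].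
Qed.

Lemma continuous_mul (f g : R * R -> R) : continuous f -> continuous g ->
  continuous (fun x => f x * g x).
Proof. by move=> cf cg x; exact: cvgM (cf x) (cg x). Qed.

Lemma continuous_add (f g : R * R -> R) : continuous f -> continuous g ->
  continuous (fun x => f x + g x).
Proof. by move=> cf cg x; exact: cvgD (cf x) (cg x). Qed.

Lemma continuous_sub (f g : R * R -> R) : continuous f -> continuous g ->
  continuous (fun x => f x - g x).
Proof. by move=> cf cg x; exact: cvgB (cf x) (cg x). Qed.

Lemma continuous_const (k : R) : continuous (fun _ : R * R => k).
Proof. by move=> x; exact: cvg_cst. Qed.

Lemma continuous_symbol1 : continuous symbol1.
Proof.
exact: (continuous_mul (continuous_sub
  (continuous_mul (@continuous_const a) (continuous_mul (@continuous_bessel_base R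
    (a - 1)) continuous_slope1))
  (continuous_mul (@continuous_bessel_base R a) continuous_shift1)) (@continuous_gauss2 R pi c)).
Qed.

Lemma continuous_symbol2 : continuous symbol2.
Proof.
exact: (continuous_mul (continuous_sub
  (continuous_mul (@continuous_const a) (continuous_mul (@continuous_bessel_base R
    (a - 1)) continuous_slope2))
  (continuous_mul (@continuous_bessel_base R a) continuous_shift2)) (@continuous_gauss2 R pi c)).
Qed.

Lemma continuous_symbol12 : continuous symbol12.
Proof.
have cs1 := continuous_slope1; have cs2 := continuous_slope2.
have ch1 := continuous_shift1; have ch2 := continuous_shift2.
have ca k := @continuous_const k; have cb := @continuous_bessel_base R.
exact: (continuous_mul (continuous_add (continuous_sub (continuous_sub
  (continuous_mul (ca (a * (a - 1))) (continuous_mul (continuous_mul (cb (a - 1 - 1)) cs2) cs1))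
  (continuous_mul (continuous_mul (ca a) (continuous_mul (cb (a - 1)) cs2)) ch1))
  (continuous_mul (continuous_mul (ca a) (continuous_mul (cb (a - 1)) cs1)) ch2))
  (continuous_mul (continuous_mul (cb a) ch1) ch2)) (@continuous_gauss2 R pi c)).
Qed.

End symbol_derivatives.

(** * Bounds for these derivatives, uniform up to the size of the symbol at the centre *)

Section symbol_estimates.
Context {R : realType}.
Implicit Types (x c : R * R).

(** Since u <= 1 + u^2 for u = 2 pi |x_i|. A factor [slope] thus costs at most one power of
    [bessel_base], the very power lost when [bessel_base] to an exponent is differentiated. *)
Lemma slope_le (x : R * R) : `|slope x.1| <= 4 * pi * bessel_base x /\
  `|slope x.2| <= 4 * pi * bessel_base x.
Proof.
have p0 : 0 <= 4 * pi :> R by rewrite mulr_ge0 ?pi_ge0.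
have E : bessel_base x = 1 + (`|2 * pi * x.1| ^+ 2 + `|2 * pi * x.2| ^+ 2).
  by rewrite !real_normK ?num_real// /bessel_base; ring.
have H (u v : R) : u <= 1 + (u ^+ 2 + v ^+ 2).
  by have := sqr_ge0 (u - 1); have := sqr_ge0 u; have := sqr_ge0 v; nra.
split; rewrite /slope normrM [`|4 * pi|]ger0_norm// ler_wpM2l// E.
  exact: H.
by rewrite [_ ^+ 2 + _]addrC; exact: H.
Qed.

Lemma bessel_base_powS x (b : R) : bessel_base x * bessel_base x `^ (b - 1) = bessel_base x `^ b.
Proof.
rewrite -[X in X * _]powRr1; last exact/ltW/bessel_base_gt0.
rewrite -powRD; first by congr powR; ring.
by rewrite (gt_eqF (bessel_base_gt0 x)) implybT.
Qed.

(** The weight (1 + u) (1 + v) is at least 1, hence at most its square, the form in which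
    [bessel_gauss2_absorb] takes it. *)
Lemma symbol_weight_le (a : R) (c x : R * R) (w C : R) :
  `|w| <= C * bessel_base x `^ a * ((1 + 2 * pi * `|x.1 - c.1|) * (1 + 2 * pi * `|x.2 - c.2|)) ->
  0 <= C ->
  `|w * gauss2 pi c x| <= C * (bessel_base x `^ a * (1 + 2 * pi * `|x.1 - c.1|) ^+ 2 *
    (1 + 2 * pi * `|x.2 - c.2|) ^+ 2 * gauss2 pi c x).
Proof.
move=> wC C0; rewrite normrM [`|gauss2 _ _ _|]ger0_norm ?gauss2_ge0//.
rewrite mulrA ler_wpM2r ?gauss2_ge0//; apply: (le_trans wC).
have L0 (u : R) : 0 <= 2 * pi * `|u| by rewrite !mulr_ge0 ?pi_ge0.
move: (L0 (x.1 - c.1)) (L0 (x.2 - c.2)).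
move: (2 * pi * _) (2 * pi * _) => u v u0 v0.
rewrite [leRHS](_ : _ = C * bessel_base x `^ a * ((1 + v) * (1 + u)) ^+ 2); last by ring.
apply: ler_wpM2l; first by rewrite mulr_ge0 ?powR_ge0.
have : 1 <= (1 + v) * (1 + u) by have := mulr_ge0 u0 v0; lra.
by move: ((1 + v) * (1 + u)) => w1 w11; rewrite expr2 ler_peMl// (le_trans _ w11).
Qed.

(** A derivative falls either on the power, where [slope] makes up for the lost exponent, or on the
    Gaussian, where it brings a factor x - c that the wider Gaussian absorbs. All four functions
    therefore share one bound. *)
Lemma symbol_bounds (a : R) : 0 < a -> exists2 K : R, 0 < K & forall c x,
  let B := K * bessel_base c `^ a * gauss2 (pi / 2) c x in
  [/\ `|symbol a c x| <= B, `|symbol1 a c x| <= B, `|symbol2 a c x| <= B &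
      `|symbol12 a c x| <= B].
Proof.
move=> a0; have [K K0 KP] := @bessel_gauss2_absorb R a a0.
pose k := 4 * pi : R.
have k0 : 0 <= k by rewrite mulr_ge0 ?pi_ge0.
(* 1 accounts for the terms with the power undifferentiated, a k for one derivative on it, a |a - 1|
   k^2 for two. *)
pose C := 1 + a * k + a * `|a - 1| * k ^+ 2.
have ak0 : 0 <= a * k by rewrite mulr_ge0// ltW.
have aak0 : 0 <= a * `|a - 1| * k ^+ 2 by rewrite mulr_ge0 ?sqr_ge0// mulr_ge0// ltW.
have C0 : 0 < C by rewrite /C -addrA ltr_wpDr// addr_ge0.
exists (C * K); first by rewrite mulr_gt0.
move=> c x B.
have [s1 s2] := slope_le x; rewrite -/k in s1 s2.
have suf (w : R) : `|w| <= C * bessel_base x `^ a *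
    ((1 + 2 * pi * `|x.1 - c.1|) * (1 + 2 * pi * `|x.2 - c.2|)) ->
    `|w * gauss2 pi c x| <= B.
  move=> /symbol_weight_le - /(_ (ltW C0)) /le_trans; apply.
  by rewrite /B -!mulrA ler_wpM2l ?(ltW C0)// !mulrA; have := KP c x; rewrite !mulrA.
set P := bessel_base x `^ a in suf *.
have P0 : 0 <= P by exact: powR_ge0.
pose Q := bessel_base x `^ (a - 1).
have Q0 : 0 <= Q by exact: powR_ge0.
pose S := bessel_base x `^ (a - 1 - 1).
have S0 : 0 <= S by exact: powR_ge0.
have QP : bessel_base x * Q = P by exact: bessel_base_powS.
have SQ : bessel_base x * S = Q by exact: bessel_base_powS.
have b0 := ltW (bessel_base_gt0 x).
have q1 : `|Q * slope x.1| <= k * P.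
  by rewrite normrM ger0_norm// -QP [leLHS]mulrC [leRHS]mulrA ler_wpM2r.
have q2 : `|Q * slope x.2| <= k * P.
  by rewrite normrM ger0_norm// -QP [leLHS]mulrC [leRHS]mulrA ler_wpM2r.
have q12 : `|S * slope x.2 * slope x.1| <= k ^+ 2 * P.
  rewrite normrM [`|S * _|]normrM [`|S|]ger0_norm// -QP -SQ.
  have -> : k ^+ 2 * (bessel_base x * (bessel_base x * S)) =
    S * (k * bessel_base x) * (k * bessel_base x) by ring.
  by apply: ler_pM => //; [rewrite mulr_ge0|rewrite ler_wpM2l].
pose d1 := 2 * pi * (x.1 - c.1); pose d2 := 2 * pi * (x.2 - c.2).
have dn1 : 2 * pi * `|x.1 - c.1| = `|d1| by rewrite normrM [`|2 * pi|]ger0_norm// mulr_ge0 ?pi_ge0.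
have dn2 : 2 * pi * `|x.2 - c.2| = `|d2| by rewrite normrM [`|2 * pi|]ger0_norm// mulr_ge0 ?pi_ge0.
rewrite dn1 dn2 in suf.
have u0 : 0 <= `|d1| by []. have v0 : 0 <= `|d2| by [].
have uv0 : 0 <= `|d1| * `|d2| by rewrite mulr_ge0.
have T : (1 + `|d1|) * (1 + `|d2|) = 1 + `|d1| + `|d2| + `|d1| * `|d2| by ring.
rewrite T in suf.
have ak : C * P * (1 + `|d1| + `|d2| + `|d1| * `|d2|) =
  P * (1 + `|d1| + `|d2| + `|d1| * `|d2|) +
  (a * k * P) * (1 + `|d1| + `|d2| + `|d1| * `|d2|) +
  (a * `|a - 1| * k ^+ 2 * P) * (1 + `|d1| + `|d2| + `|d1| * `|d2|) by rewrite /C; ring.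
rewrite ak in suf.
have akP : 0 <= a * k * P by rewrite mulr_ge0.
have aakP : 0 <= a * `|a - 1| * k ^+ 2 * P by rewrite mulr_ge0.
have pd1 : 0 <= P * `|d1| by rewrite mulr_ge0.
have pd2 : 0 <= P * `|d2| by rewrite mulr_ge0.
have pd12 : 0 <= P * (`|d1| * `|d2|) by rewrite mulr_ge0.
have ad1 : 0 <= (a * k * P) * `|d1| by rewrite mulr_ge0.
have ad2 : 0 <= (a * k * P) * `|d2| by rewrite mulr_ge0.
have ad12 : 0 <= (a * k * P) * (`|d1| * `|d2|) by rewrite mulr_ge0.
have aad1 : 0 <= (a * `|a - 1| * k ^+ 2 * P) * `|d1| by rewrite mulr_ge0.
have aad2 : 0 <= (a * `|a - 1| * k ^+ 2 * P) * `|d2| by rewrite mulr_ge0.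
have aad12 : 0 <= (a * `|a - 1| * k ^+ 2 * P) * (`|d1| * `|d2|) by rewrite mulr_ge0.
have na (u v : R) : `|u| <= v -> `|a * u| <= a * v.
  by move=> uv; rewrite normrM [`|a|]gtr0_norm// ler_wpM2l// ltW.
split; apply: suf; rewrite -/P -/Q -/S -/d1 -/d2; clearbody k d1 d2 P Q S.
- by rewrite ger0_norm//; lra.
- have e1 : `|a * (Q * slope x.1)| <= a * k * P by rewrite -mulrA na.
  have e2 : `|P * d1| = P * `|d1| by rewrite normrM ger0_norm.
  by apply: (le_trans (ler_normB _ _)); lra.
- have e1 : `|a * (Q * slope x.2)| <= a * k * P by rewrite -mulrA na.
  have e2 : `|P * d2| = P * `|d2| by rewrite normrM ger0_norm.
  by apply: (le_trans (ler_normB _ _)); lra.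
have f1 : `|a * (a - 1) * (S * slope x.2 * slope x.1)| <= a * `|a - 1| * k ^+ 2 * P.
  rewrite normrM normrM [`|a|]gtr0_norm// -[leRHS]mulrA ler_wpM2l//.
  by rewrite mulr_ge0// ltW.
have f2 : `|a * (Q * slope x.2) * d1| <= a * k * P * `|d1|.
  by rewrite normrM ler_wpM2r// -mulrA na.
have f3 : `|a * (Q * slope x.1) * d2| <= a * k * P * `|d2|.
  by rewrite normrM ler_wpM2r// -mulrA na.
have f4 : `|P * d1 * d2| = P * (`|d1| * `|d2|) by rewrite normrM [`|P * d1|]normrM
  [`|P|]ger0_norm// mulrA.
apply: (le_trans (ler_normD _ _)); rewrite f4.
apply: (le_trans (lerD (ler_normB _ _) (lexx _))).
apply: (le_trans (lerD (lerD (ler_normB _ _) (lexx _)) (lexx _))).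
by lra.
Qed.

End symbol_estimates.

(** * Upper bound for the Sobolev norm of a packet *)

Section sobolev_upper_bound.
Context {R : realType}.
Implicit Types (c x xi tau : R * R).

Lemma gauss2_le_decay2 (b : R) c : 0 < b -> exists2 K : R, 0 < K &
  forall x, gauss2 b c x <= K * decay2 x.
Proof.
move=> b0; have [K K0 KP] := @gauss_le_decay R b c.1 b0.
have [K' K'0 K'P] := @gauss_le_decay R b c.2 b0.
exists (K * K') => [|x]; first by rewrite mulr_gt0.
by rewrite /decay2 mulrACA ler_pM ?gauss_ge0.
Qed.

Lemma cnorm_cintegral_gauss2_le (k : R * R -> R) (M : R) c x : continuous k -> 0 <= M ->
  (forall xi, `|k xi| <= M * gauss2 (pi / 2) c xi) ->
  cintegrable leb2 (fun xi => (k xi)%:C%C) /\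
  cnorm (cintegral leb2 (fun xi => (k xi)%:C%C * expi (xi.1 * x.1 + xi.2 * x.2))) <= 4 * M.
Proof.
move=> ck M0 kM; have p2 : 0 < pi / 2 :> R by rewrite divr_gt0 ?pi_gt0.
have [ig eg] := integral_gauss2 c p2.
have ik : cintegrable leb2 (fun xi => (k xi)%:C%C).
  apply: (le_cintegrable _ (integrableZ_real M ig)).
    by apply: ccontinuous_measurable2; exact: ccontinuous_real.
  by move=> xi; rewrite cnorm_real.
split=> //.
(* One factor 2 is the loss in [le_cnorm_cintegral], the other is the integral of
   [gauss2 (pi / 2) c]. *)
have -> : 4 * M = 2 * \int[leb2]_xi (M * gauss2 (pi / 2) c xi).
  have pp : pi / (pi / 2) = 2 :> R by rewrite invf_div mulrCA divff ?mulr1// gt_eqF ?pi_gt0.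
  by rewrite RintegralZl// eg pp; ring.
apply: (le_cnorm_cintegral _ (integrableZ_real M ig)).
  apply: (cintegrableM_bounded ik (M := 1)).
    by apply: cmeasurable_expi; exact: measurable_dot.
  by move=> xi; rewrite cnorm_expi.
by move=> xi; rewrite Normc.normcM cnorm_expi mulr1 cnorm_real.
Qed.

(* Up to the reflections c = - tau and x -> - x, this is (I - Delta)^a applied
   with a = s / 2 to the packet of frequency tau. *)
Definition symbol_transform (a : R) c x : R[i] :=
  cintegral leb2 (fun xi => (symbol a c xi)%:C%C * expi (xi.1 * x.1 + xi.2 * x.2)).

(** Integrals of [symbol], [symbol1], [symbol2] and [symbol12] against the exponential bound the
    transform times 1, x1, x2 and x1 x2, by parts; four bounds 4 M give the 16. One derivative per
    variable is enough, as [Lp_norm_le] asks only for this weight. *)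
Lemma symbol_transform_decay (a : R) : 0 < a -> exists2 K : R, 0 < K & forall c x,
  (1 + `|x.1|) * (1 + `|x.2|) * cnorm (symbol_transform a c x) <= K * bessel_base c `^ a.
Proof.
move=> a0; have [K K0 KP] := symbol_bounds a0.
exists (16 * K); first by rewrite mulr_gt0.
move=> c x.
pose M := K * bessel_base c `^ a.
have M0 : 0 <= M by rewrite mulr_ge0 ?powR_ge0// ltW.
have p2 : 0 < pi / 2 :> R by rewrite divr_gt0 ?pi_gt0.
have [D D0 DP] := gauss2_le_decay2 c p2.
have toD (k : R * R -> R) : (forall xi, `|k xi| <= M * gauss2 (pi / 2) c xi) ->
    forall xi, cnorm (k xi)%:C%C <= (M * D) * decay2 xi.
  move=> kM xi; rewrite cnorm_real (le_trans (kM xi))// -mulrA ler_wpM2l//.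
have B0 xi : `|symbol a c xi| <= M * gauss2 (pi / 2) c xi by case: (KP c xi).
have B1 xi : `|symbol1 a c xi| <= M * gauss2 (pi / 2) c xi by case: (KP c xi).
have B2 xi : `|symbol2 a c xi| <= M * gauss2 (pi / 2) c xi by case: (KP c xi).
have B12 xi : `|symbol12 a c xi| <= M * gauss2 (pi / 2) c xi by case: (KP c xi).
have C0 : continuous (symbol a c) by exact: continuous_symbol.
have C1 : continuous (symbol1 a c) by exact: continuous_symbol1.
have C2 : continuous (symbol2 a c) by exact: continuous_symbol2.
have C12 : continuous (symbol12 a c) by exact: continuous_symbol12.
have [_ n0] := cnorm_cintegral_gauss2_le x C0 M0 B0.
have [_ n1] := cnorm_cintegral_gauss2_le x C1 M0 B1.
have [_ n2] := cnorm_cintegral_gauss2_le x C2 M0 B2.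
have [_ n12] := cnorm_cintegral_gauss2_le x C12 M0 B12.
have E1 : cintegral leb2 (fun xi => (symbol1 a c xi)%:C%C * expi (xi.1 * x.1 + xi.2 * x.2)) =
    (0 +i* (- (2 * pi * x.1)))%C * symbol_transform a c x.
  apply: (cintegral_by_parts1 x (ccontinuous_real C0) (ccontinuous_real C1) (toD _ B0) (toD _ B1)).
  by move=> [t y]; apply: cderive_real; exact: is_derive_symbol1.
have E2 : cintegral leb2 (fun xi => (symbol2 a c xi)%:C%C * expi (xi.1 * x.1 + xi.2 * x.2)) =
    (0 +i* (- (2 * pi * x.2)))%C * symbol_transform a c x.
  apply: (cintegral_by_parts2 x (ccontinuous_real C0) (ccontinuous_real C2) (toD _ B0) (toD _ B2)).
  by move=> [t y]; apply: cderive_real; exact: is_derive_symbol2.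
have E12 : cintegral leb2 (fun xi => (symbol12 a c xi)%:C%C * expi (xi.1 * x.1 + xi.2 * x.2)) =
    (0 +i* (- (2 * pi * x.2)))%C * ((0 +i* (- (2 * pi * x.1)))%C * symbol_transform a c x).
  rewrite -E1.
  apply: (cintegral_by_parts2 x (ccontinuous_real C1) (ccontinuous_real C12) (toD _ B1)
    (toD _ B12)).
  by move=> [t y]; apply: cderive_real; exact: is_derive_symbol12.
have p1 : 1 <= 2 * pi :> R by have := @pi_ge2 R; lra.
have le2pi (u v : R) : 0 <= v -> `|u| * v <= `|2 * pi * u| * v.
  move=> v0; rewrite ler_wpM2r// normrM ler_peMl// ger0_norm//; exact: le_trans p1.
move: n0 n1 n2 n12; rewrite E12 E1 E2 !Normc.normcM !cnorm_imaginary !normrN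
  -/(symbol_transform a c x).
set G := cnorm (symbol_transform a c x) => n0 n1 n2 n12.
have G0 : 0 <= G by exact: cnorm_ge0.
have h1 := le_trans (le2pi x.1 G G0) n1.
have h2 := le_trans (le2pi x.2 G G0) n2.
have h12 : `|x.2| * (`|x.1| * G) <= 4 * M.
  apply: le_trans n12; apply: (le_trans _ (le2pi _ _ _)); last by rewrite mulr_ge0.
  by rewrite ler_wpM2l// le2pi.
rewrite -[leRHS]mulrA -/M.
have -> : (1 + `|x.1|) * (1 + `|x.2|) * G = G + `|x.1| * G + `|x.2| * G + `|x.2| *
  (`|x.1| * G) by ring.
by lra.
Qed.

Lemma multiplier_schwartzE (sigma : R * R -> R) phi x :
  multiplier_schwartz sigma phi x =
  cintegral leb2 (fun xi => ((sigma xi)%:C%C * fourier phi xi) * expi (1 *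
    (x.1 * xi.1 + x.2 * xi.2))).
Proof. by apply: eq_cintegral => xi; rewrite mul1r. Qed.

(** Fixes the order [N] of Fourier decay of a Schwartz function at which its transform times the
    Bessel symbol is integrable. The variables separate by 1 + k (x^2 + y^2) <= (1 + k x^2) (1 + k
    y^2). *)
Lemma bessel_le_decay (s : R) : 0 < s -> exists N : nat, exists2 C : R, 0 < C &
  forall xi, bessel s xi <= C * decay2 xi * ((1 + `|xi.1| ^+ N) * (1 + `|xi.2| ^+ N)).
Proof.
move=> s0; have a0 : 0 < s / 2 by rewrite divr_gt0.
(* One power beyond s / 2 pays for the factor 1 + t^2 hidden in [decay]. *)
have [n na] : exists n : nat, s / 2 + 1 <= n%:R.
  by exists (Num.bound (s / 2 + 1)); apply/ltW/archi_boundP; rewrite addr_ge0// ltW.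
pose k : R := 4 * pi ^+ 2.
have k0 : 0 <= k by rewrite mulr_ge0 ?sqr_ge0.
have k1 : 1 <= k by rewrite /k; have := @pi_ge2 R; nra.
exists (2 * n)%N.
have H (t : R) : (1 + k * t ^+ 2) `^ (s / 2) <= (1 + k) ^+ n * decay t * (1 + `|t| ^+ (2 * n)).
  have y1 : 1 <= 1 + k * t ^+ 2 by rewrite lerDl mulr_ge0 ?sqr_ge0.
  have -> : (1 + k) ^+ n * decay t * (1 + `|t| ^+ (2 * n)) =
    (1 + k) ^+ n * (1 + `|t| ^+ (2 * n)) / (1 + t ^+ 2) by rewrite /decay mulrAC.
  rewrite ler_pdivlMr; last by rewrite ltr_wpDr ?sqr_ge0.
  have y0 : 0 <= 1 + k * t ^+ 2 by exact: le_trans y1.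
  apply: (@le_trans _ _ ((1 + k * t ^+ 2) `^ (s / 2 + 1))).
    rewrite powRD; last by rewrite (gt_eqF (lt_le_trans ltr01 y1)) implybT.
    rewrite powRr1// ler_wpM2l ?powR_ge0//.
    by rewrite lerD2l ler_peMl ?sqr_ge0.
  apply: (@le_trans _ _ ((1 + k * t ^+ 2) ^+ n)).
    by rewrite -[leRHS]powR_mulrn// ler_powR.
  have tn : t ^+ 2 = `|t| ^+ 2 by rewrite real_normK ?num_real.
  have pn : 0 <= `|t| ^+ (2 * n) by exact: exprn_ge0.
  have kn : 0 <= (1 + k) ^+ n by rewrite exprn_ge0// addr_ge0.
  have [t1|t1] := leP (t ^+ 2) 1.
    apply: (@le_trans _ _ ((1 + k) ^+ n)); last by rewrite ler_peMr// lerDl.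
    by apply: lerXn2r; rewrite ?nnegrE//; [exact: addr_ge0|rewrite lerD2l ler_piMr].
  apply: (@le_trans _ _ (((1 + k) * t ^+ 2) ^+ n)).
    apply: lerXn2r; rewrite ?nnegrE//; first by rewrite mulr_ge0 ?sqr_ge0// addr_ge0.
    by rewrite mulrDl mul1r lerD2r ltW.
  by rewrite exprMn ler_wpM2l// tn -exprM lerDr.
exists ((1 + k) ^+ n * (1 + k) ^+ n); first by rewrite mulr_gt0// exprn_gt0// ltr_wpDr.
move=> xi.
have y0 (t : R) : 0 <= 1 + k * t ^+ 2 by rewrite addr_ge0// mulr_ge0 ?sqr_ge0.
apply: (@le_trans _ _ ((1 + k * xi.1 ^+ 2) `^ (s / 2) * (1 + k * xi.2 ^+ 2) `^ (s / 2))).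
  rewrite -powRM//; apply: ge0_ler_powR; rewrite ?nnegrE ?(ltW a0) ?mulr_ge0//.
    by rewrite addr_ge0// mulr_ge0// addr_ge0 ?sqr_ge0.
  rewrite -/k; have e1 := mulr_ge0 k0 (sqr_ge0 xi.1); have e2 := mulr_ge0 k0 (sqr_ge0 xi.2).
  by have := mulr_ge0 e1 e2; move: e1 e2; lra.
apply: (le_trans (ler_pM (powR_ge0 _ _) (powR_ge0 _ _) (H _) (H _))).
by rewrite /decay2 le_eqVlt; apply/orP; left; apply/eqP; ring.
Qed.

Lemma continuous_bessel (s : R) : continuous (bessel s).
Proof. exact: (@continuous_bessel_base R (s / 2)). Qed.

Lemma cmeasurable_fourier (f : R * R -> R[i]) : cintegrable leb2 f ->
  cmeasurable (fourier f : measurableTypeR R * measurableTypeR R -> _).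
Proof.
move=> fi; have := cmeasurable_transform (-1) fi; congr cmeasurable.
by apply/funext => xi; apply: eq_cintegral => x; congr (_ * expi _); ring.
Qed.

Lemma cintegrable_bessel_fourier (s : R) phi : 0 < s -> schwartz phi ->
  cintegrable leb2 (fun xi => (bessel s xi)%:C%C * fourier phi xi).
Proof.
move=> s0 sphi; have [N [C C0 HC]] := bessel_le_decay s0.
have [F F0 HF] := schwartz_fourier_decay sphi N.
apply: (le_cintegrable _ (integrableZ_real (C * F) integrable_decay2)).
  apply: cmeasurableM; last exact/cmeasurable_fourier/schwartz_cintegrable.
  by apply: ccontinuous_measurable2; apply: ccontinuous_real; exact: continuous_bessel.
move=> xi; rewrite Normc.normcM cnorm_real ger0_norm ?powR_ge0//.
apply: (le_trans (ler_wpM2r (cnorm_ge0 _) (HC xi))).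
have Cd : 0 <= C * decay2 xi by rewrite mulr_ge0 ?decay2_ge0// ltW.
by have := ler_wpM2l Cd (HF xi); congr (_ <= _); ring.
Qed.

(** The norm is an infimum, so a single [G] suffices: the Fourier integral of the Bessel symbol
    times the transform of the packet. Transposing both pairings turns each into the integral of
    [symbol (s / 2) c] against [fourier phi]. *)
Lemma sobolev_norm_packet_le (s q : R) : 0 < s -> 1 < q -> exists2 K : R, 0 <= K &
  forall tau, (sobolev_norm s q (packet tau) <= (K * bessel s tau)%:E)%E.
Proof.
move=> s0 q1; have a0 : 0 < s / 2 by rewrite divr_gt0.
have [K K0 KP] := symbol_transform_decay a0.
have [V V0 HV] := Lp_norm_le q1.
exists (K * V); first by rewrite mulr_ge0// ltW.
move=> tau.
(* The packet gets integrated against exponentials of positive sign, which gives its transform at -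
   xi, a Gaussian centred at - tau. *)
pose c := (- tau.1, - tau.2).
pose G x := symbol_transform (s / 2) c (- x.1, - x.2).
have Ec : bessel_base c `^ (s / 2) = bessel s tau.
  by rewrite /bessel /bessel_base /= !sqrrN.
have isym : cintegrable leb2 (fun xi => (symbol (s / 2) c xi)%:C%C).
  have [K' K'0 KP'] := symbol_bounds a0.
  have [] // := @cnorm_cintegral_gauss2_le (symbol (s / 2) c) (K' * bessel_base c `^ (s / 2)) c 0.
  - exact: continuous_symbol.
  - by rewrite mulr_ge0 ?powR_ge0// ltW.
  - by move=> xi; case: (KP' c xi).
have GE x : G x = cintegral leb2 (fun xi => (symbol (s / 2) c xi)%:C%C *
    expi ((-1) * (x.1 * xi.1 + x.2 * xi.2))).
  by apply: eq_cintegral => xi; congr (_ * expi _); rewrite /=; ring.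
have mG : cmeasurable (G : measurableTypeR R * measurableTypeR R -> _).
  by have := cmeasurable_transform (-1) isym; congr cmeasurable; apply/funext => x; rewrite GE.
have GK x : (1 + `|x.1|) * (1 + `|x.2|) * cnorm (G x) <= K * bessel s tau.
  by have := KP c (- x.1, - x.2); rewrite Ec /= !normrN.
apply: (@le_trans _ _ (Lp_norm q G)); last first.
  by rewrite mulrAC; exact: HV.
apply: ereal_inf_lbound; exists G => //; split => // phi sphi /=.
set phi' := multiplier_schwartz _ phi.
have iphi := schwartz_cintegrable sphi.
have ibf := cintegrable_bessel_fourier s0 sphi.
have bN xi : bessel s (- xi) = bessel s xi by rewrite /bessel /= !sqrrN.
have phi'E x : phi' x = cintegral leb2 (fun xi => ((bessel s xi)%:C%C * fourier phi xi) *
    expi (1 * (x.1 * xi.1 + x.2 * xi.2))).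
  by rewrite /phi' multiplier_schwartzE; apply: eq_cintegral => xi; rewrite bN.
have [i1 e1] := cintegral_exchange_expi (-1) iphi isym.
have [i2 e2] := cintegral_exchange_expi 1 (cintegrable_packet tau) ibf.
have E1 : (fun x => G x * phi x) = (fun x => phi x * cintegral leb2 (fun xi =>
    (symbol (s / 2) c xi)%:C%C * expi ((-1) * (x.1 * xi.1 + x.2 * xi.2)))).
  by apply/funext => x; rewrite GE mulrC.
have E2 : (fun x => packet tau x * phi' x) = (fun x => packet tau x * cintegral leb2 (fun xi =>
    ((bessel s xi)%:C%C * fourier phi xi) * expi (1 * (x.1 * xi.1 + x.2 * xi.2)))).
  by apply/funext => x; rewrite phi'E.
rewrite -E1 in i1 e1; rewrite -E2 in i2 e2.
split; [exact: i1|exact: i2|].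
apply: (etrans e1); apply: (etrans _ (esym e2)).
apply: eq_cintegral => xi.
have -> : cintegral leb2 (fun x => phi x * expi ((-1) * (x.1 * xi.1 + x.2 * xi.2))) =
  fourier phi xi.
  by apply: eq_cintegral => x; congr (_ * expi _); ring.
have -> : cintegral leb2 (fun x => packet tau x * expi (1 * (x.1 * xi.1 + x.2 * xi.2))) =
    (gauss2 pi c xi)%:C%C.
  transitivity (fourier (packet tau) (- xi.1, - xi.2)).
    by apply: eq_cintegral => x; congr (_ * expi _); rewrite /=; ring.
  rewrite fourier_packet; congr (_%:C)%C; rewrite /gauss2 /gauss /=.
  by congr (expR _ * expR _); ring.
rewrite /symbol rmorphM /= mulrAC; congr (_ * _ * _).
Qed.

End sobolev_upper_bound.

(** * The bilinear multiplier on wave packets *)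

Section multiplier_symbol.
Context {R : realType}.
Variable m : R * R -> R[i].
Hypothesis m_smooth : smooth_on [set tau | tau != (0, 0)] m.
Hypothesis m_bound : forall b1 b2 : nat, exists C : R, forall tau : R * R,
  tau != (0, 0) -> cnorm (mixed_partial b1 b2 m tau) <= C * (`|tau.1| + `|tau.2|) ^- (b1 + b2).

Lemma multiplier_measurable :
  cmeasurable (m : measurableTypeR R * measurableTypeR R -> _).
Proof.
split; apply: (@continuous_off_measurable_plane _ _ (0, 0)) => x x0.
  by have [[c _] _] := m_smooth 0; exact: c.
by have [_ [c _]] := m_smooth 0; exact: c.
Qed.

Lemma multiplier_bounded : exists2 M : R, 0 <= M & forall tau, cnorm (m tau) <= M.
Proof.
have [C HC] := m_bound 0 0.
(* The hypotheses do not constrain [m (0, 0)], so its modulus enters the bound separately. *)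
exists (Num.max C (cnorm (m (0, 0)))); first by rewrite le_max cnorm_ge0 orbT.
move=> tau; rewrite le_max; have [->|/HC] := eqVneq tau (0, 0); first by rewrite lexx orbT.
rewrite expr0 invr1 mulr1 => h; apply/orP; left; apply: le_trans h.
by rewrite le_eqVlt; apply/orP; left; apply/eqP; congr (cnorm _); exact: complex_ext.
Qed.

Lemma mean_value_bound (f df : R -> R) (a b D : R) :
  (forall t, Num.min a b <= t <= Num.max a b -> is_derive t 1 f (df t)) ->
  (forall t, Num.min a b <= t <= Num.max a b -> `|df t| <= D) ->
  `|f b - f a| <= D * `|b - a|.
Proof.
wlog ab : a b / a <= b.
  move=> H; have [ab|ba] := orP (le_total a b); first exact: H.
  move=> fdf dfD; rewrite distrC [`|b - a|]distrC.
  by apply: (H b a ba) => t; rewrite minC maxC; [exact: fdf|exact: dfD].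
rewrite (min_idPl ab) (max_idPr ab) => fdf dfD.
have cf : {within `[a, b], continuous f}.
  apply: derivable_within_continuous => t; rewrite in_itv/= => tab.
  by case: (fdf t tab).
have fd t : t \in `]a, b[ -> is_derive t 1 f (df t).
  by rewrite in_itv/= => /andP[ta tb]; apply: fdf; rewrite !ltW.
have [t tab ->] := MVT_segment ab fd cf.
by rewrite normrM ler_wpM2r// dfD//; move: tab; rewrite in_itv.
Qed.

(** If |xi1 - tau1| >= |tau1| / 2, boundedness of [m] suffices. Otherwise the path that moves the
    first coordinate, then the second, stays where the first coordinate is at least |tau1| / 2 in
    modulus: it avoids the origin, and the gradient of [m] along it is O(1 / |tau1|). *)
Lemma multiplier_lipschitz : exists2 K : R, 0 <= K & forall tau xi : R * R, tau.1 != 0 ->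
  cnorm (m xi - m tau) <= K * (`|xi.1 - tau.1| + `|xi.2 - tau.2|) / `|tau.1|.
Proof.
have [M M0 HM] := multiplier_bounded.
have [C1 H1] := m_bound 1 0; have [C2 H2] := m_bound 0 1.
pose C := `|C1| + `|C2|.
have C0 : 0 <= C by rewrite addr_ge0.
exists (4 * M + 8 * C); first by rewrite addr_ge0 ?mulr_ge0.
move=> [t1 t2] [x1 x2] /= t0; have nt : 0 < `|t1| by rewrite normr_gt0.
rewrite ler_pdivlMr//.
have d1 : 0 <= `|x1 - t1| by []. have d2 : 0 <= `|x2 - t2| by [].
have [far|near] := leP (`|t1| / 2) `|x1 - t1|.
  apply: (@le_trans _ _ ((M + M) * `|t1|)).
    by rewrite ler_wpM2r// (le_trans (cnormB _ _))// lerD.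
  have e1 : M * `|t1| <= M * (2 * `|x1 - t1|) by rewrite ler_wpM2l//; lra.
  have e2 := mulr_ge0 M0 d2; have e3 := mulr_ge0 C0 d1; have e4 := mulr_ge0 C0 d2.
  by rewrite mulrDl; lra.
have big u : Num.min t1 x1 <= u <= Num.max t1 x1 -> `|t1| / 2 <= `|u|.
  move: near; rewrite ge_min le_max => near /andP[/orP h1 /orP h2].
  have [p|p] := leP 0 t1.
    rewrite (ger0_norm p) in near *.
    have := ler_norm u; move: near; rewrite ltr_norml => /andP[? ?].
    by case: h1 => ? ?; lra.
  rewrite (ltr0_norm p) in near *.
  have := ler_norm (- u); rewrite normrN; move: near; rewrite ltr_norml => /andP[? ?].
  by case: h2 => ? ?; lra.
have nz u v : `|t1| / 2 <= `|u| -> (u, v) != (0, 0) :> R * R.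
  move=> tu; apply/eqP => -[u0 _]; move: tu; rewrite u0 normr0; lra.
have grad (u v : R) (k : R) : `|t1| / 2 <= `|u| -> `|k| <= C ->
    k * (`|u| + `|v|) ^- 1 <= 2 * C / `|t1|.
  move=> tu kC; have v0 : 0 <= `|v| by [].
  have uv : 0 < `|u| + `|v| by lra.
  rewrite expr1 ler_pdivrMr// mulrAC ler_pdivlMr//.
  apply: (@le_trans _ _ (C * `|t1|)); first by rewrite ler_wpM2r// (le_trans (ler_norm _)).
  by rewrite [2 * C]mulrC -mulrA ler_wpM2l//; lra.
have k1 : `|C1| <= C by rewrite lerDl.
have k2 : `|C2| <= C by rewrite lerDr.
have near1 : `|t1| / 2 <= `|x1| by apply: big; rewrite ge_min le_max !lexx !orbT.
have derv u v : (u, v) != (0, 0) :> R * R ->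
    [/\ is_derive u 1 (fun z => Re (m (z, v))) (Re (mixed_partial 1 0 m (u, v))),
        is_derive u 1 (fun z => Im (m (z, v))) (Im (mixed_partial 1 0 m (u, v))),
        is_derive v 1 (fun z => Re (m (u, z))) (Re (mixed_partial 0 1 m (u, v))) &
        is_derive v 1 (fun z => Im (m (u, z))) (Im (mixed_partial 0 1 m (u, v)))].
  move=> uv; have [[_ [dr _ _]] [_ [di _ _]]] := m_smooth 1.
  have [r1 r2] := dr _ uv; have [i1 i2] := di _ uv.
  by split; [exact: (derivable_partial1 r1)|exact: (derivable_partial1 i1)|
             exact: (derivable_partial2 r2)|exact: (derivable_partial2 i2)].
pose D := 2 * C / `|t1|.
have D0 : 0 <= D by rewrite divr_ge0// mulr_ge0.
have step1 : cnorm (m (x1, t2) - m (t1, t2)) <= 2 * D * `|x1 - t1|.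
  rewrite (le_trans (cnorm_le_ReIm _))// cReD cImD cReN cImN -mulrA mulr_natl mulr2n.
  apply: lerD.
    apply: (@mean_value_bound (fun z => Re (m (z, t2))) (fun z => Re (mixed_partial 1 0 m (z,
      t2)))).
      by move=> u /big/nz uu; have [] := derv u t2 (uu t2).
    move=> u /big tu; apply: (le_trans (normr_Re_le _)).
    by apply: le_trans (grad u t2 _ tu k1); exact: H1 (nz _ _ tu).
  apply: (@mean_value_bound (fun z => Im (m (z, t2))) (fun z => Im (mixed_partial 1 0 m (z, t2)))).
    by move=> u /big/nz uu; have [] := derv u t2 (uu t2).
  move=> u /big tu; apply: (le_trans (normr_Im_le _)).
  by apply: le_trans (grad u t2 _ tu k1); exact: H1 (nz _ _ tu).
have step2 : cnorm (m (x1, x2) - m (x1, t2)) <= 2 * D * `|x2 - t2|.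
  rewrite (le_trans (cnorm_le_ReIm _))// cReD cImD cReN cImN -mulrA mulr_natl mulr2n.
  apply: lerD.
    apply: (@mean_value_bound (fun z => Re (m (x1, z))) (fun z => Re (mixed_partial 0 1 m (x1,
      z)))).
      by move=> u _; have [] := derv x1 u (nz _ _ near1).
    move=> u _; apply: (le_trans (normr_Re_le _)).
    by apply: le_trans (grad x1 u _ near1 k2); exact: H2 (nz _ _ near1).
  apply: (@mean_value_bound (fun z => Im (m (x1, z))) (fun z => Im (mixed_partial 0 1 m (x1, z)))).
    by move=> u _; have [] := derv x1 u (nz _ _ near1).
  move=> u _; apply: (le_trans (normr_Im_le _)).
  by apply: le_trans (grad x1 u _ near1 k2); exact: H2 (nz _ _ near1).
have -> : m (x1, x2) - m (t1, t2) = (m (x1, x2) - m (x1, t2)) + (m (x1, t2) - m (t1, t2)).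
  by rewrite addrA subrK.
apply: (@le_trans _ _ ((2 * D * `|x2 - t2| + 2 * D * `|x1 - t1|) * `|t1|)).
  by rewrite ler_wpM2r// (le_trans (cnormD _ _))// lerD.
have Dt : D * `|t1| = 2 * C by rewrite /D divfK// gt_eqF.
have -> : (2 * D * `|x2 - t2| + 2 * D * `|x1 - t1|) * `|t1| =
  2 * (D * `|t1|) * (`|x2 - t2| + `|x1 - t1|) by ring.
rewrite Dt.
have e1 := mulr_ge0 M0 d1; have e2 := mulr_ge0 M0 d2.
by have e3 := mulr_ge0 C0 d1; have e4 := mulr_ge0 C0 d2; lra.
Qed.

End multiplier_symbol.

(** * Freezing the symbol at the frequency of the packets *)

Section bilinear_approximation.
Context {R : realType}.
Local Notation R2 := (measurableTypeR R * measurableTypeR R)%type.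
Local Notation integ mu g := (mu.-integrable setT (EFin \o g)).
Variable m : R * R -> R[i].
Hypothesis m_meas : cmeasurable (m : R2 -> _).
Hypothesis m_bounded : exists2 M : R, 0 <= M & forall tau, cnorm (m tau) <= M.
Hypothesis m_lipschitz : exists2 K : R, 0 <= K & forall tau xi : R * R, tau.1 != 0 ->
  cnorm (m xi - m tau) <= K * (`|xi.1 - tau.1| + `|xi.2 - tau.2|) / `|tau.1|.

Lemma gauss_le_wide (c t : R) : gauss pi c t <= gauss (pi / 2) c t.
Proof.
rewrite ler_expR lerN2 ler_wpM2r ?sqr_ge0//.
by rewrite ler_pdivrMr// ler_peMr ?pi_ge0// ler1n.
Qed.

(** The transforms of the packets concentrate near (tau1, 0) and (0, tau2), and [m] sees the first
    coordinate of the one and the second of the other: a point near [tau]. Frozen there, it leaves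
    the exact product of the packets; in the error, Gaussians absorb the linear factors of the
    Lipschitz bound. *)
Lemma bilinear_multiplier_approx : exists2 K : R, 0 <= K & forall tau x : R * R, tau.1 != 0 ->
  cnorm (bilinear_multiplier m (packet (tau.1, 0)) (packet (0, tau.2)) x -
    m tau * ((gauss2 pi 0 x ^+ 2)%:C%C * expi (x.1 * tau.1 + x.2 * tau.2))) <= K / `|tau.1|.
Proof.
have [M M0 HM] := m_bounded; have [L L0 HL] := m_lipschitz.
have [J J0 HJ] := @gauss_moment R.
(* The outer 2 is the loss in [le_cnorm_cintegral], 2 J collects the two Lipschitz terms, 4 is the
   integral of the product of the two wide Gaussians. *)
exists (2 * (L * (2 * J) * 4)); first by rewrite !mulr_ge0// ltW.
move=> [t1 t2] x /= t0; have nt : 0 < `|t1| by rewrite normr_gt0.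
pose u (xi : R * R) : R[i] := (gauss2 pi (t1, 0) xi)%:C%C * expi (xi.1 * x.1 + xi.2 * x.2).
pose v (xi : R * R) : R[i] := (gauss2 pi (0, t2) xi)%:C%C * expi (xi.1 * x.1 + xi.2 * x.2).
have p0 := @pi_gt0 R; have p2 : 0 < pi / 2 :> R by rewrite divr_gt0.
have iuv (c : R * R) : cintegrable leb2
    (fun xi => (gauss2 pi c xi)%:C%C * expi (xi.1 * x.1 + xi.2 * x.2)).
  apply: (cintegrableM_bounded _ _ (M := 1)).
  - by apply: cintegrable_real; have [] := integral_gauss2 c p0.
  - by apply: cmeasurable_expi; exact: measurable_dot.
  - by move=> xi; rewrite cnorm_expi.
have iu : cintegrable leb2 u by exact: iuv.
have iv : cintegrable leb2 v by exact: iuv.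
pose m4 (w : R2 * R2) : R[i] := m (w.1.1, w.2.2).
have mm4 : cmeasurable m4.
  have [mr mi] := m_meas.
  have h : measurable_fun setT (fun w : R2 * R2 => (w.1.1, w.2.2)).
    apply: measurable_fun_pair.
      exact: (measurableT_comp measurable_fst measurable_fst).
    exact: (measurableT_comp measurable_snd measurable_snd).
  by split; [exact: (measurableT_comp mr h)|exact: (measurableT_comp mi h)].
pose uv (w : R2 * R2) : R[i] := u w.1 * v w.2.
have iuv4 : cintegrable leb4 uv by exact: (cintegrable_tensor iu iv).
have euv : cintegral leb4 uv = (gauss2 pi 0 x ^+ 2)%:C%C * expi (x.1 * t1 + x.2 * t2).
  apply: (etrans (cintegral_tensor iu iv)).
  rewrite /u /v !cintegral_gauss2_expi /= !mul0r addr0 add0r.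
  by rewrite mulrACA -expiD -rmorphM -expr2 [t1 * _]mulrC [t2 * _]mulrC.
have im : cintegrable leb4 (fun w => uv w * m4 w).
  by apply: (cintegrableM_bounded iuv4 mm4 (M := M)) => w; exact: HM.
have EF : bilinear_multiplier m (packet (t1, 0)) (packet (0, t2)) x =
    cintegral leb4 (fun w => uv w * m4 w).
  apply: eq_cintegral => w; rewrite /uv /m4 /u /v !fourier_packet /=.
  rewrite [RHS]mulrC -!mulrA; congr (_ * _).
  have -> : x.1 * (w.1.1 + w.2.1) + x.2 * (w.1.2 + w.2.2) =
    (w.1.1 * x.1 + w.1.2 * x.2) + (w.2.1 * x.1 + w.2.2 * x.2) by ring.
  by rewrite expiD; ring.
have imt : cintegrable leb4 (fun w => m (t1, t2) * uv w) by exact: cintegrableZ.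
rewrite EF -euv -cintegralZ// -cintegralB//.
pose E (c : R * R) := gauss2 (pi / 2) c.
have [iE1 eE1] := integral_gauss2 (t1, 0) p2.
have [iE2 eE2] := integral_gauss2 (0, t2) p2.
have iEE : integ leb4 (fun w : R2 * R2 => E (t1, 0) w.1 * E (0, t2) w.2).
  exact: (integrable_tensor iE1 iE2).
have eEE : \int[leb4]_w (E (t1, 0) w.1 * E (0, t2) w.2) = 4.
  have [_ e] := Rfubini1 iEE; apply: (etrans e) => /=.
  under eq_Rintegral do rewrite RintegralZl//.
  rewrite RintegralZr// eE1 eE2.
  have -> : pi / (pi / 2) = 2 :> R by rewrite invf_div mulrCA divff ?mulr1// gt_eqF.
  by ring.
have -> : 2 * (L * (2 * J) * 4) / `|t1| =
    2 * \int[leb4]_w ((L * (2 * J) / `|t1|) * (E (t1, 0) w.1 * E (0, t2) w.2)).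
  by rewrite RintegralZl// eEE; ring.
apply: (le_cnorm_cintegral _ (integrableZ_real (L * (2 * J) / `|t1|) iEE)).
  exact: cintegrableB.
move=> [[a b] [c d]].
have -> : uv (a, b, (c, d)) * m4 (a, b, (c, d)) - m (t1, t2) * uv (a, b, (c, d)) =
    (m (a, d) - m (t1, t2)) * uv (a, b, (c, d)) by rewrite /m4 /=; ring.
rewrite Normc.normcM.
have -> : cnorm (uv (a, b, (c, d))) = gauss2 pi (t1, 0) (a, b) * gauss2 pi (0, t2) (c, d).
  by rewrite /uv /u /v !Normc.normcM !cnorm_expi !mulr1 !cnorm_real !ger0_norm ?gauss2_ge0.
have g0 := @gauss2_ge0 R pi (t1, 0) (a, b); have h0 := @gauss2_ge0 R pi (0, t2) (c, d).
apply: (le_trans (ler_wpM2r (mulr_ge0 g0 h0) (HL (t1, t2) (a, d) t0))) => /=.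
have moment (z w : R) : `|w - z| * gauss pi z w <= J * gauss (pi / 2) z w.
  apply: le_trans (HJ z w); rewrite ler_wpM2r ?gauss_ge0// ler_peMl//.
  by have := @pi_ge2 R; lra.
have q1 := moment t1 a; have q2 := moment t2 d.
have w1 := gauss_le_wide t1 a; have w2 := gauss_le_wide 0 b.
have w3 := gauss_le_wide 0 c; have w4 := gauss_le_wide t2 d.
rewrite /E /gauss2 /=.
have G0 (z w e : R) : 0 <= gauss e z w by exact: gauss_ge0.
have r1 : `|a - t1| * gauss pi t1 a * (gauss pi 0 b * (gauss pi 0 c * gauss pi t2 d)) <=
    J * gauss (pi / 2) t1 a * (gauss (pi / 2) 0 b * (gauss (pi / 2) 0 c * gauss (pi / 2) t2 d)).
  by rewrite ler_pM ?mulr_ge0// ler_pM ?mulr_ge0// ler_pM.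
have r2 : `|d - t2| * gauss pi t2 d * (gauss pi t1 a * (gauss pi 0 b * gauss pi 0 c)) <=
    J * gauss (pi / 2) t2 d * (gauss (pi / 2) t1 a * (gauss (pi / 2) 0 b * gauss (pi / 2) 0 c)).
  by rewrite ler_pM ?mulr_ge0// ler_pM ?mulr_ge0// ler_pM.
have Lt : 0 <= L / `|t1| by rewrite divr_ge0.
have := ler_wpM2l Lt (lerD r1 r2); congr (_ <= _); ring.
Qed.

End bilinear_approximation.

(** * Duality in the first variable *)

Section line_symbol.
Context {R : realType}.
Variable a : R.
Hypothesis a_gt0 : 0 < a.
Implicit Types (c t x tau : R).

Local Notation P b t := (bessel_base (t, 0) `^ b).

(* The first-variable factor of the symbol of (I - Delta_x)^a times the Fourier
   transform of a packet; bessel_base is evaluated on the axis. *)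
Definition line_symbol c t : R := P a t * gauss pi c t.

Definition line_symbol1 c t : R :=
  (a * (P (a - 1) t * slope t) - P a t * (2 * pi * (t - c))) * gauss pi c t.

Definition line_symbol2 c t : R :=
  (a * (a - 1) * (P (a - 1 - 1) t * slope t * slope t) + a * (8 * pi ^+ 2) * P (a - 1) t
   - 2 * a * (P (a - 1) t * slope t) * (2 * pi * (t - c)) - 2 * pi * P a t
   + P a t * (2 * pi * (t - c)) * (2 * pi * (t - c))) * gauss pi c t.

Lemma is_derive_slope t : is_derive t 1 slope (8 * pi ^+ 2 : R).
Proof.
apply: (is_derive_eq (is_derive_scale (4 * pi) (is_derive_scale (2 * pi) (is_derive_id t 1)))).
by ring.
Qed.

Lemma is_derive_freq c t : is_derive t 1 (fun u => 2 * pi * (u - c)) (2 * pi).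
Proof.
by apply: (is_derive_eq (is_derive_scale (2 * pi) (is_derive_translate c t))); rewrite mulr1.
Qed.

Lemma is_derive_line_symbol c t : is_derive t 1 (line_symbol c) (line_symbol1 c t).
Proof.
apply: (is_derive_eq (is_derive_mul (is_derive_bessel_base1 a t 0) (is_derive_gauss pi c t))).
by rewrite /line_symbol1; ring.
Qed.

Lemma is_derive_line_symbol1 c t : is_derive t 1 (line_symbol1 c) (line_symbol2 c t).
Proof.
have D1 := is_derive_scale a (is_derive_mul (is_derive_bessel_base1 (a - 1) t 0)
  (is_derive_slope t)).
have D2 := is_derive_mul (is_derive_bessel_base1 a t 0) (is_derive_freq c t).
apply: (is_derive_eq (is_derive_mul (is_derive_add D1 (is_derive_opp D2))
  (is_derive_gauss pi c t))).
by rewrite /line_symbol2; ring.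
Qed.

Lemma continuous_line_base b : continuous (fun t : R => P b t).
Proof. by move=> t; exact: is_derive_continuous (is_derive_bessel_base1 b t 0). Qed.

Lemma continuous_line_symbol c : continuous (line_symbol c).
Proof. by move=> t; exact: is_derive_continuous (is_derive_line_symbol c t). Qed.

Lemma continuous_line_symbol1 c : continuous (line_symbol1 c).
Proof. by move=> t; exact: is_derive_continuous (is_derive_line_symbol1 c t). Qed.

Lemma continuous_line_symbol2 c : continuous (line_symbol2 c).
Proof.
move=> t.
have cs := is_derive_continuous (is_derive_slope t).
have cf := is_derive_continuous (is_derive_freq c t).
have cP b := @continuous_line_base b t.
have cc (k : R) : (fun _ : R => k) z @[z --> t] --> k by exact: cvg_cst.
exact: (cvgM (cvgD (cvgB (cvgB (cvgD (cvgM (cc (a * (a - 1))) (cvgM (cvgM (cP (a - 1 - 1)) cs) cs))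
  (cvgM (cc (a * (8 * pi ^+ 2))) (cP (a - 1))))
  (cvgM (cvgM (cc (2 * a)) (cvgM (cP (a - 1)) cs)) cf)) (cvgM (cc (2 * pi)) (cP a)))
  (cvgM (cvgM (cP a) cf) cf)) (@continuous_gauss R pi c t)).
Qed.

(** The mechanism of [symbol_bounds], with [bessel_gauss2_absorb] used at second coordinate 0. Here
    two derivatives fall on the same variable, for quadratic decay of the transform. *)
Lemma line_symbol_bounds : exists2 K : R, 0 < K & forall c t,
  let B := K * P a c * gauss (pi / 2) c t in
  [/\ `|line_symbol c t| <= B, `|line_symbol1 c t| <= B & `|line_symbol2 c t| <= B].
Proof.
have [K K0 KP] := @bessel_gauss2_absorb R a a_gt0.
pose k := 4 * pi : R.
have p0 := @pi_ge0 R.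
have k0 : 0 <= k by rewrite mulr_ge0.
have ak0 : 0 <= a * k by rewrite mulr_ge0// ltW.
have aak0 : 0 <= a * `|a - 1| * k ^+ 2 by rewrite mulr_ge0 ?sqr_ge0// mulr_ge0// ltW.
have ap0 : 0 <= a * (8 * pi ^+ 2) by rewrite mulr_ge0 ?mulr_ge0 ?sqr_ge0// ltW.
(* The summands match the terms of [line_symbol2]: 2 pi comes from differentiating 2 pi (t - c), 8
   pi^2 a from differentiating [slope], 2 a k from one derivative on each factor. *)
pose C := 1 + 2 * pi + a * (8 * pi ^+ 2) + 2 * (a * k) + a * `|a - 1| * k ^+ 2.
have C0 : 0 < C by rewrite /C; lra.
exists (C * K); first by rewrite mulr_gt0.
move=> c t B.
have suf (w : R) : `|w| <= C * P a t * (1 + 2 * pi * `|t - c|) ^+ 2 -> `|w * gauss pi c t| <= B.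
  move=> wC; rewrite normrM [`|gauss _ _ _|]ger0_norm ?gauss_ge0//.
  apply: (le_trans (ler_wpM2r (gauss_ge0 _ _ _) wC)).
  have := ler_wpM2l (ltW C0) (KP (c, 0) (t, 0)).
  rewrite /gauss2 /gauss /= !subr0 normr0 expr0n /= !(mulr0, oppr0, addr0, expR0, mulr1, expr1n).
  by rewrite /B /gauss; congr (_ <= _); ring.
have [s1 _] := slope_le (t, 0); rewrite -/k /= in s1.
pose p := P a t; pose Q := P (a - 1) t; pose S := P (a - 1 - 1) t.
have P0 : 0 <= p by exact: powR_ge0.
have Q0 : 0 <= Q by exact: powR_ge0.
have S0 : 0 <= S by exact: powR_ge0.
have QP : bessel_base (t, 0) * Q = p by exact: bessel_base_powS.
have SQ : bessel_base (t, 0) * S = Q by exact: bessel_base_powS.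
have b1 : 1 <= bessel_base (t, 0) :> R by exact: bessel_base_ge1.
have q0 : Q <= p by rewrite -QP ler_peMl.
have b0 := le_trans ler01 b1.
have q1 : `|Q * slope t| <= k * p.
  by rewrite normrM ger0_norm// -QP [leLHS]mulrC [leRHS]mulrA ler_wpM2r.
have q12 : `|S * slope t * slope t| <= k ^+ 2 * p.
  rewrite normrM [`|S * _|]normrM [`|S|]ger0_norm// -QP -SQ.
  have -> : k ^+ 2 * (bessel_base (t, 0) * (bessel_base (t, 0) * S)) =
    S * (k * bessel_base (t, 0)) * (k * bessel_base (t, 0)) by ring.
  by apply: ler_pM => //; [rewrite mulr_ge0|rewrite ler_wpM2l].
pose h := 2 * pi * (t - c).
have hn : 2 * pi * `|t - c| = `|h| by rewrite normrM [`|2 * pi|]ger0_norm// mulr_ge0.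
rewrite hn -/p in suf.
rewrite /line_symbol /line_symbol1 /line_symbol2 -/p -/Q -/S -/h.
have na (u v : R) : `|u| <= v -> `|a * u| <= a * v.
  by move=> uv; rewrite normrM [`|a|]gtr0_norm// ler_wpM2l// ltW.
have u0 : 0 <= `|h| by [].
have uu0 : 0 <= `|h| ^+ 2 by exact: sqr_ge0.
(* The monomials dominated by (1 + |h|)^2, each with a nonnegative coefficient [y]; afterwards [lra]
   meets only linear atoms. *)
have T (y : R) : 0 <= y -> y <= y * (1 + `|h|) ^+ 2 /\ y * `|h| <= y * (1 + `|h|) ^+ 2 /\
    y * `|h| ^+ 2 <= y * (1 + `|h|) ^+ 2 /\ 2 * (y * `|h|) <= 2 * y * (1 + `|h|) ^+ 2 /\
    0 <= y * (1 + `|h|) ^+ 2 /\ y + y * `|h| ^+2 <= y * (1 + `|h|) ^+ 2 /\ y + y * `|h| <= y *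
      (1 + `|h|) ^+ 2.
  move=> y0; have e1 := mulr_ge0 y0 u0; have e2 := mulr_ge0 y0 uu0.
  have -> : y * (1 + `|h|) ^+ 2 = y + 2 * (y * `|h|) + y * `|h| ^+ 2 by ring.
  have -> : 2 * y * (1 + `|h|) ^+ 2 = 2 * (y + 2 * (y * `|h|) + y * `|h| ^+ 2) by ring.
  move: (y * `|h| ^+ 2) (y * `|h|) e1 e2 => z1 z2 e1 e2.
  by clear -y0 e1 e2; do 6?[split; first by lra]; lra.
have CE : C * p * (1 + `|h|) ^+ 2 = p * (1 + `|h|) ^+ 2 + 2 * pi * p * (1 + `|h|) ^+ 2 +
    a * (8 * pi ^+ 2) * p * (1 + `|h|) ^+ 2 + 2 * (a * k * p) * (1 + `|h|) ^+ 2 +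
    a * `|a - 1| * k ^+ 2 * p * (1 + `|h|) ^+ 2 by rewrite /C; ring.
rewrite CE in suf.
have [a1 [a2 [a3 [_ [a4 [a5 a6]]]]]] := T _ P0.
have y2 : 0 <= 2 * pi * p by rewrite !mulr_ge0.
have [c1 [_ [_ [_ [c4 _]]]]] := T _ y2.
have y3 : 0 <= a * (8 * pi ^+ 2) * p by rewrite mulr_ge0.
have [d1 [_ [_ [_ [d4 _]]]]] := T _ y3.
have y4 : 0 <= a * k * p by rewrite mulr_ge0.
have [e1 [e2 [_ [e3 [e4 [_ e6]]]]]] := T _ y4.
have y5 : 0 <= a * `|a - 1| * k ^+ 2 * p by rewrite mulr_ge0.
have [f1 [_ [_ [_ [f4 _]]]]] := T _ y5.
have g1 : `|a * (Q * slope t)| <= a * k * p by rewrite -mulrA na.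
have g2 : `|p * h| = p * `|h| by rewrite normrM ger0_norm.
have g3 : `|a * (a - 1) * (S * slope t * slope t)| <= a * `|a - 1| * k ^+ 2 * p.
  rewrite normrM [`|a * _|]normrM [`|a|]gtr0_norm// -[leRHS]mulrA ler_wpM2l//.
  by rewrite mulr_ge0// ltW.
have g4 : `|a * (8 * pi ^+ 2) * Q| <= a * (8 * pi ^+ 2) * p.
  by rewrite ger0_norm ?ler_wpM2l// mulr_ge0.
have g5 : `|2 * a * (Q * slope t) * h| <= 2 * (a * k * p * `|h|).
  rewrite -[2 * a * _]mulrA -[2 * _ * h]mulrA normrM [`|2|]ger0_norm// ler_wpM2l//.
  by rewrite normrM ler_wpM2r.
have g6 : `|2 * pi * p| = 2 * pi * p by rewrite ger0_norm.
have g7 : `|p * h * h| = p * `|h| ^+ 2 by rewrite normrM g2 -mulrA -expr2.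
move: a1 a2 a3 a4 a5 a6 c1 c4 d1 d4 e1 e2 e3 e4 e6 f1 f4 suf.
have -> : 2 * (a * k * p) * (1 + `|h|) ^+ 2 = 2 * (a * k * p * (1 + `|h|) ^+ 2) by ring.
move: (p * (1 + `|h|) ^+ 2) (2 * pi * p * (1 + `|h|) ^+ 2) (a * (8 * pi ^+ 2) * p * (1 + `|h|) ^+ 2)
  (a * k * p * (1 + `|h|) ^+ 2) (a * `|a - 1| * k ^+ 2 * p * (1 + `|h|) ^+ 2) => v1 v2 v3 v4 v5.
move=> a1 a2 a3 a4 a5 a6 c1 c4 d1 d4 e1 e2 e3 e4 e6 f1 f4 suf.
split; apply: suf.
- by rewrite ger0_norm//; clear -a1 c4 d4 e4 f4; lra.
- apply: (le_trans (ler_normB _ _)); rewrite g2.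
  by clear -g1 a2 c4 d4 e1 e4 f4; lra.
apply: (le_trans (ler_normD _ _)); rewrite g7.
apply: (le_trans (lerD (ler_normB _ _) (lexx _))); rewrite g6.
apply: (le_trans (lerD (lerD (ler_normB _ _) (lexx _)) (lexx _))).
apply: (le_trans (lerD (lerD (lerD (ler_normD _ _) (lexx _)) (lexx _)) (lexx _))).
by clear -g3 g4 g5 a3 c1 d1 e2 f1 a4 e4; lra.
Qed.

End line_symbol.

(** * The one-dimensional transform: decay and leading term *)

Section line_transform.
Context {R : realType}.
Local Notation leb := (@lebesgue_measure R).
Variable a : R.
Hypothesis a_gt0 : 0 < a.
Implicit Types (c t x : R).

Local Notation P b t := (bessel_base (t, 0) `^ b).

Definition line_transform c x : R[i] :=
  cintegral leb (fun t => (line_symbol a c t)%:C%C * expi (t * x)).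

Lemma cnorm_cintegral_gauss_le : exists2 J : R, 0 < J & forall (k : R -> R) (M : R) c x,
  continuous k -> 0 <= M -> (forall t, `|k t| <= M * gauss (pi / 2) c t) ->
  cintegrable leb (fun t => (k t)%:C%C) /\
  cnorm (cintegral leb (fun t => (k t)%:C%C * expi (t * x))) <= M * J.
Proof.
have p2 : 0 < pi / 2 :> R by rewrite divr_gt0 ?pi_gt0.
exists (2 * Num.sqrt (pi / (pi / 2))).
  by rewrite mulr_gt0// sqrtr_gt0 divr_gt0 ?pi_gt0.
move=> k M c x ck M0 kM; have [ig eg] := integral_gauss c p2.
have ik : cintegrable leb (fun t => (k t)%:C%C).
  apply: (le_cintegrable _ (integrableZ_real M ig)).
    by apply: ccontinuous_measurable; exact: ccontinuous_real.
  by move=> t; rewrite cnorm_real.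
split=> //.
have -> : M * (2 * Num.sqrt (pi / (pi / 2))) = 2 * \int[leb]_t (M * gauss (pi / 2) c t).
  by rewrite RintegralZl// eg; ring.
apply: (le_cnorm_cintegral _ (integrableZ_real M ig)).
  apply: (cintegrableM_bounded ik (M := 1)); first exact: cmeasurable_expiZ.
  by move=> t; rewrite cnorm_expi.
by move=> t; rewrite Normc.normcM cnorm_expi mulr1 cnorm_real.
Qed.

(** Two integrations by parts bound x^2 times the transform, besides the transform itself. The decay
    is wanted because the error in [bilinear_multiplier_approx] is only uniform in [x], so the test
    function has to supply integrability. *)
Lemma line_transform_decay : exists2 K : R, 0 < K & forall c x,
  cnorm (line_transform c x) <= K * P a c * decay x.
Proof.
have [K K0 KP] := line_symbol_bounds a_gt0.
have [J J0 HJ] := cnorm_cintegral_gauss_le.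
exists (2 * (K * J)); first by rewrite !mulr_gt0.
move=> c x; pose M := K * P a c.
have M0 : 0 <= M by rewrite mulr_ge0 ?powR_ge0// ltW.
have p2 : 0 < pi / 2 :> R by rewrite divr_gt0 ?pi_gt0.
have [D D0 DP] := @gauss_le_decay R (pi / 2) c p2.
have toD (k : R -> R) : (forall t, `|k t| <= M * gauss (pi / 2) c t) ->
    forall t, cnorm (k t)%:C%C <= (M * D) * decay t.
  by move=> kM t; rewrite cnorm_real (le_trans (kM t))// -mulrA ler_wpM2l.
have B0 t : `|line_symbol a c t| <= M * gauss (pi / 2) c t by case: (KP c t).
have B1 t : `|line_symbol1 a c t| <= M * gauss (pi / 2) c t by case: (KP c t).
have B2 t : `|line_symbol2 a c t| <= M * gauss (pi / 2) c t by case: (KP c t).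
have C0 := @continuous_line_symbol R a c; have C1 := @continuous_line_symbol1 R a c.
have C2 := @continuous_line_symbol2 R a c.
have [_ n0] := HJ _ M c x C0 M0 B0; have [_ n2] := HJ _ M c x C2 M0 B2.
have E1 : cintegral leb (fun t => (line_symbol1 a c t)%:C%C * expi (t * x)) =
    (0 +i* (- (2 * pi * x)))%C * line_transform c x.
  apply: (cintegral_by_parts x _ (ccontinuous_real C1) (toD _ B0) (toD _ B1)).
  by move=> t; apply: cderive_real; exact: is_derive_line_symbol.
have E2 : cintegral leb (fun t => (line_symbol2 a c t)%:C%C * expi (t * x)) =
    (0 +i* (- (2 * pi * x)))%C * ((0 +i* (- (2 * pi * x)))%C * line_transform c x).
  rewrite -E1.
  apply: (cintegral_by_parts x _ (ccontinuous_real C2) (toD _ B1) (toD _ B2)).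
  by move=> t; apply: cderive_real; exact: is_derive_line_symbol1.
move: n0 n2; rewrite E2 !Normc.normcM !cnorm_imaginary !normrN -/(line_transform c x).
set G := cnorm (line_transform c x) => n0 n2.
have G0 : 0 <= G by exact: cnorm_ge0.
rewrite /decay ler_pdivlMr; last by rewrite ltr_wpDr ?sqr_ge0.
have n3 : x ^+ 2 * G <= M * J.
  apply: le_trans n2; rewrite mulrA -expr2 real_normK ?num_real// ler_wpM2r//.
  rewrite exprMn ler_peMl ?sqr_ge0//; have := @pi_ge2 R; nra.
rewrite (_ : 2 * (K * J) * P a c = 2 * (M * J)); last by rewrite /M; ring.
by rewrite mulrDr mulr1 [G * _]mulrC; lra.
Qed.

(** With u = a ln rho: for rho >= 1, 1 - u <= e^(-u) gives rho^a - 1 <= a (ln rho) rho^a; for rho <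
    1, 1 - rho^a <= - u <= a (1 / rho - 1). Each case accounts for one term of the sum, and small
    and large [a] are treated alike. *)
Lemma powR_sub1_le (rho : R) : 0 < rho ->
  `|rho `^ a - 1| <= a * `|rho - 1| * (rho `^ a + rho^-1).
Proof.
move=> r0; have E : rho `^ a = expR (a * ln rho) by rewrite /powR gt_eqF.
have ra : 0 < rho `^ a by exact: powR_gt0.
have ri : 0 < rho^-1 by rewrite invr_gt0.
have lnle (u : R) : 0 < u -> ln u <= u - 1.
  move=> u0; have := expR_ge1Dx (ln u); rewrite lnK ?posrE//; lra.
have [r1|r1] := leP 1 rho.
  have rr : 0 <= rho - 1 by lra.
  have l0 : 0 <= ln rho by rewrite ln_ge0.
  have ra1 : 1 <= rho `^ a by rewrite E -expR0 ler_expR mulr_ge0// ltW.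
  rewrite ger0_norm ?subr_ge0// (ger0_norm rr).
  have h1 : 1 - a * ln rho <= expR (- (a * ln rho)) by exact: expR_ge1Dx.
  have h2 : (1 - a * ln rho) * rho `^ a <= 1.
    apply: (le_trans (ler_wpM2r (ltW ra) h1)).
    by rewrite E -expRD addNr expR0.
  have h3 : a * ln rho * rho `^ a <= a * (rho - 1) * rho `^ a.
    by rewrite ler_wpM2r ?ler_wpM2l ?(ltW a_gt0) ?(ltW ra)// lnle.
  have h4 : 0 <= a * (rho - 1) * rho^-1 by rewrite !mulr_ge0 ?(ltW a_gt0) ?(ltW ri).
  by rewrite mulrDr; move: h2; rewrite mulrBl mul1r; lra.
have rr : rho - 1 < 0 by lra.
have l0 : ln rho <= 0 by apply: ln_le0; exact: ltW.
have ra1 : rho `^ a <= 1 by rewrite E -expR0 ler_expR pmulr_rle0.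
rewrite distrC ger0_norm ?subr_ge0// (ltr0_norm rr).
have h1 : 1 + a * ln rho <= rho `^ a by rewrite E expR_ge1Dx.
have h2 : - ln rho <= rho^-1 - 1 by rewrite -lnV ?posrE// lnle.
have h3 : a * - ln rho <= a * (rho^-1 - 1) by rewrite ler_wpM2l// ltW.
have h4 : a * (- (rho - 1)) * rho^-1 = a * (rho^-1 - 1).
  by rewrite -mulrA opprB mulrBl mul1r divff// gt_eqF.
have h5 : 0 <= a * (- (rho - 1)) * rho `^ a by rewrite !mulr_ge0 ?(ltW a_gt0) ?(ltW ra)//; lra.
by rewrite mulrDr; lra.
Qed.

(** For the ratio rho of the two bases, rho - 1 = k (t^2 - c^2) / (1 + k c^2), and |t^2 - c^2| <= |t
    - c| (|t - c| + 2 |c|): this gains 1 / |c|. Peetre's inequality in both directions bounds rho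
    and 1 / rho, and the Gaussian absorbs the powers of t - c. *)
Lemma line_base_diff : exists2 K : R, 0 < K & forall c t, 1 <= `|c| ->
  `|P a t - P a c| * gauss pi c t <= K * P a c / `|c| * gauss (pi / 2) c t.
Proof.
(* Up to constants rho^a costs y^a and 1 / rho costs y; as y >= 1, the exponent a + 1 covers
   both. *)
have [K K0 HK] := @gauss_weight_absorb R (a + 1) (addr_gt0 a_gt0 ltr01).
pose k : R := 4 * pi ^+ 2.
have pp := @pi_ge2 R.
have k1 : 1 <= k by rewrite /k; nra.
have k0 : 0 <= k by lra.
exists (a * (2 `^ a + 2) * K); first by rewrite !mulr_gt0// addr_gt0// powR_gt0.
move=> c t c1; set n := `|c| in c1 *.
have n0 : 0 < n by lra.
pose rho : R := bessel_base (t, 0) / bessel_base (c, 0).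
have bt := bessel_base_gt0 (t, 0); have bc := bessel_base_gt0 (c, 0).
have r0 : 0 < rho by rewrite divr_gt0.
pose y : R := 1 + k * (t - c) ^+ 2.
have y1 : 1 <= y by rewrite lerDl mulr_ge0 ?sqr_ge0.
have y0 : 0 <= y by lra.
have ya : 1 <= y `^ a by rewrite -(powRr0 y) ler_powR// ltW.
have peetre u v : bessel_base (u, 0) <= 2 * (1 + k * (u - v) ^+ 2) * bessel_base (v, 0) :> R.
  have := bessel_base_peetre (v, 0) (u, 0); rewrite /= subr0 expr0n /= mulr0 addr0 mulr1.
  by [].
have ry : rho <= 2 * y by rewrite ler_pdivrMr//; exact: peetre.
have riy : rho^-1 <= 2 * y.
  rewrite /rho invf_div ler_pdivrMr//.
  by have := peetre c t; rewrite -sqrrN opprB.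
have Pt : P a t = rho `^ a * P a c.
  by rewrite -powRM ?(ltW r0) ?(ltW bc)// /rho divfK// gt_eqF.
have -> : P a t - P a c = (rho `^ a - 1) * P a c by rewrite Pt mulrBl mul1r.
rewrite normrM [`|P a c|]ger0_norm ?powR_ge0//.
have rho1 : `|rho - 1| <= (1 + 2 * pi * `|t - c|) ^+ 2 / n.
  have E : rho - 1 = k * (t ^+ 2 - c ^+ 2) / bessel_base (c, 0).
    have bc' : bessel_base (c, 0) = 1 + k * c ^+ 2 by rewrite /bessel_base /= expr0n /= addr0.
    have bt' : bessel_base (t, 0) = 1 + k * t ^+ 2 by rewrite /bessel_base /= expr0n /= addr0.
    rewrite /rho bc' bt'; field; rewrite -bc' gt_eqF//.
  have nn : c ^+ 2 = n ^+ 2 by rewrite /n real_normK ?num_real.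
  have bcn : k * n ^+ 2 <= bessel_base (c, 0).
    by rewrite /bessel_base -/k /= expr0n /= addr0 nn lerDr.
  rewrite E normrM normrM (ger0_norm k0) [`|_^-1|]ger0_norm ?invr_ge0 ?(ltW bc)//.
  rewrite ler_pdivrMr// [leRHS]mulrAC ler_pdivlMr//.
  have tc : t ^+ 2 - c ^+ 2 = (t - c) * (t - c + 2 * c) by ring.
  have d0 : 0 <= `|t - c| by [].
  have h1 : `|t ^+ 2 - c ^+ 2| <= `|t - c| * (`|t - c| + 2 * n).
    rewrite tc normrM ler_wpM2l// (le_trans (ler_normD _ _))// normrM.
    by rewrite [`|2|]ger0_norm.
  have h2 : `|t - c| * (`|t - c| + 2 * n) <= (1 + 2 * pi * `|t - c|) ^+ 2 * n.
    move: d0; move: `|t - c| => d d0.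
    have dp : 2 * d <= pi * d by rewrite ler_wpM2r.
    have dd : 0 <= d * d by rewrite mulr_ge0.
    have z1 : 4 * d <= 2 * pi * d by lra.
    have z2 : (1 + 4 * d) ^+ 2 <= (1 + 2 * pi * d) ^+ 2.
      by apply: lerXn2r; rewrite ?nnegrE; lra.
    apply: (@le_trans _ _ ((1 + 4 * d) ^+ 2 * n)); last by rewrite ler_wpM2r// ltW.
    have z3 : d * d <= d * d * n by rewrite ler_peMr.
    have z4 : 0 <= d * n by rewrite mulr_ge0// ltW.
    have z5 : 0 <= d * d * n by rewrite mulr_ge0// ltW.
    have -> : (1 + 4 * d) ^+ 2 * n = n + 8 * (d * n) + 16 * (d * d * n) by ring.
    have -> : d * (d + 2 * n) = d * d + 2 * (d * n) by ring.
    lra.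
  have h3 := le_trans h1 h2.
  apply: (@le_trans _ _ (k * ((1 + 2 * pi * `|t - c|) ^+ 2 * n) * n)).
    by rewrite ler_wpM2r ?(ltW n0)// ler_wpM2l.
  have -> : k * ((1 + 2 * pi * `|t - c|) ^+ 2 * n) * n =
    (1 + 2 * pi * `|t - c|) ^+ 2 * (k * n ^+ 2) by ring.
  by rewrite ler_wpM2l ?sqr_ge0.
have sum : rho `^ a + rho^-1 <= (2 `^ a + 2) * y `^ (a + 1).
  have w1 : rho `^ a <= 2 `^ a * y `^ a.
    rewrite -powRM//; apply: ge0_ler_powR; rewrite ?nnegrE ?(ltW a_gt0) ?(ltW r0)//.
    by rewrite mulr_ge0.
  rewrite powRD; last by rewrite (gt_eqF (lt_le_trans ltr01 y1)) implybT.
  rewrite powRr1// mulrDl lerD//.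
    apply: (le_trans w1); rewrite ler_wpM2l ?powR_ge0// ler_peMr ?powR_ge0//.
  by apply: (le_trans riy); rewrite ler_wpM2l// ler_peMl.
have s0 : 0 <= rho `^ a + rho^-1 by rewrite addr_ge0 ?powR_ge0 ?invr_ge0 ?(ltW r0).
have b1 : `|rho `^ a - 1| <= a * ((1 + 2 * pi * `|t - c|) ^+ 2 / n) * ((2 `^ a + 2) * y `^ (a + 1)).
  apply: (le_trans (powR_sub1_le r0)); apply: ler_pM => //; first by rewrite mulr_ge0 ?(ltW a_gt0).
  by rewrite ler_wpM2l ?(ltW a_gt0).
have A0 : 0 <= a * (2 `^ a + 2) * P a c / n.
  by rewrite divr_ge0 ?(ltW n0)// mulr_ge0 ?powR_ge0// mulr_ge0 ?(ltW a_gt0)// addr_ge0 ?powR_ge0.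
have g0 : 0 <= P a c * gauss pi c t by rewrite mulr_ge0 ?powR_ge0 ?gauss_ge0.
rewrite -[leLHS]mulrA; apply: (le_trans (ler_wpM2r g0 b1)).
by have := ler_wpM2l A0 (HK c t); rewrite -/k -/y; congr (_ <= _); ring.
Qed.

(** Replacing [P a t] by its value at [c] leaves the transform of a Gaussian, known exactly;
    [line_base_diff] bounds the integrand of the error. *)
Lemma line_transform_approx : exists2 K : R, 0 < K & forall c x, 1 <= `|c| ->
  cnorm (line_transform c x - (P a c)%:C%C * ((gauss pi 0 x)%:C%C * expi (c * x))) <=
  K * P a c / `|c|.
Proof.
have [K K0 KP] := line_base_diff.
have [Ks Ks0 KsP] := line_symbol_bounds a_gt0.
have [J J0 HJ] := cnorm_cintegral_gauss_le.
exists (K * J); first by rewrite mulr_gt0.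
move=> c x c1.
have isym : cintegrable leb (fun t => (line_symbol a c t)%:C%C).
  have [] // := HJ (line_symbol a c) (Ks * P a c) c 0.
  - exact: continuous_line_symbol.
  - by rewrite mulr_ge0 ?powR_ge0// ltW.
  - by move=> t; case: (KsP c t).
have isx : cintegrable leb (fun t => (line_symbol a c t)%:C%C * expi (t * x)).
  apply: (cintegrableM_bounded isym (M := 1)); first exact: cmeasurable_expiZ.
  by move=> t; rewrite cnorm_expi.
have igx : cintegrable leb (fun t => (gauss pi c t)%:C%C * expi (t * x)).
  exact: cintegrable_gauss_expi.
have igx' := cintegrableZ (P a c)%:C%C igx.
rewrite -cintegral_gauss_expi -cintegralZ// /line_transform -cintegralB//.
pose k t := (P a t - P a c) * gauss pi c t.
have -> : cintegral leb (fun t => (line_symbol a c t)%:C%C * expi (t * x) -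
    (P a c)%:C%C * ((gauss pi c t)%:C%C * expi (t * x))) =
  cintegral leb (fun t => (k t)%:C%C * expi (t * x)).
  apply: eq_cintegral => t; rewrite /line_symbol /k mulrA -mulrBl; congr (_ * _).
  by rewrite -rmorphM -rmorphB mulrBl.
have ck : continuous k.
  move=> t; apply: cvgM; last exact: continuous_gauss.
  by apply: cvgB; [exact: continuous_line_base|exact: cvg_cst].
have kM t : `|k t| <= K * P a c / `|c| * gauss (pi / 2) c t.
  by rewrite normrM [`|gauss _ _ _|]ger0_norm ?gauss_ge0//; exact: KP.
have M0 : 0 <= K * P a c / `|c| by rewrite divr_ge0// mulr_ge0 ?powR_ge0// ltW.
have [_ h] := HJ k _ c x ck M0 kM.
by apply: (le_trans h); rewrite le_eqVlt; apply/orP; left; apply/eqP; ring.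
Qed.

End line_transform.

(** * Pairing with the transposed packet and Hoelder's inequality *)

Section duality_pairing.
Context {R : realType}.
Local Notation R2 := (measurableTypeR R * measurableTypeR R)%type.
Variable s : R.
Hypothesis s_gt0 : 0 < s.
Let a := s / 2.
Let a_gt0 : 0 < a. Proof. exact: divr_gt0. Qed.

Let B (c : R) := bessel_base (c, 0) `^ a.

(* The test function is modulated at - tau so as to cancel the phase of
   bilinear_multiplier m f g. *)
Definition dual_packet (tau : R * R) : R * R -> R[i] :=
  multiplier_schwartz (fun xi => bessel_x s (- xi)) (packet (- tau.1, - tau.2)).

(** The multiplier acts on the first variable only, so the integral factors; in the second variable
    the packet is reproduced. *)
Lemma dual_packetE tau x : dual_packet tau x =
  line_transform a (- tau.1) x.1 * ((gauss pi 0 x.2)%:C%C * expi (- tau.2 * x.2)).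
Proof.
have [K K0 KP] := line_symbol_bounds a_gt0.
have [J J0 HJ] := @cnorm_cintegral_gauss_le R.
have isym : cintegrable lebesgue_measure (fun t => (line_symbol a (- tau.1) t)%:C%C).
  have [] // := HJ (line_symbol a (- tau.1)) (K * B (- tau.1)) (- tau.1) 0.
  - exact: continuous_line_symbol.
  - by rewrite mulr_ge0 ?powR_ge0// ltW.
  - by move=> t; case: (KP (- tau.1) t).
have isx : cintegrable lebesgue_measure (fun t => (line_symbol a (- tau.1) t)%:C%C * expi
  (t * x.1)).
  apply: (cintegrableM_bounded isym (M := 1)); first exact: cmeasurable_expiZ.
  by move=> t; rewrite cnorm_expi.
rewrite -cintegral_gauss_expi /line_transform -cintegral_tensor2//;
  last exact: cintegrable_gauss_expi.
apply: eq_cintegral => xi; rewrite fourier_packet /gauss2 /line_symbol /=.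
rewrite !rmorphM [x.1 * _]mulrC [x.2 * _]mulrC expiD.
have -> : bessel_x s (- xi) = bessel_base (xi.1, 0) `^ a.
  by rewrite /bessel_x /bessel_base /= sqrrN expr0n /= addr0.
by ring.
Qed.

Variable m : R * R -> R[i].
Hypothesis m_meas : cmeasurable (m : R2 -> _).
Hypothesis m_bounded : exists2 M : R, 0 <= M & forall tau, cnorm (m tau) <= M.
Hypothesis m_lipschitz : exists2 K : R, 0 <= K & forall tau xi : R * R, tau.1 != 0 ->
  cnorm (m xi - m tau) <= K * (`|xi.1 - tau.1| + `|xi.2 - tau.2|) / `|tau.1|.

(** The phases cancel in the main term, and three Gaussians multiply to [gauss2 (3 * pi) 0], of
    integral 1/3. In both error terms a uniform error meets a decaying factor: the Gaussian in [A1]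
    for the error of [H], the decay of [H] and [e2] for the error of [F x]. *)
Lemma pairing_approx : exists2 K : R, 0 <= K & forall tau : R * R, 1 <= `|tau.1| ->
  let F := bilinear_multiplier m (packet (tau.1, 0)) (packet (0, tau.2)) in
  cintegrable leb2 (fun x => F x * dual_packet tau x) ->
  cnorm (cintegral leb2 (fun x => F x * dual_packet tau x) -
    (B tau.1)%:C%C * m tau * (3^-1)%:C%C) <= K * B tau.1 / `|tau.1|.
Proof.
have [M M0 HM] := m_bounded.
have [K1 K10 H1] := bilinear_multiplier_approx m_meas m_bounded m_lipschitz.
have [K2 K20 H2] := line_transform_decay a_gt0.
have [K3 K30 H3] := line_transform_approx a_gt0.
have p0 := @pi_gt0 R.
have [D D0 HD] := @gauss_le_decay R pi 0 p0.
have [D2 D20 HD2] := @gauss2_le_decay2 R pi 0 p0.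
pose K4 := M * D2 * K3 + K1 * (K2 * D).
have K40 : 0 <= K4 by rewrite addr_ge0// !mulr_ge0// ltW.
pose I := \int[leb2]_x (decay2 x : R).
have I0 : 0 <= I by apply: Rintegral_ge0 => x _; exact: decay2_ge0.
exists (2 * (K4 * I)); first by rewrite !mulr_ge0.
move=> tau t1 F iFp.
have n0 : 0 < `|tau.1| by exact: lt_le_trans t1.
have tau0 : tau.1 != 0 by rewrite -normr_gt0.
have p3 : 0 < 3 * pi :> R by rewrite mulr_gt0.
have [ig3 eg3] := integral_gauss2 (0 : R * R) p3.
have cube x : gauss2 pi 0 x ^+ 3 = gauss2 (3 * pi) 0 x :> R.
  by rewrite /gauss2 /gauss -!expRD -expRM_natl; congr expR; ring.
pose b := B tau.1.
have b0 : 0 <= b by exact: powR_ge0.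
have BN : B (- tau.1) = b by rewrite /b /B /bessel_base /= sqrrN.
pose main x : R[i] := ((b%:C)%C * m tau) * (gauss2 (3 * pi) 0 x)%:C%C.
have imain : cintegrable leb2 main by apply: cintegrableZ; exact: cintegrable_real.
have emain : cintegral leb2 main = (b%:C)%C * m tau * (3^-1)%:C%C.
  rewrite cintegralZ; last exact: cintegrable_real.
  rewrite cintegral_real eg3; congr (_ * (_%:C)%C).
  by rewrite invfM mulrCA divff ?mulr1// gt_eqF.
rewrite -emain -cintegralB//.
have idec := integrableZ_real (K4 * b / `|tau.1|) (@integrable_decay2 R).
have -> : 2 * (K4 * I) * B tau.1 / `|tau.1| = 2 * \int[leb2]_x (K4 * b / `|tau.1| * decay2 x).
  by rewrite RintegralZl//; [rewrite /I /b; ring|exact: integrable_decay2].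
apply: (le_cnorm_cintegral _ idec); first exact: cintegrableB.
move=> x; rewrite dual_packetE.
set H := line_transform a (- tau.1) x.1.
have HB : cnorm H <= K2 * b * decay x.1 by rewrite -BN; exact: H2.
have HA : cnorm (H - (b%:C)%C * ((gauss pi 0 x.1)%:C%C * expi
  (- tau.1 * x.1))) <= K3 * b / `|tau.1|.
  by have := H3 (- tau.1) x.1; rewrite normrN -/(B _) BN; apply.
have FA := H1 tau x tau0; rewrite -/F in FA.
set e2 := (gauss pi 0 x.2)%:C%C * expi (- tau.2 * x.2).
pose A1 := m tau * ((gauss2 pi 0 x ^+ 2)%:C%C * expi (x.1 * tau.1 + x.2 * tau.2)).
pose A2 := (b%:C)%C * ((gauss pi 0 x.1)%:C%C * expi (- tau.1 * x.1)).
have EM : main x = A1 * (A2 * e2).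
  rewrite /main -cube /A1 /A2 /e2 /gauss2 !rmorphXn rmorphM /=.
  have ee : expi (x.1 * tau.1 + x.2 * tau.2) * (expi (- tau.1 * x.1) * expi (- tau.2 * x.2)) =
    1 :> R[i].
    by rewrite -!expiD -[RHS]expi0; congr expi; ring.
  rewrite -[LHS]mulr1 -ee; ring.
have -> : F x * (H * e2) - main x = A1 * ((H - A2) * e2) + (F x - A1) * (H * e2).
  by rewrite EM; ring.
have g2 : 0 <= gauss pi 0 x.2 by exact: gauss_ge0.
have ne2 : cnorm e2 = gauss pi 0 x.2.
  by rewrite Normc.normcM cnorm_expi mulr1 cnorm_real ger0_norm.
have g1le (t : R) : gauss pi 0 t <= 1 by rewrite -expR0 ler_expR oppr_le0 mulr_ge0 ?sqr_ge0// ltW.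
have gg0 := @gauss2_ge0 R pi 0 x.
have gg1 : gauss2 pi 0 x <= 1 by rewrite mulr_ile1 ?gauss_ge0.
have nA1 : cnorm A1 <= M * gauss2 pi 0 x.
  rewrite !Normc.normcM cnorm_expi mulr1 cnorm_real ger0_norm ?sqr_ge0//.
  by apply: ler_pM; rewrite ?cnorm_ge0 ?sqr_ge0// expr2 ler_piMl.
have first_term : cnorm (A1 * ((H - A2) * e2)) <= M * D2 * K3 * b / `|tau.1| * decay2 x.
  rewrite Normc.normcM [cnorm (_ * e2)]Normc.normcM ne2.
  have z1 : cnorm (H - A2) * gauss pi 0 x.2 <= K3 * b / `|tau.1|.
    apply: le_trans HA; rewrite ler_piMr ?cnorm_ge0//.
  have z2 : cnorm A1 <= M * (D2 * decay2 x).
    by apply: (le_trans nA1); rewrite ler_wpM2l.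
  apply: (le_trans (ler_pM (cnorm_ge0 _) (mulr_ge0 (cnorm_ge0 _) g2) z2 z1)).
  by rewrite le_eqVlt; apply/orP; left; apply/eqP; ring.
have second_term : cnorm ((F x - A1) * (H * e2)) <= K1 * (K2 * D) * b / `|tau.1| * decay2 x.
  rewrite Normc.normcM [cnorm (H * e2)]Normc.normcM ne2.
  have z1 : cnorm H * gauss pi 0 x.2 <= K2 * b * decay x.1 * (D * decay x.2).
    by apply: ler_pM; rewrite ?cnorm_ge0.
  apply: (le_trans (ler_pM (cnorm_ge0 _) (mulr_ge0 (cnorm_ge0 _) g2) FA z1)).
  by rewrite /decay2 le_eqVlt; apply/orP; left; apply/eqP; ring.
apply: (le_trans (cnormD _ _)); apply: (le_trans (lerD first_term second_term)).
by rewrite le_eqVlt; apply/orP; left; apply/eqP; rewrite /K4; ring.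
Qed.

Lemma cnorm_cintegral_hoelder (r r' : R) (G h : R * R -> R[i]) (N : R) :
  0 < r -> 0 < r' -> r^-1 + r'^-1 = 1 -> cmeasurable (G : R2 -> _) -> cmeasurable (h : R2 -> _) ->
  cintegrable leb2 (fun x => G x * h x) -> (Lp_norm r' h <= N%:E)%E ->
  ((cnorm (cintegral leb2 (fun x => G x * h x)))%:E <= (2 * N)%:E * Lp_norm r G)%E.
Proof.
move=> r0 r'0 rr mG mh iGh hN.
have iabs := integrable_cnorm iGh.
have := le_cnorm_cintegral iGh iabs (fun=> lexx _); rewrite -lee_fin => /le_trans; apply.
have fI : (\int[leb2]_x (cnorm (G x * h x))%:E \is a fin_num)%E.
  exact: (integrable_fin_num measurableT iabs).
rewrite !EFinM -muleA lee_pmul2l//.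
have mcG := measurable_cnorm mG; have mch := measurable_cnorm mh.
have := hoelder leb2 mcG mch r0 r'0 rr.
rewrite Lnorm1 => H.
have -> : (\int[leb2]_x cnorm (G x * h x))%:E =
    (\int[leb2]_x `|(cnorm (G x) * cnorm (h x))%:E|)%E.
  rewrite /Rintegral fineK//; apply: eq_integral => x _ /=.
  by rewrite Normc.normcM ger0_norm// mulr_ge0 ?cnorm_ge0.
apply: (le_trans H); rewrite muleC; apply: lee_wpmul2r => //; exact: Lnorm_ge0.
Qed.

End duality_pairing.

Section packet_norm.
Context {R : realType}.

Lemma Lp_norm_packet_le (p : R) : 1 < p -> exists2 K : R, 0 <= K &
  forall tau, (Lp_norm p (packet tau) <= K%:E)%E.
Proof.
move=> p1; have [V V0 HV] := Lp_norm_le p1.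
have [D D0 HD] := @gauss2_le_decay2 R pi 0 (pi_gt0 R).
exists (4 * D * V); first by rewrite !mulr_ge0// ltW.
move=> tau; apply: HV; first exact/cintegrable_measurable/cintegrable_packet.
move=> x; rewrite cnorm_packet.
have H (t : R) : (1 + `|t|) * decay t <= 2.
  have t0 : 0 < 1 + `|t| by rewrite ltr_wpDr.
  by have := decay_le t; rewrite ler_pdivlMr// mulrC.
have w0 : 0 <= (1 + `|x.1|) * (1 + `|x.2|) by rewrite mulr_ge0 ?addr_ge0.
apply: (le_trans (ler_wpM2l w0 (HD x))).
have d0 (t : R) : 0 <= (1 + `|t|) * decay t by rewrite mulr_ge0 ?addr_ge0// ltW// decay_gt0.
have := ler_wpM2l (ltW D0) (ler_pM (d0 x.1) (d0 x.2) (H x.1) (H x.2)).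
by rewrite /decay2; congr (_ <= _); ring.
Qed.

End packet_norm.

(** * Comparison of both sides of the estimate on packets *)

Theorem proposition1 (R : realType) (m : R * R -> R[i])
  (m_smooth : smooth_on [set tau | tau != (0, 0)] m)
  (m_bound : forall b1 b2 : nat, exists C : R, forall tau : R * R,
     tau != (0, 0) ->
     cnorm (mixed_partial b1 b2 m tau)
       <= C * (`|tau.1| + `|tau.2|) ^- (b1 + b2))
  (p q r s : R) (p_gt1 : 1 < p) (q_gt1 : 1 < q) (r_gt1 : 1 < r)
  (pqr : 1 / p + 1 / q = 1 / r) (s_gt0 : 0 < s)
  (T_bound : exists C : R, forall f g : R * R -> R[i],
     schwartz f -> schwartz g ->
     (partial_sobolev_norm s r (bilinear_multiplier m f g)
        <= C%:E * Lp_norm p f * sobolev_norm s q g)%E) :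
  forall gamma : R, 0 < gamma -> exists2 c : R, 0 < c &
    [set tau : R * R | tau != (0, 0) /\ gamma <= cnorm (m tau)] `<=`
    [set tau : R * R | `|tau.1| <= c * (1 + `|tau.2|)].
Proof.
move=> gamma gamma0.
have [C HC] := T_bound.
have m_meas := multiplier_measurable m_smooth.
have m_bdd := multiplier_bounded m_bound.
have m_lip := multiplier_lipschitz m_smooth m_bound.
have [K K0 HK] := pairing_approx s_gt0 m_meas m_bdd m_lip.
have [Kp Kp0 HKp] := Lp_norm_packet_le p_gt1.
have [Kq Kq0 HKq] := sobolev_norm_packet_le s_gt0 q_gt1.
have r0 : 0 < r by lra.
have r10 : 0 < r - 1 by lra.
pose r' := r / (r - 1).
have r'0 : 0 < r' by rewrite divr_gt0.
have r'1 : 1 < r' by rewrite ltr_pdivlMr//; lra.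
have rr : r^-1 + r'^-1 = 1 by rewrite /r' invf_div; field; rewrite gt_eqF.
have [N N0 HN] := Lp_norm_packet_le r'1.
have a0 : 0 < s / 2 by rewrite divr_gt0.
pose B (t : R) := bessel_base (t, 0) `^ (s / 2).
have B0 t : 0 < B t by rewrite powR_gt0// bessel_base_gt0.
(* N + 1 rather than N keeps this positive for the division below; 2 is the factor in
   [cnorm_cintegral_hoelder]. *)
pose N1 := 2 * (N + 1).
have N10 : 0 < N1 by rewrite /N1; lra.
pose Z := N1 * (`|C| * Kp * Kq).
have Z0 : 0 <= Z by rewrite mulr_ge0 ?(ltW N10)// !mulr_ge0.
have key (tau : R * R) : 1 <= `|tau.1| -> gamma <= cnorm (m tau) ->
    B tau.1 * (gamma / 3 - K / `|tau.1|) <= Z * B tau.2.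
  move=> t1 mg.
  pose f := packet (tau.1, 0); pose g := packet (0, tau.2).
  set b := B tau.1 * _.
  have lower : ((b / N1)%:E <= partial_sobolev_norm s r (bilinear_multiplier m f g))%E.
    (* Every admissible [G] is tested on the packet of frequency - tau; the identity defining [G]
       turns that pairing into the one of [pairing_approx], and the infimum inherits the bound. *)
    apply: le_ereal_inf_tmp => _ [G [mG HG] <-].
    have [i1 i2 e] := HG _ (schwartz_packet (- tau.1, - tau.2)).
    have := HK tau t1 i2; rewrite -e => h.
    have NN : (Lp_norm r' (packet (- tau.1, - tau.2)%R) <= (N + 1)%:E)%E.
      by apply: (le_trans (HN _)); rewrite lee_fin lerDl.
    have mphi : cmeasurable (packet (- tau.1, - tau.2) :
      measurableTypeR R * measurableTypeR R -> _).
      exact/cintegrable_measurable/cintegrable_packet.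
    have hh := cnorm_cintegral_hoelder r0 r'0 rr mG mphi i1 NN.
    rewrite mulrC EFinM lee_pdivrMl//; apply: le_trans hh; rewrite lee_fin.
    set I := cintegral _ _ in h *.
    have h2 : B tau.1 * cnorm (m tau) / 3 <= K * B tau.1 / `|tau.1| + cnorm I.
      have -> : B tau.1 * cnorm (m tau) / 3 = cnorm ((B tau.1)%:C%C * m tau * (3^-1)%:C%C).
        by rewrite !Normc.normcM !cnorm_real !ger0_norm ?invr_ge0 ?(ltW (B0 _)).
      have -> : (B tau.1)%:C%C * m tau * (3^-1)%:C%C =
        I - (I - (B tau.1)%:C%C * m tau * (3^-1)%:C%C) by ring.
      by rewrite [leRHS]addrC (le_trans (cnormB _ _))// lerD2l.
    have h3 : B tau.1 * gamma / 3 <= B tau.1 * cnorm (m tau) / 3.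
      by rewrite ler_wpM2r ?invr_ge0// ler_wpM2l// ltW.
    rewrite /b mulrBr mulrA.
    have -> : B tau.1 * (K / `|tau.1|) = K * B tau.1 / `|tau.1| by ring.
    by lra.
  have upper : (C%:E * Lp_norm p f * sobolev_norm s q g <= (`|C| * Kp * (Kq * B tau.2))%:E)%E.
    have s0 : (0 <= sobolev_norm s q g)%E.
      by apply: le_ereal_inf_tmp => _ [G _ <-]; exact: Lnorm_ge0.
    have f0 : (0 <= Lp_norm p f)%E by exact: Lnorm_ge0.
    have eB : B tau.2 = bessel s (0, tau.2) by rewrite /B /bessel_base /bessel /= [_ + 0 ^+ 2]addrC.
    rewrite !EFinM; apply: (@le_trans _ _ (`|C|%:E * Lp_norm p f * sobolev_norm s q g)%E).
      by apply: lee_wpmul2r => //; apply: lee_wpmul2r => //; rewrite lee_fin ler_norm.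
    apply: lee_pmul => //; first by rewrite mule_ge0// lee_fin.
      by apply: lee_wpmul2l; [rewrite lee_fin|exact: HKp].
    by rewrite eB -EFinM; exact: HKq.
  have := le_trans lower (le_trans (HC f g (schwartz_packet _) (schwartz_packet _)) upper).
  rewrite lee_fin ler_pdivrMr// => /le_trans; apply.
  by rewrite le_eqVlt; apply/orP; left; apply/eqP; rewrite /Z; ring.
(* Once K / |tau1| <= gamma / 6, the bracket in [key] is at least gamma / 6, which gives the ratio 6
   Z / gamma; adding 1 makes [W] positive even if [Z] vanishes. *)
pose W := 6 * Z / gamma + 1.
have W0 : 0 < W by rewrite ltr_wpDl// divr_ge0 ?(ltW gamma0)// mulr_ge0.
(* The root undoes the power s / 2, so that the estimate becomes one between values of
   [bessel_base]. *)
pose w := W `^ (s / 2)^-1.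
have w0 : 0 < w by rewrite powR_gt0.
have Kg : 0 <= 6 * K / gamma by rewrite divr_ge0 ?mulr_ge0// ltW.
(* 1 secures |tau1| >= 1, 6 K / gamma makes the error small, and 1 + w contradicts the final bound
   |tau1|^2 <= w (1 + |tau2|)^2, since w <= (1 + w)^2. *)
exists (1 + w + 6 * K / gamma); first by lra.
move=> tau [/= _ mg]; rewrite leNgt; apply/negP => big.
have v0 : 0 <= `|tau.2| by [].
set n := `|tau.1| in big *; set v := `|tau.2| in big v0 *.
have cn : 1 + w + 6 * K / gamma < n.
  by apply: le_lt_trans big; rewrite ler_peMr ?lerDl//; lra.
have n1 : 1 <= n by lra.
have n0 : 0 < n by lra.
have small : K / n <= gamma / 6.
  rewrite ler_pdivrMr// mulrAC ler_pdivlMr// -ler_pdivrMl//.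
  have -> : gamma^-1 * (K * 6) = 6 * K / gamma by ring.
  by lra.
have h1 := key tau n1 mg; rewrite -/n in h1.
have h2 : B tau.1 <= W * B tau.2.
  have e1 : B tau.1 * (gamma / 6) <= Z * B tau.2.
    by apply: le_trans h1; rewrite ler_wpM2l ?(ltW (B0 _))//; lra.
  have e2 : B tau.1 <= 6 * Z / gamma * B tau.2.
    have := ler_wpM2l (ltW (divr_gt0 (ltr0Sn R 5) gamma0)) e1.
    congr (_ <= _); last by ring.
    by field; rewrite gt_eqF.
  by rewrite /W mulrDl mul1r (le_trans e2)// lerDl ltW.
have h3 : bessel_base (tau.1, 0) <= w * bessel_base (tau.2, 0).
  rewrite leNgt; apply/negP => lt.
  have := gt0_ltr_powR a0 _ _ lt; rewrite !nnegrE.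
  rewrite mulr_ge0 ?(ltW w0) ?(ltW (bessel_base_gt0 _))// => /(_ isT isT).
  rewrite powRM ?(ltW w0) ?(ltW (bessel_base_gt0 _))//.
  by rewrite /w -powRrM mulVf ?gt_eqF// powRr1 ?(ltW W0)// ltNge h2.
pose k : R := 4 * pi ^+ 2.
have k1 : 1 <= k by rewrite /k; have := @pi_ge2 R; nra.
have bb t : bessel_base (t, 0) = 1 + k * `|t| ^+ 2.
  by rewrite /bessel_base /= expr0n addr0 real_normK ?num_real.
rewrite !bb -/n -/v in h3.
have h4 : k * n ^+ 2 <= k * (w * (1 + v) ^+ 2).
  have kv : 1 + k * v ^+ 2 <= k * (1 + v) ^+ 2.
    have -> : k * (1 + v) ^+ 2 = k + 2 * (k * v) + k * v ^+ 2 by ring.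
    have k0 : 0 <= k by lra.
    by have := mulr_ge0 k0 v0; lra.
  have := ler_wpM2l (ltW w0) kv.
  have -> : w * (k * (1 + v) ^+ 2) = k * (w * (1 + v) ^+ 2) by ring.
  by move: h3; lra.
rewrite ler_pM2l in h4; last by lra.
have v1 : 0 < 1 + v by lra.
have h5 : (1 + w) * (1 + v) < n.
  by apply: le_lt_trans big; rewrite ler_wpM2r ?(ltW v1)//; lra.
have h6 : ((1 + w) * (1 + v)) ^+ 2 < n ^+ 2.
  by rewrite ltrXn2r// ?nnegrE ?(ltW n0)// mulr_ge0 ?(ltW v1)//; lra.
have h7 : w * (1 + v) ^+ 2 <= ((1 + w) * (1 + v)) ^+ 2.
  by rewrite exprMn ler_wpM2r ?sqr_ge0//; nra.
by have := le_lt_trans h7 h6; lra.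
Qed.
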